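(* Let $L$ be a finite flag simplicial complex that is superstar-transitive, and let $X$ be the unique (up to isomorphism) CAT(0) $L$-cube-complex. Then every finite set of pairwise transverse hyperplanes $\hat{\mathfrak h}_1,\ldots,\hat{\mathfrak h}_d$ in $X$ satisfies the hyperplane automorphism extension property (HAEP).
   Context: A CAT(0) cube complex is a 1-connected cube complex all of whose vertex links are flag simplicial complexes. For a vertex $x$ of a cube complex $X$, the link is the simplicial complex whose vertices are the edges incident to $x$ and whose simplices are the collections of edges at $x$ spanning cubes. An $L$-cube-complex is a cube complex all of whose vertex links are isomorphic to $L$. For a simplex $\sigma$ of $L$, the open star $\mathrm{st}_L(\sigma)$ is the union of all open simplices of $L$ whose closure intersects the closed simplex $\sigma$; an isomorphism between open stars is a bijection between their sets of open simplices preserving dimension and, in both directions, the face relation. $L$ is superstar-transitive if for any two (not necessarily distinct, nonempty) simplices $\sigma,\sigma'$ and any isomorphism $\phi:\mathrm{st}_L(\sigma)\to\mathrm{st}_L(\sigma')$ sending $\sigma$ to $\sigma'$ there is an automorphism $\Phi$ of $L$ with $\Phi|_{\mathrm{st}_L(\sigma)}=\phi$. When $L$ is finite, flag and superstar-transitive, there is exactly one CAT(0) $L$-cube-complex up to isomorphism, namely the Davis complex of the right-angled Coxeter group $W_L=\langle \xi\in L^{(0)}\mid \xi^2=1,\ [\xi,\zeta]=1 \text{ for } \xi,\zeta \text{ adjacent in } L\rangle$ (the Cayley graph of $W_L$ with bigons collapsed, with a cube added for each 1-skeleton of a cube). Hyperplanes of a CAT(0) cube complex are the usual unions of midcubes;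 each is itself a CAT(0) cube complex whose cubes are the midcubes. Two distinct hyperplanes are transverse if they intersect. For pairwise transverse hyperplanes, $\mathrm{Aut}(\hat{\mathfrak h}_1\cup\ldots\cup\hat{\mathfrak h}_d)$ is the group of automorphisms of the union that carry midcubes of the hyperplanes to midcubes of the hyperplanes. HAEP: a set of pairwise transverse hyperplanes $\hat{\mathfrak h}_1,\ldots,\hat{\mathfrak h}_d$ of $X$ satisfies the HAEP if for every $\hat f\in\mathrm{Aut}(\hat{\mathfrak h}_1\cup\ldots\cup\hat{\mathfrak h}_d)$ there exists $f\in\mathrm{Aut}(X)$ that stabilizes $\hat{\mathfrak h}_1\cup\ldots\cup\hat{\mathfrak h}_d$ and satisfies $f|_{\hat{\mathfrak h}_1\cup\ldots\cup\hat{\mathfrak h}_d}=\hat f$. *)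

(* Defs.v *)
From HB Require Import structures.
From Stdlib Require Import Relation_Operators.
From mathcomp Require Import all_boot all_order finmap.
From mathcomp Require Import boolp classical_sets functions cardinality.

Set Implicit Arguments.
Unset Strict Implicit.
Unset Printing Implicit Defensive.

Import Order.TTheory.

Local Open Scope classical_set_scope.
Local Open Scope order_scope.

(* A simplex is the nonempty finite set of its vertices; the empty complex is
   allowed. *)
Record scomplex := SComplex {
  svert : choiceType;
  simplex : set {fset svert};
  simplex_neq0 : forall s, simplex s -> s != fset0;
  simplex1 : forall v, simplex [fset v]%fset;
  simplexS : forall s t : {fset svert},
    simplex s -> (t `<=` s)%fset -> t != fset0 -> simplex t }.

Definition finite_scomplex (L : scomplex) := finite_set [set: svert L].

Definition flag (L : scomplex) :=
  forall s : {fset svert L}, s != fset0 ->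
    (forall u v, u \in s -> v \in s -> u != v -> simplex [fset u; v]%fset) ->
  simplex s.

Definition siso (L K : scomplex) (f : svert L -> svert K) :=
  bijective f /\
  forall s : {fset svert L}, simplex [fset f v | v in s]%fset <-> simplex s.

Definition isomorphic (L K : scomplex) := exists f, @siso L K f.

(* The open star of [s], as a set of open simplices: the closed simplices [t]
   and [s] meet exactly when they have a common vertex. *)
Definition open_star (L : scomplex) (s : {fset svert L}) : set {fset svert L} :=
  [set t | simplex t /\ (t `&` s)%fset != fset0].

Definition star_iso (L : scomplex) (s s' : {fset svert L})
    (phi : {fset svert L} -> {fset svert L}) :=
  [/\ set_bij (open_star s) (open_star s') phi,
      forall t, open_star s t -> #|` phi t| = #|` t| &
      forall t u, open_star s t -> open_star s u ->
        (phi t `<=` phi u)%fset = (t `<=` u)%fset].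

Definition superstar_transitive (L : scomplex) :=
  forall (s s' : {fset svert L}) (phi : {fset svert L} -> {fset svert L}),
    simplex s -> simplex s' -> star_iso s s' phi -> phi s = s' ->
  exists2 Phi : svert L -> svert L, siso Phi &
    forall t, open_star s t -> [fset Phi v | v in t]%fset = phi t.

(* A nonempty face of [0, 1]^n: [Some b] means that the coordinate is fixed to
   the value [b], and [None] that it is free. *)
Definition cface n := {ffun 'I_n -> option bool}.

Definition cface_le n (F G : cface n) :=
  [forall i, (G i == None) || (F i == G i)].

Definition cface_dim n (F : cface n) := #|[pred i | F i == None]|.

(* A cube complex is given by its poset of closed cells. Cubes are embedded, but
   two cubes may meet in more than one face; in the CAT(0) case this is
   excluded by [link_simplicial] below and simple connectivity. *)
Record cubeComplex := CubeComplex {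
  cell_disp : Order.disp_t;
  cell : porderType cell_disp;
  dim : cell -> nat;
  cell_cube : forall c, exists phi : cface (dim c) -> cell,
    [/\ {mono phi : F G / cface_le F G >-> F <= G},
        forall F, dim (phi F) = cface_dim F &
        forall b, b <= c <-> exists F, phi F = b] }.

Definition vertex (X : cubeComplex) (x : cell X) := dim x == 0%N.
Definition edge (X : cubeComplex) (e : cell X) := dim e == 1%N.

Definition automorphism (X : cubeComplex) (f : cell X -> cell X) :=
  bijective f /\ {mono f : c c' / c <= c'}.

(* The path x, e1, x1, e2, x2, ... is encoded by its starting point x and the
   sequence (e1, x1), (e2, x2), ... *)
Definition step (X : cubeComplex) (a b : cell X * cell X) :=
  [&& edge b.1, vertex b.2, a.2 <= b.1, b.2 <= b.1 & a.2 != b.2].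

Definition edge_path (X : cubeComplex) (x : cell X) (p : seq (cell X * cell X)) :=
  vertex x && path (@step X) (x, x) p.

Definition path_end (X : cubeComplex) (x : cell X) (p : seq (cell X * cell X)) :=
  (last (x, x) p).2.

(* Edge paths modulo homotopy across cells of dimension at most 2 compute the
   fundamental group. Homotopy across a 1-cell removes or inserts backtracks. *)
Inductive elementary_homotopy (X : cubeComplex) (x : cell X) :
    seq (cell X * cell X) -> seq (cell X * cell X) -> Prop :=
  ElementaryHomotopy (c : cell X) p r r' q :
    (dim c <= 2)%N ->
    edge_path x (p ++ r ++ q) -> edge_path x (p ++ r' ++ q) ->
    path_end x (p ++ r) = path_end x (p ++ r') ->
    all (fun a => a.1 <= c) r -> all (fun a => a.1 <= c) r' ->
    elementary_homotopy x (p ++ r ++ q) (p ++ r' ++ q).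

Definition homotopic (X : cubeComplex) (x : cell X) :=
  clos_refl_sym_trans _ (elementary_homotopy x).

Definition path_connected (X : cubeComplex) :=
  forall x y : cell X, vertex x -> vertex y ->
    exists2 p, edge_path x p & path_end x p = y.

Definition simply_connected (X : cubeComplex) :=
  forall (x : cell X) p, edge_path x p -> path_end x p = x ->
    homotopic x p [::].

Definition one_connected (X : cubeComplex) :=
  [/\ exists x : cell X, vertex x, path_connected X & simply_connected X].

Section Link.
Variables (X : cubeComplex) (x : cell X).

Definition edge_at : choiceType := {e : cell X | edge e && (x <= e)}.

Definition link_simplex : set {fset edge_at} :=
  [set s | s != fset0 /\
    exists2 c : cell X, x <= c & forall e, (e \in s) = (val e <= c)].

Lemma link_simplex_neq0 s : link_simplex s -> s != fset0.
Proof. by case. Qed.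

Lemma edge_le_eq (e e' : cell X) : edge e -> edge e' -> e' <= e -> e' = e.
Proof.
move=> /eqP de /eqP de' le_e'e.
have [phi [_ dphi im_phi]] := cell_cube e.
have full F : dim (phi F) = dim e -> F = [ffun=> None].
  move=> dF; apply/ffunP => i; rewrite ffunE.
  have cF : #|[pred i | F i == None]| = #|'I_(dim e)|.
    by rewrite [RHS]card_ord; apply: etrans dF; rewrite dphi.
  have /subset_cardP/(_ (subset_predT _)) := cF.
  by move=> /(_ i); rewrite !inE => /eqP.
have [F defF] := (im_phi e').1 le_e'e.
have [G defG] := (im_phi e).1 (lexx e).
have defF0 := full F (etrans (congr1 _ defF) (etrans de' (esym de))).
have defG0 := full G (congr1 _ defG).
by apply: etrans (esym defF) (etrans _ defG); rewrite defF0 defG0.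
Qed.

Lemma link_simplex1 e : link_simplex [fset e]%fset.
Proof.
split; first by apply/fset0Pn; exists e; rewrite inE.
case/andP: (valP e) => ee xe; exists (val e) => // e'.
case/andP: (valP e') => ee' xe'; rewrite inE; apply/eqP/idP => [-> // | le_e'e].
exact/val_inj/edge_le_eq.
Qed.

Lemma cface_edge_eq n (F G G' : cface n) i :
    cface_le F G -> cface_le F G' -> cface_dim G = 1%N -> cface_dim G' = 1%N ->
  G i = None -> G' i = None -> G = G'.
Proof.
have aux H j : cface_le F H -> cface_dim H = 1%N -> H i = None -> i != j ->
    F j = H j.
  move=> /forallP/(_ j) le_FH /eqP/card1P[k defk] Hi neq_ij.
  case/orP: le_FH => [Hj | /eqP //].
  have := defk i; have := defk j; rewrite !inE Hj Hi eqxx => /esym/eqP<-.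
  by move/esym; rewrite (negPf neq_ij).
move=> FG FG' dG dG' Gi G'i; apply/ffunP => j.
have [<- | neq_ij] := eqVneq i j; first by rewrite Gi G'i.
by rewrite -(aux G) // -(aux G').
Qed.

Lemma link_simplexS s t :
  link_simplex s -> (t `<=` s)%fset -> t != fset0 -> link_simplex t.
Proof.
move=> [_ [c xc def_s]] /fsubsetP ts t0; split=> //.
have [phi [mphi dphi im_phi]] := cell_cube c.
have [Fx defx] := (im_phi x).1 xc.
pose G : cface (dim c) :=
  [ffun i => if `[< exists2 F : cface (dim c), F i = None & exists2 e, e \in t & phi F = val e >]
             then None else Fx i].
have le_xG : cface_le Fx G.
  by apply/forallP => i; rewrite ffunE; case: ifP; rewrite ?eqxx ?orbT.
have faceP (e : edge_at) F :
    phi F = val e -> cface_le Fx F /\ cface_dim F = 1%N.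
  case/andP: (valP e) => /eqP de xe defF.
  by split; [rewrite -mphi defF defx | rewrite -dphi defF].
have face_of e : e \in t -> exists F, phi F = val e.
  by move=> et; apply/im_phi; rewrite -def_s ts.
exists (phi G) => [|e]; first by rewrite -[leLHS]defx mphi.
apply/idP/idP => [et | eG].
  have [F defF] := face_of e et; have [/forallP xF _] := faceP e F defF.
  rewrite -defF mphi; apply/forallP => i; rewrite ffunE.
  case: asboolP => // no; apply/orP; right; rewrite eq_sym.
  case/orP: (xF i) => // /eqP Fi.
  by case: no; exists F => //; exists e.
have [F defF] : exists F, phi F = val e.
  by apply/im_phi; apply: le_trans eG _; apply/im_phi; exists G.
have [xF dF] := faceP e F defF.
move: eG; rewrite -defF mphi => /forallP le_FG.
have /eqP/card1P[i /(_ i)] := dF; rewrite !inE eqxx => /eqP Fi.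
have [e' e't [F' F'i defF']] : exists2 e', e' \in t &
    exists2 F' : cface (dim c), F' i = None & phi F' = val e'.
  have := le_FG i; rewrite Fi ffunE.
  case: asboolP => [[F' F'i [e' e't defF']] _ | _ Fxi].
    by exists e' => //; exists F'.
  have {}Fxi : Fx i = None by case: (Fx i) Fxi.
  case/fset0Pn: t0 => e' e't; exists e' => //.
  have [F' defF'] := face_of e' e't; exists F' => //.
  have [/forallP/(_ i) xF' _] := faceP e' F' defF'.
  by move: xF'; rewrite Fxi => /orP[/eqP // | /eqP <-].
have [xF' dF'] := faceP e' F' defF'.
suff -> : e = e' by [].
by apply: val_inj; rewrite /= -defF -defF' (cface_edge_eq xF xF' dF dF' Fi).
Qed.

Definition link : scomplex :=
  SComplex link_simplex_neq0 link_simplex1 link_simplexS.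

(* The cubes at [x] form a simplicial complex: no two of them span the same set
   of edges at [x]. *)
Definition link_simplicial :=
  forall c c' : cell X, x <= c -> x <= c' ->
    (forall e, edge e -> x <= e -> (e <= c) = (e <= c')) -> c = c'.

End Link.

Definition cat0 (X : cubeComplex) :=
  one_connected X /\
  forall x : cell X, vertex x -> link_simplicial x /\ flag (link x).

Definition L_cube_complex (L : scomplex) (X : cubeComplex) :=
  forall x : cell X, vertex x -> isomorphic (link x) L.

Definition opposite (X : cubeComplex) (e e' : cell X) :=
  [/\ edge e, edge e', exists c : cell X, [/\ dim c = 2%N, e <= c & e' <= c] &
      ~ exists v : cell X, v <= e /\ v <= e'].

Definition parallel (X : cubeComplex) : cell X -> cell X -> Prop :=
  clos_refl_sym_trans _ (@opposite X).

(* A hyperplane is encoded by the set of the edges dual to it. In a CAT(0) cube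
   complex its intersection with a cube [c] is empty or a midcube of [c], and
   it is the latter exactly when [c] contains an edge dual to it. *)
Definition hyperplane (X : cubeComplex) (h : set (cell X)) :=
  exists2 e, edge e & h = [set e' | parallel e e'].

Definition crosses (X : cubeComplex) (h : set (cell X)) (c : cell X) :=
  exists2 e, h e & e <= c.

(* Two distinct midcubes of the same cube always intersect. *)
Definition transverse (X : cubeComplex) (h h' : set (cell X)) :=
  h <> h' /\ exists2 c, crosses h c & crosses h' c.

(* The union of a set [H] of hyperplanes is a cell complex whose cells are the
   nonempty intersections of midcubes. Such a cell is encoded by the pair (c, T)
   of the smallest cube [c] containing it and the set [T] of the hyperplanes
   in [H] containing it; it is the intersection of the midcubes of [c] dual to
   the members of [T], and it is itself a midcube when [T] is a singleton. *)
Definition ucell (X : cubeComplex) := (cell X * set (set (cell X)))%type.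

Definition union_cells (X : cubeComplex) (H : set (set (cell X))) :
    set (ucell X) :=
  [set m | [/\ m.2 `<=` H, m.2 !=set0 & forall h, m.2 h -> crosses h m.1]].

Definition ucell_le (X : cubeComplex) (m m' : ucell X) :=
  m.1 <= m'.1 /\ m'.2 `<=` m.2.

Definition is_midcube (X : cubeComplex) (m : ucell X) :=
  exists h, m.2 = [set h].

Definition union_aut (X : cubeComplex) (H : set (set (cell X)))
    (g : ucell X -> ucell X) :=
  [/\ set_bij (union_cells H) (union_cells H) g,
      forall m m', union_cells H m -> union_cells H m' ->
        ucell_le (g m) (g m') <-> ucell_le m m' &
      forall m, union_cells H m -> is_midcube (g m) <-> is_midcube m].

Definition ucell_act (X : cubeComplex) (f : cell X -> cell X) (m : ucell X) :
    ucell X :=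
  (f m.1, [set f @` h | h in m.2]).

Definition HAEP (X : cubeComplex) (H : set (set (cell X))) :=
  forall g, union_aut H g ->
  exists f : cell X -> cell X,
    [/\ automorphism f,
        [set ucell_act f m | m in union_cells H] = union_cells H &
        forall m, union_cells H m -> ucell_act f m = g m].

(* Main.v *)
From Stdlib Require Import Relation_Operators Operators_Properties.
Require Import Defs.
From mathcomp Require Import all_boot all_order finmap.
From mathcomp Require Import boolp classical_sets functions cardinality.

Set Implicit Arguments.
Unset Strict Implicit.
Unset Printing Implicit Defensive.

Import Order.TTheory.

Local Open Scope classical_set_scope.
Local Open Scope order_scope.

(** Let [x0] be a vertex incident to an edge dual to each of the hyperplanes of
   [H]; it exists by the Helly property [helly]. An automorphism [g] of the union
   of the hyperplanes amounts to a permutation of [H] and an automorphism [G] of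
   the poset of the cubes that meet the union ([uautE], [uaut_cube_le]). One
   looks for an automorphism of the complex that extends [G] and builds it
   vertex by vertex, by induction on the distance to [x0]: at each vertex [x] one
   chooses a germ, that is, an isomorphism from the poset of the cubes at [x] to
   the poset of the cubes at some vertex.

   At [x], the values of the germ are imposed on the cubes containing an edge
   that descends towards [x0], by the germs at the lower neighbours, and on the
   cubes containing an edge dual to a member of [H], by [G]. All these edges
   pairwise span squares: two descending edges by [desc_Sq], a descending edge
   and a dual edge by [hyp_desc_Sq], because [x0] is adjacent to the hyperplane,
   and two dual edges by [transverse_cross]. Flagness then gives a simplex of the
   link whose open star is the set of the cubes with an imposed image. The
   constraints agree with each other ([desc_agree], [desc_image], [hyp_image]) and
   form an isomorphism of open stars, which superstar-transitivity extends to the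
   whole link ([germ_extension], [coherent_step]). Germs chosen in this way agree
   along edges, so they glue ([germ_system]) to a local isomorphism, which is
   bijective because the complex is simply connected ([f_vertex_inj]). It maps
   each dual edge as [G] does, so it permutes the hyperplanes as [g] does.

   The geometry needed for this is deduced from simple connectivity and flag
   links, and not from the CAT(0) metric. Simple connectivity enters through the
   principle of monodromy: an action of edges on some fibres that is coherent
   around squares is trivial along closed walks ([monodromy]). Applied to
   classes of reduced walks modulo moves across squares, it shows that reduced
   walks with given ends are unique modulo these moves ([red_uniq]), as in the
   solution of the word problem for right-angled Coxeter groups. The
   combinatorial core is [lev_trans], an analogue of the Levi lemma, where three
   squares at a vertex are completed to a cube. The length of reduced walks is
   then a distance with the expected properties. Hyperplanes are studied through
   ladders, the strips of squares along which a dual edge is transported; they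
   can be moved across squares like the walks that carry them ([ladder_lev]). *)

(** * Faces of a cube *)

Section FaceOrder.
Variable n : nat.
Implicit Types F G : cface n.

Lemma cface_leP F G i b : cface_le F G -> G i = Some b -> F i = Some b.
Proof. by move=> /forallP/(_ i)/orP[/eqP->|/eqP->]. Qed.

Lemma cface_le_None F G i : cface_le F G -> F i = None -> G i = None.
Proof.
by move=> FG Fi; case Gi: (G i) => [b|] //; rewrite (cface_leP FG Gi) in Fi.
Qed.

Lemma cface_le_dim F G : cface_le F G -> (cface_dim F <= cface_dim G)%N.
Proof.
move=> FG; apply/subset_leq_card/fintype.subsetP=> i; rewrite !inE => /eqP Fi.
by rewrite (cface_le_None FG Fi).
Qed.

Lemma cface_le_dim_eq F G :
  cface_le F G -> cface_dim F = cface_dim G -> F = G.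
Proof.
move=> FG dFG; have sub : [pred i | F i == None] \subset [pred i | G i == None].
  by apply/fintype.subsetP=> i; rewrite !inE => /eqP Fi; rewrite (cface_le_None FG Fi).
have /subset_cardP/(_ sub) eFG := dFG; apply/ffunP=> i.
have /orP[Gi|/eqP //] := forallP FG i.
by move: (eFG i); rewrite !inE Gi => /eqP->; apply/esym/eqP.
Qed.

Definition face0 : cface n := [ffun=> Some false].
Definition dirface (i : 'I_n) : cface n :=
  [ffun j => if j == i then None else Some false].

Lemma face0_dim : cface_dim face0 = 0%N.
Proof. by apply: eq_card0 => i; rewrite !inE ffunE. Qed.

Lemma dirface_dim i : cface_dim (dirface i) = 1%N.
Proof.
by apply/eqP/card1P; exists i => j; rewrite !inE ffunE; case: (j == i).
Qed.

Lemma face0_dir i : cface_le face0 (dirface i).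
Proof. by apply/forallP=> j; rewrite !ffunE; case: (j == i). Qed.

Lemma cface_dim0P F i : cface_dim F = 0%N -> exists b, F i = Some b.
Proof.
move=> /card0_eq/(_ i); rewrite !inE.
by case: (F i) => // b _; exists b.
Qed.

Lemma face0_le F i b : cface_le face0 F -> F i = Some b -> b = false.
Proof. by move=> xF Fi; have := cface_leP xF Fi; rewrite ffunE => -[]. Qed.

Lemma dirface_le F i : cface_le face0 F -> cface_le (dirface i) F = (F i == None).
Proof.
move=> xF; apply/idP/eqP => [iF|Fi].
  by apply: (cface_le_None iF); rewrite ffunE eqxx.
apply/forallP=> j; rewrite ffunE; case: (j =P i) => [->|_].
  by rewrite Fi eqxx.
by case Fj: (F j) => [b|] //=; rewrite (face0_le xF Fj).
Qed.

Lemma cface_dim1P F : cface_le face0 F -> cface_dim F = 1%N -> exists i, F = dirface i.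
Proof.
move=> xF dF; have /eqP/card1P[i /(_ i)] := dF; rewrite !inE eqxx => /eqP Fi.
by exists i; apply/esym/cface_le_dim_eq; rewrite ?dirface_dim // dirface_le // Fi.
Qed.

End FaceOrder.

Section Embedding.
Variables (k n : nat) (d : 'I_k -> 'I_n).
Hypothesis d_inj : injective d.

Definition emb (F : cface k) : cface n :=
  [ffun i => if [pick j | d j == i] is Some j then F j else Some false].

Lemma emb_d F j : emb F (d j) = F j.
Proof.
rewrite ffunE; case: pickP => [j' /eqP/d_inj-> //|/(_ j)]; by rewrite eqxx.
Qed.

Lemma emb_out F i : (forall j, d j <> i) -> emb F i = Some false.
Proof.
by move=> out; rewrite ffunE; case: pickP => // j /eqP /out.
Qed.

Lemma emb_dirP i : (exists j, d j = i) \/ (forall j, d j <> i).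
Proof.
case: (pickP (fun j => d j == i)) => [j /eqP<-|out]; first by left; exists j.
by right=> j dj; have := out j; rewrite dj eqxx.
Qed.

Lemma emb_mono : {mono emb : F G / cface_le F G}.
Proof.
move=> F G; apply/forallP/forallP => FG i.
  by have := FG (d i); rewrite !emb_d.
have [[j <-]|out] := emb_dirP i; first by rewrite !emb_d.
by rewrite !emb_out ?eqxx ?orbT.
Qed.

Lemma emb_dim F : cface_dim (emb F) = cface_dim F.
Proof.
rewrite /cface_dim -(card_in_image (in2W d_inj)).
apply: eq_card => i.
apply/idP/fintype.imageP => [|[j]]; rewrite inE => /eqP Fi; last first.
  by move=> ->; rewrite inE emb_d Fi.
have [[j dj]|out] := emb_dirP i; last by rewrite emb_out in Fi.
by exists j; rewrite // inE -Fi -dj emb_d.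
Qed.

Lemma emb_down F G : cface_le G (emb F) -> exists F', G = emb F'.
Proof.
move=> GF; exists [ffun j => G (d j)]; apply/ffunP=> i.
have [[j <-]|out] := emb_dirP i; first by rewrite emb_d ffunE.
by rewrite [RHS]emb_out //; apply: (cface_leP GF); rewrite emb_out.
Qed.

Lemma emb0 : emb (face0 k) = face0 n.
Proof.
apply/ffunP=> i; have [[j <-]|out] := emb_dirP i; first by rewrite emb_d !ffunE.
by rewrite emb_out // ffunE.
Qed.

Lemma emb_dir j : emb (dirface j) = dirface (d j).
Proof.
apply/ffunP=> i; have [[j' <-]|out] := emb_dirP i.
  by rewrite emb_d !ffunE (inj_eq d_inj).
by rewrite emb_out // ffunE; case: eqP => // /esym/out.
Qed.

End Embedding.

(** * Cells of a cube complex *)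

Section Cells.
Variable X : cubeComplex.
Implicit Types (x y c e s : cell X).

Lemma dim_le c c' : c <= c' -> (dim c <= dim c')%N.
Proof.
have [phi [mphi dphi im]] := cell_cube c' => cc'.
have [F eF] := (im c).1 cc'; have [G eG] := (im c').1 (lexx c').
by rewrite -eF -[X in (_ <= dim X)%N]eG !dphi cface_le_dim // -mphi eF eG.
Qed.

Lemma dim_le_eq c c' : c <= c' -> dim c = dim c' -> c = c'.
Proof.
have [phi [mphi dphi im]] := cell_cube c' => cc'.
have [F eF] := (im c).1 cc'; have [G eG] := (im c').1 (lexx c').
have FG : cface_le F G by rewrite -mphi eF eG.
move=> dcc'; rewrite -eF -[RHS]eG; congr phi; apply: (cface_le_dim_eq FG).
by rewrite -!dphi eF eG.
Qed.

Lemma dim_lt c c' : c < c' -> (dim c < dim c')%N.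
Proof.
rewrite lt_neqAle => /andP[ne le]; rewrite ltn_neqAle (dim_le le) andbT.
by apply: contra ne => /eqP/(dim_le_eq le)->.
Qed.

(** Flipping coordinates is a symmetry of the cube; flipping those where [x] has
   the value [true] moves [x] to the origin. *)
Lemma chart_at x c : vertex x -> x <= c ->
  exists phi : cface (dim c) -> cell X,
    [/\ {mono phi : F G / cface_le F G >-> F <= G},
        forall F, dim (phi F) = cface_dim F,
        forall b, b <= c <-> exists F, phi F = b & phi (face0 _) = x].
Proof.
move=> /eqP dx xc; have [phi [mphi dphi im]] := cell_cube c.
have [F0 eF0] := (im x).1 xc.
have F0P i : exists b, F0 i = Some b.
  by apply: cface_dim0P; rewrite -dphi eF0.
pose tw (F : cface (dim c)) : cface (dim c) :=
  [ffun i => if F0 i is Some b then omap (addb b) (F i) else F i].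
have twK : involutive tw.
  move=> F; apply/ffunP=> i; rewrite !ffunE; have [b ->] := F0P i.
  by case: (F i) => //= b'; rewrite addKb.
have tw_None F i : (tw F i == None) = (F i == None).
  by rewrite ffunE; have [b ->] := F0P i; case: (F i).
exists (phi \o tw); split=> [F G|F|b|] /=.
- rewrite mphi; apply: eq_forallb => i; rewrite tw_None; congr (_ || _).
  rewrite !ffunE; have [b ->] := F0P i.
  by case: (F i) (G i) => [u|] [v|] //=; case: u v b => [] [] [].
- by rewrite dphi; apply: eq_card => i; rewrite !inE tw_None.
- split=> [/im[F <-]|[F <-]]; last by apply/im; exists (tw F).
  by exists (tw F); rewrite twK.
- rewrite -eF0; congr phi; apply/ffunP=> i; rewrite !ffunE.
  by have [b ->] := F0P i => /=; rewrite addbF.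
Qed.

(** In a chart at [x] the edges are coordinate directions, and the face that they
   span is a cube having them as all its directions. *)
Lemma subcube x c k (E : 'I_k -> cell X) : vertex x -> injective E ->
  (forall j, [/\ edge (E j), x <= E j & E j <= c]) -> x <= c ->
  exists psi : cface k -> cell X,
    [/\ {mono psi : F G / cface_le F G >-> F <= G},
        forall F, dim (psi F) = cface_dim F,
        forall F b, b <= psi F -> exists F', psi F' = b,
        psi (face0 _) = x & (forall j, psi (dirface j) = E j) /\
        forall F, psi F <= c].
Proof.
move=> vx E_inj EP xc; have [phi [mphi dphi im phi0]] := chart_at vx xc.
have /choice[d dP] : forall j, exists i, phi (dirface i) = E j.
  move=> j; have [/eqP ej xj jc] := EP j.
  have [F eF] := (im (E j)).1 jc.
  have xF : cface_le (face0 _) F by rewrite -mphi phi0 eF.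
  have [i eFi] : exists i, F = dirface i.
    by apply: (cface_dim1P xF); rewrite -dphi eF.
  by exists i; rewrite -eFi.
have d_inj : injective d by move=> i j dij; apply: E_inj; rewrite -!dP dij.
exists (phi \o emb d); split=> [F G|F|F b|/=|] /=.
- by rewrite mphi emb_mono.
- by rewrite dphi emb_dim.
- move=> bF; have /im[G eG] : b <= c by apply: le_trans bF _; apply/im; exists (emb d F).
  move: bF; rewrite -eG mphi => /(emb_down d_inj)[F' ->]; by exists F'.
- by rewrite emb0.
- split=> [j|F]; first by rewrite emb_dir.
  by apply/im; exists (emb d F).
Qed.

Lemma vertex_below c : exists2 x, vertex x & x <= c.
Proof.
have [phi [mphi dphi im]] := cell_cube c.
exists (phi (face0 _)); last by apply/im; exists (face0 _).
by rewrite /vertex dphi face0_dim.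
Qed.

Lemma coatom c c' : c < c' -> exists b, [/\ c <= b, b < c' & (dim b).+1 = dim c'].
Proof.
move=> cc'; have [phi [mphi dphi im]] := cell_cube c'.
have [F eF] := (im c).1 (ltW cc'); have [G eG] := (im c').1 (lexx c').
have full i : G i = None.
  have : cface_dim G = #|'I_(dim c')| by rewrite card_ord -dphi eG.
  by move/subset_cardP/(_ (subset_predT _))/(_ i); rewrite !inE => /eqP.
have [i [b Fi]] : exists i b, F i = Some b.
  apply: contrapT => no; have : F = G.
    apply/ffunP=> i; rewrite full; case Fi: (F i) => [b|] //.
    by case: no; exists i, b.
  by move=> FG; move: cc'; rewrite -eF -eG FG ltxx.
pose B : cface (dim c') := [ffun j => if j == i then Some b else None].
have dB : (dim (phi B)).+1 = dim c'.
  rewrite dphi -[RHS]card_ord (cardD1 i) inE /= add1n; congr _.+1.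
  by apply: eq_card => j; rewrite !inE ffunE; case: (j == i).
exists (phi B); split => //.
  rewrite -eF mphi; apply/forallP=> j; rewrite ffunE.
  by case: (j =P i) => // ->; rewrite Fi eqxx.
rewrite lt_neqAle -{2}eG mphi; apply/andP; split.
  by apply/eqP => eB; move: dB; rewrite eB => /eqP; rewrite eqn_leq ltnn.
by apply/forallP=> j; rewrite full eqxx.
Qed.

End Cells.

(** A cell is reached from any of its faces by a chain of cells whose dimensions
   increase by one, and a strictly monotone map does not shorten this chain. *)
Lemma mono_dim (X Y : cubeComplex) (a : cell X) (F : cell X -> cell Y) :
  (forall c c', a <= c -> c < c' -> F c < F c') ->
  forall c, a <= c -> (dim (F a) + dim c <= dim (F c) + dim a)%N.
Proof.
move=> mF c; have [m] := ubnP (dim c); elim: m c => // m IH c cm ac.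
have [->//|ne] := eqVneq a c.
have [b [ab bc db]] : exists b, [/\ a <= b, b < c & (dim b).+1 = dim c].
  by apply: coatom; rewrite lt_neqAle ne.
have /IH/(_ ab) IHb : (dim b < m)%N by rewrite db.
rewrite -db addnS; apply: (leq_ltn_trans IHb).
by rewrite ltn_add2r dim_lt // mF.
Qed.

(** * Squares *)

Definition leo (p q : option bool) := (q == None) || (p == q).

Local Notation N := (@None bool).
Local Notation f0 := (Some false).
Local Notation t1 := (Some true).

Definition mk2 p q : cface 2 := [ffun i => if i == ord0 then p else q].
Definition mk3 p q r : cface 3 :=
  [ffun i => if i == ord0 then p else if i == ord_max then r else q].

Lemma cface_dimE n (F : cface n) : cface_dim F = (\sum_i (F i == None))%N.
Proof. by rewrite /cface_dim -sum1_card big_mkcond. Qed.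

Lemma cface_leE n (F G : cface n) : cface_le F G = \big[andb/true]_i leo (F i) (G i).
Proof. by rewrite big_andE. Qed.

Lemma mk2_le p q p' q' : cface_le (mk2 p q) (mk2 p' q') = leo p p' && leo q q'.
Proof. by rewrite cface_leE !big_ord_recl big_ord0 !ffunE /= andbT. Qed.

Lemma mk2_dim p q : cface_dim (mk2 p q) = ((p == N) + (q == N))%N.
Proof. by rewrite cface_dimE !big_ord_recl big_ord0 !ffunE /= addn0. Qed.

Lemma mk2_ex F : exists p q, F = mk2 p q.
Proof.
exists (F ord0), (F ord_max); apply/ffunP=> i; rewrite ffunE.
by case: i => [[|[|i]] Hi] //; rewrite -val_eqE /=; congr (F _); apply: val_inj.
Qed.

Lemma mk3_le p q r p' q' r' :
  cface_le (mk3 p q r) (mk3 p' q' r') = [&& leo p p', leo q q' & leo r r'].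
Proof. by rewrite cface_leE !big_ord_recl big_ord0 !ffunE /= andbT. Qed.

Lemma mk3_dim p q r :
  cface_dim (mk3 p q r) = ((p == N) + ((q == N) + (r == N)))%N.
Proof. by rewrite cface_dimE !big_ord_recl big_ord0 !ffunE /= addn0. Qed.

Lemma mk3_ex F : exists p q r, F = mk3 p q r.
Proof.
exists (F ord0), (F (inord 1)), (F ord_max); apply/ffunP=> i; rewrite ffunE.
case: i => [[|[|[|i]]] Hi] //; rewrite -!val_eqE /=; congr (F _); apply: val_inj => //=.
by rewrite inordK.
Qed.

Section Squares.
Variable X : cubeComplex.
Implicit Types (x y c e s : cell X) (a b k : cell X * cell X).

Definition dart x a := vertex x && step (x, x) a.
Definition drev x a : cell X * cell X := (a.1, x).

Lemma dartP x a : reflect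
  [/\ [/\ vertex x, edge a.1 & vertex a.2], x <= a.1, a.2 <= a.1 & x != a.2]
  (dart x a).
Proof.
by apply: (iffP and5P) => [[? ? ? ? /andP[? ?]]|[[? ? ?] ? ? ?]];
  split=> //; apply/andP.
Qed.

Lemma dart_rev x a : dart x a -> dart a.2 (drev x a).
Proof. by case/dartP=> [[? ? ?] ? ? ne]; apply/dartP; rewrite /= eq_sym. Qed.

Lemma drevK x a : drev a.2 (drev x a) = a.
Proof. by case: a. Qed.

(** Coordinates on the faces of a square, resp. of a 3-cube, encoded as in [cface]
   but with the entries as separate arguments, so that statements about faces
   are decided by case analysis on the arguments. *)
Definition chart2 (psi : option bool -> option bool -> cell X) :=
  [/\ forall p q p' q', (psi p q <= psi p' q') = leo p p' && leo q q',
      forall p q, dim (psi p q) = ((p == N) + (q == N))%N &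
      forall p q z, z <= psi p q -> exists p' q', z = psi p' q'].

Definition chart3 (psi : option bool -> option bool -> option bool -> cell X) :=
  [/\ forall p q r p' q' r',
        (psi p q r <= psi p' q' r') = [&& leo p p', leo q q' & leo r r'],
      forall p q r, dim (psi p q r) = ((p == N) + ((q == N) + (r == N)))%N &
      forall p q r z, z <= psi p q r -> exists p' q' r', z = psi p' q' r'].

Lemma chart2_inj psi p q p' q' : chart2 psi -> psi p q = psi p' q' -> p = p' /\ q = q'.
Proof.
move=> [m _ _] e; have := m p q p' q'; have := m p' q' p q.
rewrite e lexx => /esym/andP[+ +] /esym/andP[].
by case: p p' q q' {e} => [[]|] [[]|] [[]|] [[]|].
Qed.

Lemma chart2_sym psi : chart2 psi -> chart2 (fun p q => psi q p).
Proof.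
case=> m d w; split=> [*|*|p q b /w[p' [q' ->]]]; rewrite ?m 1?andbC //.
  by rewrite d addnC.
by exists q', p'.
Qed.

Lemma chart2_flip psi : chart2 psi -> chart2 (fun p q => psi (omap negb p) q).
Proof.
case=> m d w; split=> [p q p' q'|p q|p q b /w[p' [q' ->]]].
- by rewrite m; congr andb; case: p p' => [[]|] [[]|].
- by rewrite d; case: p => [[]|].
- by exists (omap negb p'), q'; case: p' => [[]|].
Qed.

Lemma edge_chart x e : vertex x -> edge e -> x <= e ->
  exists psi : option bool -> cell X,
    [/\ forall p p', (psi p <= psi p') = leo p p',
        forall p, dim (psi p) = (p == N),
        forall z, z <= e -> exists p, z = psi p, psi f0 = x & psi N = e].
Proof.
move=> vx /eqP de xe; have := chart_at vx xe; rewrite de => -[phi [m d w phi0]].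
have F1 (F : cface 1) : F = [ffun=> F ord0].
  by apply/ffunP=> i; rewrite ffunE (ord1 i).
exists (fun p => phi [ffun=> p]); split=> [p p'|p|b /w[F <-]||].
- by rewrite m cface_leE big_ord_recl big_ord0 !ffunE andbT.
- by rewrite d cface_dimE big_ord_recl big_ord0 ffunE addn0.
- by exists (F ord0); rewrite -F1.
- by rewrite -phi0.
- have /w[F eF] := lexx e; rewrite -[RHS]eF; congr phi; rewrite [RHS]F1.
  apply/ffunP=> i; rewrite !ffunE; case F0: (F ord0) => [b|] //.
  by have := d F; rewrite eF de cface_dimE big_ord_recl big_ord0 F0.
Qed.

Lemma dart_ex x e : vertex x -> edge e -> x <= e -> exists v, dart x (e, v).
Proof.
move=> vx ee xe; have [psi [m d _ p0 pN]] := edge_chart vx ee xe.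
exists (psi t1); apply/dartP; split; rewrite //= -?pN ?m //.
  by split=> //; rewrite ?pN // /vertex d.
by apply/eqP => e0; have := m f0 t1; rewrite p0 e0 lexx.
Qed.

Lemma dart_end x a v : dart x a -> vertex v -> v <= a.1 -> v = x \/ v = a.2.
Proof.
case/dartP=> [[vx ea va] xa aa ne] vv vle.
have [psi [m d w p0 pN]] := edge_chart vx ea xa.
have {w}W u : vertex u -> u <= a.1 -> u = x \/ u = psi t1.
  move=> vu /w[p eu]; move: vu; rewrite eu /vertex d.
  by case: p {eu} => [[]|] // _; [right | left].
case: (W _ vv vle) => [->|->]; [by left | right].
by case: (W _ va aa) => [e|->] //; rewrite e eqxx in ne.
Qed.

Lemma dart_uniq x a b : dart x a -> dart x b -> a.1 = b.1 -> a = b.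
Proof.
move=> xa /dartP[[_ _ vb] _ bb ne] e1; rewrite -e1 in bb.
case: (dart_end xa vb bb) => e2; first by rewrite e2 eqxx in ne.
by case: a b e1 e2 {xa vb bb ne} => a1 a2 [b1 b2] /= -> ->.
Qed.

Lemma square_chart x e1 e2 c : vertex x -> e1 <> e2 -> edge e1 -> edge e2 ->
  x <= e1 -> x <= e2 -> e1 <= c -> e2 <= c ->
  exists psi, [/\ chart2 psi, psi f0 f0 = x, psi N f0 = e1, psi f0 N = e2 &
    psi N N <= c].
Proof.
move=> vx ne ee1 ee2 x1 x2 l1 l2.
pose E (j : 'I_2) := if val j is 0%N then e1 else e2.
have E_inj : injective E.
  by case=> [[|[|i]] Hi] [[|[|j]] Hj] //= H; apply: val_inj => //; case: ne.
have EP j : [/\ edge (E j), x <= E j & E j <= c].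
  by rewrite /E; case: (val j).
have [phi [m d w phi0 [phid phic]]] := subcube vx E_inj EP (le_trans x1 l1).
exists (fun p q => phi (mk2 p q)); split=> //.
- split=> [*|*|p q b /w[F <-]]; rewrite ?m ?d ?mk2_le ?mk2_dim //.
  by have [p' [q' ->]] := mk2_ex F; exists p', q'.
- by rewrite -phi0; congr phi; apply/ffunP=> i; rewrite !ffunE; case: ifP.
- exact: (phid ord0).
- rewrite -(phid ord_max : _ = e2); congr phi; apply/ffunP.
  by case=> [[|[|i]] Hi] //; rewrite !ffunE -?val_eqE.
Qed.

Lemma cube_chart x e1 e2 e3 c : vertex x -> e1 <> e2 -> e1 <> e3 -> e2 <> e3 ->
  edge e1 -> edge e2 -> edge e3 -> x <= e1 -> x <= e2 -> x <= e3 ->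
  e1 <= c -> e2 <= c -> e3 <= c ->
  exists psi, [/\ chart3 psi, psi f0 f0 f0 = x, psi N f0 f0 = e1, psi f0 N f0 = e2 &
    psi f0 f0 N = e3].
Proof.
move=> vx n12 n13 n23 ee1 ee2 ee3 x1 x2 x3 l1 l2 l3.
pose E (j : 'I_3) := match val j with 0%N => e1 | 1%N => e2 | _ => e3 end.
have E_inj : injective E.
  by case=> [[|[|[|i]]] Hi] [[|[|[|j]]] Hj] //= H; apply: val_inj => //;
    by [case: n12 | case: n13 | case: n23].
have EP j : [/\ edge (E j), x <= E j & E j <= c].
  by rewrite /E; case: (val j) => [|[|]].
have [phi [m d w phi0 [phid phic]]] := subcube vx E_inj EP (le_trans x1 l1).
exists (fun p q r => phi (mk3 p q r)); split=> //.
- split=> [*|*|p q r b /w[F <-]]; rewrite ?m ?d ?mk3_le ?mk3_dim //.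
  by have [p' [q' [r' ->]]] := mk3_ex F; exists p', q', r'.
- rewrite -phi0; congr phi; apply/ffunP=> i; rewrite !ffunE.
  by case: ifP => // _; case: ifP.
- rewrite -(phid ord0 : _ = e1); congr phi; apply/ffunP.
  by case=> [[|[|[|i]]] Hi] //; rewrite !ffunE -?val_eqE.
- have E1 : E (inord 1) = e2 by rewrite /E /= inordK.
  rewrite -E1 -phid; congr phi; apply/ffunP.
  by case=> [[|[|[|i]]] Hi] //; rewrite !ffunE -?val_eqE /= inordK.
- rewrite -(phid ord_max : _ = e3); congr phi; apply/ffunP.
  by case=> [[|[|[|i]]] Hi] //; rewrite !ffunE -?val_eqE.
Qed.

(** [Sq x a b a' b']: the darts [a] and [b] at [x] are two sides of a square
   whose two other sides are [a'], issued from the end of [b] and opposite to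
   [a], and [b'], issued from the end of [a] and opposite to [b]. *)
Definition Sq x a b a' b' := exists2 psi, chart2 psi &
  [/\ x = psi f0 f0, a = (psi N f0, psi t1 f0), b = (psi f0 N, psi f0 t1),
      a' = (psi N t1, psi t1 t1) & b' = (psi t1 N, psi t1 t1)].

Lemma Sq_sym x a b a' b' : Sq x a b a' b' -> Sq x b a b' a'.
Proof. by case=> psi /chart2_sym cpsi [*]; exists (fun p q => psi q p). Qed.

Lemma Sq_rot x a b a' b' : Sq x a b a' b' -> Sq a.2 (drev x a) b' (drev b.2 a') b.
Proof.
case=> psi /chart2_flip cpsi [-> -> -> -> ->].
by exists (fun p q => psi (omap negb p) q).
Qed.

Lemma Sq_dart x a b a' b' : Sq x a b a' b' -> dart x a.
Proof.
case=> psi cpsi [-> -> _ _ _]; have [m d _] := cpsi.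
apply/dartP; rewrite /vertex /edge /= !m !d; split=> //.
by apply/eqP => /(chart2_inj cpsi)[].
Qed.

Lemma Sq_dart2 x a b a' b' : Sq x a b a' b' -> dart x b.
Proof. by move=> /Sq_sym/Sq_dart. Qed.

Lemma Sq_dart3 x a b a' b' : Sq x a b a' b' -> dart a.2 b'.
Proof. by move=> /Sq_rot/Sq_dart2. Qed.

Lemma Sq_dart4 x a b a' b' : Sq x a b a' b' -> dart b.2 a'.
Proof. by move=> /Sq_sym/Sq_dart3. Qed.

Lemma Sq_neq1 x a b a' b' : Sq x a b a' b' -> a.1 <> b.1.
Proof. by case=> psi cpsi [_ -> -> _ _] /(chart2_inj cpsi)[]. Qed.

Lemma Sq_neq x a b a' b' : Sq x a b a' b' -> a <> b.
Proof. by move=> /Sq_neq1 ne e; apply: ne; rewrite e. Qed.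

Lemma Sq_end x a b a' b' : Sq x a b a' b' -> a'.2 = b'.2.
Proof. by case=> psi _ [_ _ _ -> ->]. Qed.

Lemma Sq_opp x a b a' b' : Sq x a b a' b' -> opposite b.1 b'.1.
Proof.
case=> psi cpsi [_ _ -> _ ->]; have [m d w] := cpsi.
split; rewrite /edge /= ?d //; first by exists (psi N N); rewrite !m d.
case=> v [v1 v2]; have [p [q ev]] := w _ _ _ v1; move: v1 v2; rewrite ev !m.
by case: p {ev} => [[]|].
Qed.

Lemma Sq_ex x a b c : dart x a -> dart x b -> a <> b -> a.1 <= c -> b.1 <= c ->
  exists a' b', [/\ Sq x a b a' b', a'.1 <= c & b'.1 <= c].
Proof.
move=> xa xb ne ac bc; have ne1 : a.1 <> b.1 by move/(dart_uniq xa xb).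
have /dartP[[vx ea va] la laa nea] := xa; have /dartP[[_ eb vb] lb lbb neb] := xb.
have [psi [cpsi p0 pa pb pc]] := square_chart vx ne1 ea eb la lb ac bc.
have [m d w] := cpsi; exists (psi N t1, psi t1 t1), (psi t1 N, psi t1 t1).
split; try by apply: le_trans pc; rewrite m.
have e0 : a.2 = psi t1 f0.
  have := @dart_end x a (psi t1 f0) xa; rewrite /vertex d -pa m => /(_ isT isT)[|//].
  by rewrite -p0 => /(chart2_inj cpsi)[].
have e1 : b.2 = psi f0 t1.
  have := @dart_end x b (psi f0 t1) xb; rewrite /vertex d -pb m => /(_ isT isT)[|//].
  by rewrite -p0 => /(chart2_inj cpsi)[].
exists psi => //; split=> //; last by rewrite pb -e1; case: (b).
by rewrite pa -e0; case: (a).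
Qed.

End Squares.

(** * Nonpositive curvature *)

Definition nonpos_curved (X : cubeComplex) :=
  forall x : cell X, vertex x -> link_simplicial x /\ flag (link x).

Section NonPositivelyCurved.
Variable X : cubeComplex.
Hypothesis X_npc : nonpos_curved X.
Implicit Types (x y c e s : cell X) (a b k : cell X * cell X).

(** The face of [c'] spanned by the edges of [c] at [x] has the same edges at [x]
   as [c], hence equals [c] because the link is simplicial. *)
Lemma cell_le_edges x c c' : vertex x -> x <= c -> x <= c' ->
  (forall e, edge e -> x <= e -> e <= c -> e <= c') -> c <= c'.
Proof.
move=> vx xc xc' sub; have [phi [m d w phi0]] := chart_at vx xc.
pose E i := phi (dirface i).
have E_inj : injective E.
  move=> i j eij; have ij : phi (dirface i) <= phi (dirface j) by rewrite -/(E i) eij.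
  rewrite m dirface_le ?face0_dir // ffunE in ij.
  by case: (i =P j) ij.
have EP i : [/\ edge (E i), x <= E i & E i <= c].
  split; first by rewrite /edge d dirface_dim.
  - by rewrite -phi0 m face0_dir.
  - by apply/w; exists (dirface i).
have EP' i : [/\ edge (E i), x <= E i & E i <= c'].
  by have [ei xi ic] := EP i; split=> //; apply: sub.
have [psi [m' d' w' psi0 [psid psic]]] := subcube vx E_inj EP' xc'.
pose full : cface (dim c) := [ffun=> N].
have le_full F : cface_le F full by apply/forallP=> i; rewrite ffunE eqxx.
suff -> : c = psi full by apply: psic.
apply: (X_npc vx).1 => //; first by rewrite -psi0 m' le_full.
move=> e /eqP de xe; apply/idP/idP => [/w[F eF]|/w'[F eF]].
  have xF : cface_le (face0 _) F by rewrite -m phi0 eF.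
  have [|i eFi] := cface_dim1P xF; first by rewrite -d eF.
  by rewrite -eF eFi -/(E i) -psid m' le_full.
have xF : cface_le (face0 _) F by rewrite -m' psi0 eF.
have [|i eFi] := cface_dim1P xF; first by rewrite -d' eF.
by rewrite -eF eFi psid; case: (EP i).
Qed.

Lemma chart2_edges psi e : chart2 psi -> edge e -> psi f0 f0 <= e ->
  e <= psi N N -> e = psi N f0 \/ e = psi f0 N.
Proof.
case=> m d w ee xe /w[p [q ep]]; move: ee xe; rewrite ep /edge m d.
by case: p q {ep} => [[]|] [[]|] // _ _; [right|left].
Qed.

(** The link being flag, it is enough that the edges be pairwise adjacent in it;
   the square that two edges span inside a common cell shows that they are. *)
Lemma flag_span x (A : {fset edge_at x}) : vertex x -> A != fset0 ->
  (forall u v, u \in A -> v \in A -> u != v ->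
    exists2 c, val u <= c & val v <= c) ->
  exists2 c, x <= c & forall u, (u \in A) = (val u <= c).
Proof.
move=> vx A0 sq; suff [_ ?] : @simplex (link x) A by [].
apply: ((X_npc vx).2 A A0) => u v uA vA uv.
have [c uc vc] := sq u v uA vA uv.
have /andP[eu xu] := valP u; have /andP[ev xv] := valP v.
have ne : val u <> val v by move/val_inj => e; rewrite e eqxx in uv.
have [psi [cpsi p0 pu pv pc]] := square_chart vx ne eu ev xu xv uc vc.
have [m d w] := cpsi; split; first by apply/fset0Pn; exists u; rewrite !inE eqxx.
exists (psi N N) => [|z]; first by rewrite -p0 m.
rewrite !inE; apply/orP/idP => [[/eqP->|/eqP->]|le].
- by rewrite -pu m.
- by rewrite -pv m.
have /andP[ee xe] := valP z.
have xe' : psi f0 f0 <= val z by rewrite p0.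
by have [E|E] := chart2_edges cpsi ee xe' le; [left|right];
  apply/eqP/val_inj; rewrite E.
Qed.

(** The square is also the least cell at [x] containing [a] and [b], so it lies in
   every cell that contains these two darts. *)
Lemma Sq_cell x a b a' b' : Sq x a b a' b' -> exists s,
  [/\ dim s = 2%N, [/\ a.1 <= s, b.1 <= s, a'.1 <= s & b'.1 <= s],
     forall c, x <= c -> a.1 <= c -> b.1 <= c -> s <= c &
     forall k, dart a.2 k -> k.1 <= s -> k = drev x a \/ k = b'].
Proof.
move=> S; have [psi cpsi [ex ea eb ea' eb']] := S; have [m d w] := cpsi.
have vx : vertex x by have /dartP[[]] := Sq_dart S.
exists (psi N N); split.
- by rewrite d.
- by rewrite ea eb ea' eb' /= !m.
- move=> c xc ac bc; apply: (cell_le_edges vx) => //; first by rewrite ex m.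
  move=> e ee xe; rewrite ex in xe => /(chart2_edges cpsi ee xe).
  by rewrite ea eb /= in ac bc => -[]->.
- move=> k ak ks; have /dartP[[_ ek _] ka _ _] := ak.
  have cpsi' := chart2_flip cpsi; rewrite ea /= in ka.
  have [E|E] := chart2_edges cpsi' ek ka ks; [left|right];
    apply: (dart_uniq ak); rewrite ?E ?ea ?eb' //=.
  + by apply: dart_rev; rewrite -ea; apply: Sq_dart S.
  + by have := Sq_dart3 S; rewrite ea eb'.
Qed.

(** Both squares are the least cell containing the two darts at [x], and each
   vertex of a square has only two darts in it. *)
Lemma Sq_uniq x a b a' b' a1 b1 : Sq x a b a' b' -> Sq x a b a1 b1 ->
  a' = a1 /\ b' = b1.
Proof.
suff H k l k' l' k1 l1 : Sq x k l k' l' -> Sq x k l k1 l1 -> l' = l1.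
  by move=> S S1; split; [apply: H (Sq_sym S) (Sq_sym S1) | apply: H S S1].
move=> S S1; have [s [_ [_ _ _ sl'] min _]] := Sq_cell S.
have [s1 [_ [sk sl _ _] _ un1]] := Sq_cell S1.
have xs1 : x <= s1 by apply: le_trans sk; have /dartP[] := Sq_dart S.
have [e|//] := un1 _ (Sq_dart3 S) (le_trans sl' (min _ xs1 sk sl)).
by have := Sq_neq (Sq_rot S); rewrite e.
Qed.

(** Serves to recognize the sides of a square that is only known to contain the
   images of the sides of another one. *)
Lemma Sq_side x a b a' b' k s : Sq x a b a' b' -> dim s = 2%N ->
  a.1 <= s -> b.1 <= s -> dart a.2 k -> k.1 <= s -> k <> drev x a -> k = b'.
Proof.
move=> S ds sa sb ak ks ne; have [s1 [ds1 _ min un]] := Sq_cell S.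
have xs : x <= s by apply: le_trans sa; have /dartP[] := Sq_dart S.
have e : s1 = s by apply: dim_le_eq (min _ xs sa sb) _; rewrite ds.
by case: (un k ak); rewrite ?e.
Qed.

Lemma chart3_face o (psi : option bool -> option bool -> option bool -> cell X) :
  chart3 psi -> chart2 (fun p q => psi p q (Some o)).
Proof.
case=> m d w; split=> [*|*|p q z le]; rewrite ?m ?d ?addn0 //.
  by rewrite /leo eqxx !andbT.
have [p' [q' [r' e]]] := w _ _ _ _ le; exists p', q'; move: le; rewrite e m.
by case: r' {e} => [r'|] /and3P[_ _] //= /eqP->.
Qed.

Lemma chart3_cyc (psi : option bool -> option bool -> option bool -> cell X) :
  chart3 psi -> chart3 (fun p q r => psi q r p).
Proof.
case=> m d w; split=> [*|*|p q r z /w[p' [q' [r' ->]]]]; rewrite ?m ?d.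
- by rewrite andbA andbC.
- by rewrite addnA addnC.
- by exists r', p', q'.
Qed.

Lemma chart2_Sq (psi : option bool -> option bool -> cell X) : chart2 psi ->
  Sq (psi f0 f0) (psi N f0, psi t1 f0)
  (psi f0 N, psi f0 t1) (psi N t1, psi t1 t1) (psi t1 N, psi t1 t1).
Proof. by exists psi. Qed.

(** By flagness the three squares are faces of a cube at [x]; the conclusion lists
   the three faces of this cube away from [x]. *)
Lemma Sq_cube x a b k a1 b1 a2 k2 b3 k3 :
    Sq x a b a1 b1 -> Sq x a k a2 k2 -> Sq x b k b3 k3 ->
  exists a' b' k', [/\ Sq a.2 b1 k2 b' k', Sq b.2 a1 k3 a' k' & Sq k.2 a2 b3 a' b'].
Proof.
move=> Sab Sac Sbc.
have /dartP[[vx ea va] la laa nea] := Sq_dart Sab.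
have /dartP[[_ eb vb] lb lbb neb] := Sq_dart2 Sab.
have /dartP[[_ ek vk] lk lkk nek] := Sq_dart2 Sac.
have mkP e : edge e -> x <= e -> edge e && (x <= e) by move=> -> ->.
pose ua : edge_at x := exist _ a.1 (mkP _ ea la).
pose ub : edge_at x := exist _ b.1 (mkP _ eb lb).
pose uc : edge_at x := exist _ k.1 (mkP _ ek lk).
have [sab [_ [ab1 ab2 _ _] _ _]] := Sq_cell Sab.
have [sac [_ [ac1 ac2 _ _] _ _]] := Sq_cell Sac.
have [sbc [_ [bc1 bc2 _ _] _ _]] := Sq_cell Sbc.
have [|||C xC CP] := @flag_span x [fset ua; ub; uc]%fset => //.
- by apply/fset0Pn; exists ua; rewrite !inE eqxx.
- move=> u v; rewrite !inE -!orbA => /or3P[] /eqP-> /or3P[] /eqP-> //= ne;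
    by [rewrite eqxx in ne | exists sab | exists sac | exists sbc].
have [aC bC cC] : [/\ a.1 <= C, b.1 <= C & k.1 <= C].
  by split; [have := CP ua | have := CP ub | have := CP uc];
    rewrite !inE eqxx ?orbT => /esym.
have [psi [cpsi p0 pa pb pc]] := cube_chart vx (Sq_neq1 Sab) (Sq_neq1 Sac)
  (Sq_neq1 Sbc) ea eb ek la lb lk aC bC cC.
have cpsi1 := chart3_cyc cpsi; have cpsi2 := chart3_cyc cpsi1.
have /= Fab := chart2_Sq (chart3_face false cpsi).
have /= Fca := chart2_Sq (chart3_face false cpsi1).
have /= Fbc := chart2_Sq (chart3_face false cpsi2).
have /= Gab := chart2_Sq (chart3_face true cpsi).
have /= Gca := chart2_Sq (chart3_face true cpsi1).
have /= Gbc := chart2_Sq (chart3_face true cpsi2).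
rewrite p0 in Fab Fca Fbc.
have Ea := dart_uniq (Sq_dart Sab) (Sq_dart Fab) (esym pa).
have Eb := dart_uniq (Sq_dart Sbc) (Sq_dart Fbc) (esym pb).
have Ec := dart_uniq (Sq_dart2 Sac) (Sq_dart Fca) (esym pc).
rewrite -Ea -Eb -Ec in Fab Fca Fbc.
have [-> ->] := Sq_uniq Sab Fab; have [-> ->] := Sq_uniq Sbc Fbc.
have [-> ->] := Sq_uniq (Sq_sym Sac) Fca; rewrite Ea Eb Ec /=.
by do 3!eexists; split; [apply: Gbc | apply: Sq_sym Gca | apply: Gab].
Qed.

End NonPositivelyCurved.

(** * Walking and transporting edges inside a cube *)

Section InsideCubes.
Variable X : cubeComplex.
Implicit Types (x y u v c e s : cell X) (a b k : cell X * cell X).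

Lemma dart_vertex x a : dart x a -> vertex x.
Proof. by case/dartP=> -[]. Qed.

Lemma dart_le x a : dart x a -> x <= a.1.
Proof. by case/dartP. Qed.

Lemma cell2_chart x c : vertex x -> x <= c -> dim c = 2%N ->
  exists psi, [/\ chart2 psi, psi f0 f0 = x & psi N N = c].
Proof.
move=> vx xc dc; have := chart_at vx xc; rewrite dc => -[phi [m d w phi0]].
exists (fun p q => phi (mk2 p q)); split.
- split=> [*|*|p q z le]; rewrite ?m ?d ?mk2_le ?mk2_dim //.
  have [F <-] : exists F, phi F = z.
    by apply/w; apply: le_trans le _; apply/w; exists (mk2 p q).
  by have [p' [q' ->]] := mk2_ex F; exists p', q'.
- by rewrite -phi0; congr phi; apply/ffunP=> i; rewrite !ffunE; case: ifP.
- have /w[F eF] := lexx c; rewrite -eF; congr phi.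
  have := d F; rewrite eF dc; have [p [q ->]] := mk2_ex F; rewrite mk2_dim.
  by case: p q => [p|] [q|].
Qed.

Lemma dart_in_chart psi u a : chart2 psi -> dart u a -> a.1 <= psi N N ->
  exists i j, u = psi (Some i) (Some j) /\
   (a = (psi N (Some j), psi (Some (~~ i)) (Some j)) \/
    a = (psi (Some i) N, psi (Some i) (Some (~~ j)))).
Proof.
case=> m d w /dartP[[vu ea va] ua aa ne] /w[p [q E]].
move: ea ua aa; rewrite E /edge d => pq ua aa.
have [p1 [q1 eu]] := w _ _ _ ua; have [p2 [q2 eW]] := w _ _ _ aa.
move: vu va ua aa ne; rewrite {1 2}eu {1 2}eW /vertex !d !m eW.
have -> : a = (psi p q, psi p2 q2) by rewrite -E -eW; case: (a).
case: p1 q1 eu => [i|] [j|] // eu; case: p2 q2 eW => [i'|] [j'|] // eW _ _.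
rewrite eu; move: pq; case: p E => [p|]; case: q => [q|] //= E _.
  rewrite /leo /= ?orbF ?andbT => /eqP[<-] /eqP[ii'] ne.
  exists i, j; split=> //; right; rewrite ii' in ne *; congr (_, psi _ (Some _)).
  by case: j j' ne {eu eW} => [] []; rewrite ?eqxx.
rewrite /leo /= ?orbF ?andbT => /eqP[<-] /eqP[jj'] ne.
exists i, j; split=> //; left; rewrite jj' in ne *; congr (_, psi (Some _) _).
by case: i i' ne {eu eW} => [] []; rewrite ?eqxx.
Qed.

(** Induction on the number of coordinates where the two vertices differ. *)
Lemma cube_connected c (P : cell X -> Prop) :
    (forall u a, dart u a -> a.1 <= c -> P u -> P a.2) ->
  forall x y, vertex x -> x <= c -> vertex y -> y <= c -> P x -> P y.
Proof.
move=> st x y vx xc vy yc Px; have [phi [m d w phi0]] := chart_at vx xc.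
have /w[F eF] := yc; move: vy; rewrite -eF /vertex d => /eqP.
have [n] := ubnP #|[pred i | F i == t1]|; elim: n F {y yc eF} => // n IH F Fn dF.
have [i /eqP Fi|noF] := pickP [pred i | F i == t1]; last first.
  suff -> : F = face0 _ by rewrite phi0.
  apply/ffunP=> i; rewrite ffunE; have [b Fi] := cface_dim0P i dF.
  by have := noF i; rewrite /= Fi; case: (b).
pose G o : cface (dim c) := [ffun j => if j == i then o else F j].
have dG o : cface_dim (G o) = (o == N).
  rewrite !cface_dimE (bigD1 i) //= ffunE eqxx big1 ?addn0 // => j /negPf ij.
  by rewrite ffunE ij; have [b ->] := cface_dim0P j dF.
have GF : G t1 = F by apply/ffunP=> j; rewrite ffunE; case: eqP => // ->.
have mG o o' : (phi (G o) <= phi (G o')) = leo o o'.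
  rewrite m; apply/forallP/idP => [/(_ i)|oo' j]; first by rewrite !ffunE eqxx.
  by rewrite !ffunE; case: (j == i); rewrite ?eqxx ?orbT.
rewrite -GF; apply: (st (phi (G f0)) (phi (G N), phi (G t1))).
- apply/dartP; rewrite /vertex /edge /= !d !dG !mG; split=> //.
  by apply/eqP=> E; have := mG f0 t1; rewrite E lexx.
- by apply/w; exists (G N).
apply: IH; rewrite ?dG //; rewrite ltnS in Fn; apply: leq_trans _ Fn.
apply: proper_card.
apply/fintype.properP; split.
  by apply/fintype.subsetP=> j; rewrite !inE ffunE; case: (j == i).
by exists i; rewrite !inE ?Fi // ffunE eqxx.
Qed.

Lemma opposite_Sq e e' x k : opposite e e' -> dart x k -> k.1 = e ->
  exists a k' a', Sq x a k a' k' /\ k'.1 = e'.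
Proof.
move=> [ee ee' [c [dc ec ec']] no] xk ke; rewrite -ke in ec no.
have [psi0 [cpsi0 p0 pN]] :=
  cell2_chart (dart_vertex xk) (le_trans (dart_le xk) ec) dc.
have [psi [cpsi {}p0 {}pN pk]] : exists psi,
    [/\ chart2 psi, psi f0 f0 = x, psi N N = c & psi f0 N = k.1].
  have [_ ek _] := dartP _ _ xk; have /dartP[[_ e1 _] _ _ _] := xk.
  have := chart2_edges cpsi0 e1; rewrite p0 pN => /(_ (dart_le xk) ec)[] E.
    by exists (fun p q => psi0 q p); split=> //; apply: chart2_sym.
  by exists psi0.
have [m d w] := cpsi; have := chart2_Sq cpsi; rewrite p0 pk.
set a := (_, psi t1 f0); set k0 := (_, psi f0 t1).
set a' := (psi N t1, _); set k' := (psi t1 N, _) => S.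
have -> : k = k0 by apply: (dart_uniq xk (Sq_dart2 S)).
exists a, k', a'; split=> //=.
move: ec'; rewrite -pN => /w[p [q e'E]]; move: ee' no.
rewrite e'E /edge d => pq no.
have {}no v : v <= psi f0 N -> v <= psi p q -> False.
  by rewrite pk => v1 v2; apply: no; exists v.
by case: p q pq no {e'E} => [[]|] [[]|] // _ no;
  [case: (no (psi f0 f0)) | case: (no (psi f0 t1)) | case: (no (psi f0 f0))];
  rewrite !m.
Qed.

Lemma opposite_sym e e' : opposite e e' -> opposite e' e.
Proof.
case=> ee ee' [c [dc ec ec']] no; split=> //; first by exists c.
by case=> v [v1 v2]; apply: no; exists v.
Qed.

Lemma Sq_parallel x a b a' b' : Sq x a b a' b' -> parallel b.1 b'.1.
Proof. by move=> /Sq_opp ?; apply: rst_step. Qed.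

(** An edge can be transported inside the cube along any walk of the cube, across
   squares. *)
Lemma parallel_in_cube e c x : edge e -> e <= c -> vertex x -> x <= c ->
  exists k, [/\ dart x k, k.1 <= c & parallel e k.1].
Proof.
move=> ee ec vx xc; have [v vv ve] := vertex_below e.
have [w vw] := dart_ex vv ee ve.
apply: (@cube_connected c (fun x => exists k, [/\ dart x k, k.1 <= c & parallel e k.1]) _ v) => //.
- move=> u a ua ac [k [uk kc ek]].
  have [ka|ka] := pselect (k = a).
    by exists (drev u a); split; [apply: dart_rev | | rewrite -ka].
  have [k' [a' [S kc' _]]] := Sq_ex uk ua ka kc ac.
  exists k'; split=> //; first exact: Sq_dart4 S.
  exact: rst_trans ek (Sq_parallel (Sq_sym S)).
- exact: le_trans ve ec.
- by exists (e, w); split=> //; apply: rst_refl.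
Qed.

End InsideCubes.

(** * Monodromy *)

Section Walks.
Variable X : cubeComplex.
Implicit Types (x y u v c e s : cell X) (a b k : cell X * cell X).
Implicit Types (p q r : seq (cell X * cell X)).

Fixpoint walk x p := if p is a :: p' then dart x a && walk a.2 p' else vertex x.

Definition wend x p := foldl (fun _ a => a.2) x p.

Lemma walk_vertex x p : walk x p -> vertex x.
Proof. by case: p => //= a p /andP[/dart_vertex]. Qed.

Lemma walk_cat x p q : walk x (p ++ q) = walk x p && walk (wend x p) q.
Proof.
elim: p x => [|a p IH] x /=; last by rewrite IH andbA.
by apply/idP/andP => [w|[]//]; split=> //; apply: walk_vertex w.
Qed.

Lemma wend_cat x p q : wend x (p ++ q) = wend (wend x p) q.
Proof. exact: foldl_cat. Qed.

Lemma wend_vertex x p : walk x p -> vertex (wend x p).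
Proof. by elim: p x => //= a p IH x /andP[_ /IH]. Qed.

Lemma edge_path_walk x p : edge_path x p = walk x p.
Proof.
rewrite /edge_path; move: {2}x => z; elim: p x z => [|a p IH] x z /=; first by rewrite andbT.
rewrite andbA /dart -(IH a.2 a.1) -surjective_pairing.
have -> : step (z, x) a = step (x, x) a by [].
by case: (@andP (vertex x)) => //= -[_ /and5P[_ -> ]].
Qed.

Lemma path_end_wend x p : path_end x p = wend x p.
Proof.
rewrite /path_end /wend; move: {1}x => z; elim: p x z => //= a p IH x z.
by rewrite -(IH a.2 a.1) -surjective_pairing.
Qed.

Fixpoint wrev x p := if p is a :: p' then rcons (wrev a.2 p') (drev x a) else [::].

Lemma wrev_walk x p : walk x p ->
  walk (wend x p) (wrev x p) /\ wend (wend x p) (wrev x p) = x.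
Proof.
elim: p x => //= a p IH x /andP[xa /IH[w e]].
rewrite -cats1 walk_cat wend_cat e /= w (dart_rev xa) /=; split=> //.
exact: dart_vertex xa.
Qed.

End Walks.

Section Monodromy.
Variables (X : cubeComplex) (S : Type) (good : S -> Prop) (over : S -> cell X).
Variable act : S -> cell X * cell X -> S.
Implicit Types (x y u v c e : cell X) (a b k : cell X * cell X) (s : S).
Implicit Types (p q r : seq (cell X * cell X)).

Hypothesis act_dart : forall s a, good s -> dart (over s) a ->
  [/\ good (act s a), over (act s a) = a.2 & act (act s a) (drev (over s) a) = s].
Hypothesis act_Sq : forall s a b a' b', good s -> Sq (over s) a b a' b' ->
  act (act s a) b' = act (act s b) a'.

Lemma act_walk s p : good s -> walk (over s) p ->
  good (foldl act s p) /\ over (foldl act s p) = wend (over s) p.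
Proof.
elim: p s => //= a p IH s gs /andP[sa w]; have [ga oa _] := act_dart gs sa.
by have := IH _ ga; rewrite oa => /(_ w).
Qed.

Lemma act_wrev s p : good s -> walk (over s) p ->
  foldl act (foldl act s p) (wrev (over s) p) = s.
Proof.
elim: p s => //= a p IH s gs /andP[sa w]; have [ga oa ra] := act_dart gs sa.
by rewrite foldl_rcons -oa IH ?oa.
Qed.

(** A section over a cell makes the action of a walk in this cell depend only on
   its ends. Over a square, it is defined by going around the square in both
   directions, which is consistent by [act_Sq]. *)
Lemma act_section s c : good s -> (dim c <= 2)%N -> vertex (over s) -> over s <= c ->
  exists2 sec : cell X -> S, sec (over s) = s &
    forall u a, dart u a -> a.1 <= c -> act (sec u) a = sec a.2.
Proof.
move=> gs; set v := over s; case dc: (dim c) => [|[|[|//]]] _ vv vc.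
- exists (fun=> s) => // u a /dartP[[_ ea _] _ _ _] /dim_le.
  by rewrite dc (eqP ea).
- have [w vw] := dart_ex vv (introT eqP dc : edge c) vc.
  have /dartP[_ _ _ /= ne] := vw; rewrite eq_sym in ne.
  exists (fun u => if u == v then s else act s (c, w)); first by rewrite eqxx.
  move=> u a ua ac; have e1 : a.1 = c.
    by apply: dim_le_eq => //; rewrite dc; have /dartP[[_ /eqP]] := ua.
  have [e|e] : u = v \/ u = w.
    by apply: (dart_end vw (dart_vertex ua)); rewrite /= -e1; apply: dart_le.
    have -> : a = (c, w) by apply: (@dart_uniq _ u); rewrite // e.
    by rewrite e eqxx (negPf ne).
  have -> : a = drev v (c, w).
    by have := dart_rev vw; rewrite /= -e => wv; apply: (@dart_uniq _ u).
  by rewrite e (negPf ne) /= eqxx; have [] := act_dart gs vw.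
have [psi [cpsi p0 pN]] := cell2_chart vv vc dc.
pose a0 := (psi N f0, psi t1 f0); pose b0 := (psi f0 N, psi f0 t1).
pose a1 := (psi N t1, psi t1 t1); pose b1 := (psi t1 N, psi t1 t1).
have Q : Sq v a0 b0 a1 b1 by rewrite -p0; apply: chart2_Sq.
have [g1 o1 r1] := act_dart gs (Sq_dart Q).
have [g2 o2 r2] := act_dart gs (Sq_dart2 Q).
have d3 : dart (over (act s a0)) b1 by rewrite o1; apply: Sq_dart3 Q.
have d4 : dart (over (act s b0)) a1 by rewrite o2; apply: Sq_dart4 Q.
have [g3 o3 r3] := act_dart g1 d3; have [g4 o4 r4] := act_dart g2 d4.
have e34 := act_Sq gs Q.
pose T (i j : bool) := if i then if j then act (act s a0) b1 else act s a0
  else if j then act s b0 else s.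
pose sec u := if u == psi f0 f0 then T false false else
  if u == psi t1 f0 then T true false else if u == psi f0 t1 then T false true
  else T true true.
have secE i j : sec (psi (Some i) (Some j)) = T i j.
  have inj i' j' : (psi (Some i) (Some j) == psi (Some i') (Some j')) = (i == i') && (j == j').
    apply/eqP/andP => [/(chart2_inj cpsi)[[->] [->]]|[/eqP-> /eqP->]] //.
  by rewrite /sec !inj; case: (i) (j) => [] [].
exists sec; first by rewrite -p0 secE.
move=> u a ua; rewrite -pN => /(dart_in_chart cpsi ua)[i [j [-> [->|->]]]] /=;
  rewrite !secE; case: i j => [] [] //=; rewrite /T.
- by rewrite e34 -[X in act _ X]/(drev b0.2 a1) -o2.
- by rewrite -[X in act _ X]/(drev (psi f0 f0) a0) p0.
- by rewrite -[X in act _ X]/(drev a0.2 b1) -o1.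
- by rewrite -[X in act _ X]/(drev (psi f0 f0) b0) p0.
Qed.

Lemma section_walk c (sec : cell X -> S) x p :
  (forall u a, dart u a -> a.1 <= c -> act (sec u) a = sec a.2) ->
  walk x p -> all (fun a => a.1 <= c) p -> foldl act (sec x) p = sec (wend x p).
Proof.
move=> sc; elim: p x => //= a p IH x /andP[xa w] /andP[ac al].
by rewrite (sc _ _ xa ac) IH.
Qed.

Lemma act_homotopy s p q : good s -> homotopic (over s) p q ->
  foldl act s p = foldl act s q.
Proof.
move=> gs; elim=> {p q} [p q|//|p q _ ->//|p q r _ -> _ -> //].
  case=> c {}p r r' {}q dc; rewrite !edge_path_walk !path_end_wend !wend_cat.
  rewrite !walk_cat => /and3P[w1 w2 w3] /and3P[_ w2' w3'] ew al al'.
  have [gp op] := act_walk gs w1.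
  rewrite !foldl_cat; congr foldl; move: gp op; set z := foldl act s p => gp op.
  rewrite -op in w2 w2' ew.
  have [zc|zc] := boolP (over z <= c).
    have [sec e sc] := act_section gp dc (walk_vertex w2) zc.
    by rewrite -e (section_walk sc w2) // (section_walk sc w2') // -ew.
  have nil p' : walk (over z) p' -> all (fun a => a.1 <= c) p' -> p' = [::].
    case: p' => //= a p' /andP[/dart_le za _] /andP[ac _].
    by rewrite (le_trans za ac) in zc.
  by rewrite (nil _ w2 al) (nil _ w2' al').
Qed.

(** This is how simple connectivity is used: an elementary homotopy replaces a
   walk in a cell of dimension at most 2 by another one with the same ends. *)
Lemma monodromy s p : simply_connected X -> good s -> walk (over s) p ->
  wend (over s) p = over s -> foldl act s p = s.
Proof.
move=> sc gs w e; have := sc (over s) p; rewrite edge_path_walk path_end_wend.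
by move=> /(_ w e)/(act_homotopy gs).
Qed.

End Monodromy.

(** * Reduced walks *)

Section Reduced.
Variable X : cubeComplex.
Hypothesis X_npc : nonpos_curved X.
Implicit Types (x y u v c e s : cell X) (a b k : cell X * cell X).
Implicit Types (p q r : seq (cell X * cell X)).

(** [lev x p q]: the walks [p] and [q] issued from [x] are equivalent under the
   moves that replace two consecutive sides of a square by the two others. This
   form of the definition, inspired by the Levi lemma for partially commutative
   monoids, makes that lemma an inversion principle; the content is then in the
   transitivity [lev_trans]. *)
Inductive lev : cell X -> seq (cell X * cell X) -> seq (cell X * cell X) -> Prop :=
| lev_nil x : vertex x -> lev x [::] [::]
| lev_cons x a p q : dart x a -> lev a.2 p q -> lev x (a :: p) (a :: q)
| lev_swap x a b a' b' p q r : Sq x a b a' b' ->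
    lev a.2 p (b' :: r) -> lev b.2 (a' :: r) q -> lev x (a :: p) (b :: q).

Lemma lev_sym x p q : lev x p q -> lev x q p.
Proof.
elim=> {x p q} [x vx|x a p q xa _ IH|x a b a' b' p q r S _ IH1 _ IH2].
- exact: lev_nil.
- exact: lev_cons.
- exact: lev_swap (Sq_sym S) IH2 IH1.
Qed.

Lemma lev_walk x p q : lev x p q -> walk x p.
Proof.
elim=> {x p q} [x vx|x a p q xa _ w|x a b a' b' p q r S _ w _ _] //=.
  by rewrite xa.
by rewrite (Sq_dart S).
Qed.

Lemma lev_walkr x p q : lev x p q -> walk x q.
Proof. by move=> /lev_sym/lev_walk. Qed.

Lemma lev_refl x p : walk x p -> lev x p p.
Proof.
elim: p x => [|a p IH] x /=; first exact: lev_nil.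
by case/andP=> xa /IH; apply: lev_cons.
Qed.

Lemma lev_size x p q : lev x p q -> size p = size q.
Proof.
elim=> {x p q} [//|x a p q _ _ /= ->//|x a b a' b' p q r _ _ /= -> _ /=] ->//.
Qed.

Lemma lev_wend x p q : lev x p q -> wend x p = wend x q.
Proof.
elim=> {x p q} [//|//|x a b a' b' p q r S _ /= -> _ /= <-].
by rewrite (Sq_end S).
Qed.

Lemma lev_inv x a b p q : lev x (a :: p) (b :: q) ->
  a = b /\ lev a.2 p q \/
  exists a' b' r, [/\ Sq x a b a' b', lev a.2 p (b' :: r) & lev b.2 (a' :: r) q].
Proof.
move=> H; inversion H; first by left.
by right; exists a', b', r.
Qed.

Lemma lev_inv_eq x a p q : lev x (a :: p) (a :: q) -> lev a.2 p q.
Proof. by case/lev_inv=> [[]//|[? [? [? [/Sq_neq]]]]]. Qed.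

Lemma lev_nilr x p : lev x p [::] -> p = [::].
Proof. by move=> /lev_size; case: p. Qed.

Lemma lev_Sq x a b a' b' r : Sq x a b a' b' -> walk a'.2 r ->
  lev x (a :: b' :: r) (b :: a' :: r).
Proof.
move=> S w; apply: (lev_swap S); apply: lev_refl => /=.
  by rewrite (Sq_dart3 S) -(Sq_end S).
by rewrite (Sq_dart4 S).
Qed.

(** Two different first darts [a] and [b] of walks equivalent to one starting
   with [k] yield, at the end of [k], two darts that again start equivalent
   walks; by induction they span a square, and the cube spanned by the three
   squares provides the square at [x]. *)
Lemma lev_trans x p q r : lev x p q -> lev x q r -> lev x p r.
Proof.
have [n] := ubnP (size p); elim: n x p q r => // n IH x p q r.
case: p => [|a p] /=; first by move=> _ /lev_sym/lev_nilr-> .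
rewrite ltnS => pn L1 L2; have := lev_size L1; have := lev_size L2.
case: q L1 L2 => [|k q] //; case: r => [|b r] // L1 L2 /= [qr] [pq].
have {}IH y p1 q1 r1 : size p1 = size p -> lev y p1 q1 -> lev y q1 r1 -> lev y p1 r1.
  by move=> e; apply: IH; rewrite e.
have /andP[xa _] : walk x (a :: p) := lev_walk L1.
case/lev_inv: L1 => [[ak pq1]|[a1 [k1 [s [S1 ps sq]]]]].
  rewrite -ak in L2 *; case/lev_inv: L2 => [[<- qr1]|[a2 [b2 [t [S2 qt tr]]]]].
    by apply: lev_cons => //; apply: (IH _ _ _ _ _ pq1 qr1).
  by apply: (lev_swap S2 _ tr); apply: (IH _ _ _ _ _ pq1 qt).
have sp : size (a1 :: s) = size p by rewrite (lev_size ps).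
case/lev_inv: L2 => [[<- qr1]|[k2 [b2 [t [S2 qt tr]]]]].
  by apply: (lev_swap S1 ps); apply: (IH _ _ _ _ _ sq qr1).
have st := IH _ _ _ _ sp sq qt.
have tp : size (k2 :: t) = size p by rewrite (lev_size tr) -qr -pq.
have S1' := Sq_rot (Sq_sym S1); have S2' := Sq_rot S2.
case/lev_inv: (st) => [[e st1]|[a3 [b3 [w [S3 sw wt]]]]].
  rewrite -e in S2' S2; have [_ ab] := Sq_uniq X_npc S1' S2'.
  rewrite -ab in S2 tr *; have [k12 _] := Sq_uniq X_npc (Sq_sym S1) S2.
  apply: lev_cons => //; apply: (IH _ _ _ _ _ ps _) => //.
  rewrite -k12 in tr tp; apply: (IH _ _ (k1 :: t) _ _ _ tr); first by rewrite (lev_size ps).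
  by apply: lev_cons; rewrite ?(Sq_dart3 S1) // -(Sq_end S1).
have [a' [b' [k' [/= Q1 Q2 Q3]]]] := Sq_cube X_npc S1' S2' S3.
have {Q2}/= := Sq_rot Q2; have {Q3}/= := Sq_rot Q3.
have -> : drev b2.2 (drev b.2 k2) = k2.
  by rewrite -(Sq_end S2) drevK.
have -> : drev a1.2 (drev a.2 k1) = k1 by rewrite (Sq_end S1) drevK.
rewrite (Sq_end S3); set c' := drev b3.2 a' => Q3 Q2.
have /andP[_ w3] : walk a1.2 (b3 :: w) := lev_walkr sw.
apply: (lev_swap (r := c' :: w) Q1).
  apply: (IH _ _ _ _ _ ps _) => //; apply: (IH _ _ (k1 :: b3 :: w) _ _ _ (lev_Sq Q2 _)) => //.
  by apply: lev_cons; rewrite ?(Sq_dart3 S1) // -(Sq_end S1).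
have st' : size (k2 :: a3 :: w) = size p by rewrite -tp /= -(lev_size wt).
apply: (IH _ _ (k2 :: a3 :: w)) => //; first exact: lev_sym (lev_Sq Q3 _).
apply: (IH _ _ _ _ _ _ tr) => //; apply: lev_cons; rewrite ?(Sq_dart4 S2) //.
by rewrite (Sq_end S2).
Qed.

End Reduced.

Section ReducedClasses.
Variable X : cubeComplex.
Hypothesis X_npc : nonpos_curved X.
Implicit Types (x y u v c e : cell X) (a b k : cell X * cell X).
Implicit Types (p q r : seq (cell X * cell X)).

(** A walk is reduced when no sequence of moves across squares creates a
   backtrack; it suffices to forbid, for each final part of the walk, that it be
   equivalent to one starting with the reverse of the previous dart. *)
Fixpoint red x p : Prop := if p is a :: p' then
  [/\ dart x a, red a.2 p' & ~ exists r, lev a.2 p' (drev x a :: r)]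
  else vertex x.

Lemma red_walk x p : red x p -> walk x p.
Proof. by elim: p x => //= a p IH x [-> /IH ->]. Qed.

Lemma red_cons x a p : red x (a :: p) -> red a.2 p.
Proof. by case. Qed.

(** In the case of a move across a square, a cancellation after the move could be
   pushed back across the square to a cancellation before it. *)
Lemma red_lev x p q : lev x p q -> red x p -> red x q.
Proof.
elim=> {x p q} [//|x a p q xa L IH /= [_ /IH rq no]|x a b a' b' p q r S L1 IH1 L2 IH2 /=].
  by split=> // -[r qr]; apply: no; exists r; apply: lev_trans L qr.
case=> xa /IH1 /= [_ rr no] nop; have eW := Sq_end S.
have wr : walk a'.2 r by rewrite eW; apply: red_walk.
have rq : red b.2 q.
  apply: IH2; split; [exact: Sq_dart4 S | by rewrite eW | case=> t rt].
  apply: nop; exists (b :: t); apply: lev_trans L1 _ => //.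
  have Q := Sq_rot (Sq_sym (Sq_rot S)).
  have /andP[_ wt] := lev_walkr rt; rewrite /= in wt.
  apply: lev_trans (lev_Sq (Sq_sym (Sq_rot S)) wt) => //.
  by apply: lev_cons; rewrite ?(Sq_dart3 S) // -eW.
split=> //; first exact: Sq_dart2 S.
case=> t qt; have {qt} := lev_trans X_npc L2 qt.
case/lev_inv=> [[e _]|[c' [d' [w [Q L3 L4]]]]].
  by have := Sq_neq (Sq_rot (Sq_sym S)); rewrite e.
have [e _] := Sq_uniq X_npc (Sq_sym Q) (Sq_rot (Sq_sym S)).
by apply: no; exists w; rewrite -e -eW.
Qed.

(** The effect on classes of reduced walks of moving the origin [x] along the dart
   [a]: either [a] is cancelled from [p], or its reverse is added. *)
Definition mv x a p p' := lev x p (a :: p') \/ lev a.2 p' (drev x a :: p).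

Lemma mv_rev x a p p' : mv x a p p' -> mv a.2 (drev x a) p' p.
Proof. by case=> L; [right; rewrite drevK | left]. Qed.

Lemma mv_wend x a p p' : mv x a p p' -> wend a.2 p' = wend x p.
Proof. by case=> /lev_wend ->. Qed.

Lemma mv_levr x a p p1 p2 : lev a.2 p1 p2 -> mv x a p p1 -> mv x a p p2.
Proof.
move=> L [L1|L1]; [left|right]; last exact: lev_trans (lev_sym L) L1.
apply: (lev_trans X_npc L1); have /andP[xa _] := lev_walkr L1.
exact: lev_cons.
Qed.

Lemma mv_levl x a p1 p2 p' : lev x p1 p2 -> mv x a p1 p' -> mv x a p2 p'.
Proof.
move=> L /mv_rev M; have := mv_rev (@mv_levr a.2 (drev x a) p' _ _ L M).
by rewrite drevK.
Qed.

Lemma mv_ex x a p : dart x a -> red x p -> exists2 p', red a.2 p' & mv x a p p'.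
Proof.
move=> xa rp; have [[r pr]|no] := pselect (exists r, lev x p (a :: r)).
  by exists r; [exact: red_cons (red_lev pr rp) | left].
exists (drev x a :: p); last by right; apply: lev_refl; rewrite /= (dart_rev xa) red_walk.
by split; rewrite ?drevK //; apply: dart_rev.
Qed.

(** A cancellation and an addition cannot both lead to reduced walks, since the
   walk obtained by the addition would contain a backtrack. *)
Lemma mv_uniq x a p1 p2 p1' p2' : lev x p1 p2 -> red a.2 p1' -> red a.2 p2' ->
  mv x a p1 p1' -> mv x a p2 p2' -> lev a.2 p1' p2'.
Proof.
wlog : p1 p2 p1' p2' / lev x p1 (a :: p1').
  move=> W L r1 r2 [M1|M1] [M2|M2].
  - by apply: (W p1 p2) => //; left.
  - by apply: (W p1 p2) => //; [left|right].
  - by apply: lev_sym; apply: (W p2 p1) => //; [apply: lev_sym|left|right].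
  - apply: (lev_trans X_npc M1); apply: (lev_trans X_npc _ (lev_sym M2)).
    by have /andP[? _] := lev_walkr M1; apply: lev_cons.
move=> M1 L r1 r2 _ [M2|M2].
  exact: lev_inv_eq (lev_trans X_npc (lev_sym M1) (lev_trans X_npc L M2)).
have [_ _ []] := red_lev M2 r2; exists p1'; rewrite drevK.
exact: lev_trans (lev_sym L) M1.
Qed.

(** If both [a] and [b] can be first darts of a walk equivalent to [p], then so can
   [a, b'], by inversion of the equivalence. In the other cases the walks asked
   for are written down, and a backtrack in one of them would make [a] or [b] a
   first dart although it is not one. *)
Lemma mv_Sq x a b a' b' p : red x p -> Sq x a b a' b' -> exists pa pb pw,
  [/\ red a.2 pa, red b.2 pb & red a'.2 pw] /\
  [/\ mv x a p pa, mv x b p pb, mv a.2 b' pa pw & mv b.2 a' pb pw].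
Proof.
move=> rp S.
wlog [A|nA] : a b a' b' S / (exists r, lev x p (a :: r)) \/
    ~ (exists r, lev x p (a :: r)) /\ ~ (exists r, lev x p (b :: r)).
  move=> W; have [A|nA] := pselect (exists r, lev x p (a :: r)).
    by apply: W => //; left.
  have [B|nB] := pselect (exists r, lev x p (b :: r)); last by apply: W => //; right.
  have [|pb [pa [pw [[? ? rw] [? ? ? ?]]]]] := W _ _ _ _ (Sq_sym S); first by left.
  by exists pa, pb, pw; rewrite (Sq_end S).
- case: A => r pr; have [_ rr nr] := red_lev pr rp.
  have [[t pt]|nB] := pselect (exists r, lev x p (b :: r)).
    case: (lev_inv (lev_trans X_npc (lev_sym pr) pt)) => [[e _]|].
      by have := Sq_neq S.
    case=> [a1 [b1 [w [S1 rw wt]]]]; have [e1 e2] := Sq_uniq X_npc S S1.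
    rewrite -e1 -e2 in rw wt; exists r, t, w.
    split; first by rewrite (Sq_end S); split=> //;
      [exact: red_cons (red_lev pt rp) | exact: red_cons (red_lev rw rr)].
    by split; [left|left|left|left; apply: lev_sym].
  have [rb mb] : red b.2 (drev x b :: p) /\ mv x b p (drev x b :: p).
    have d := dart_rev (Sq_dart2 S); split; last first.
      by right; apply: lev_refl; rewrite /= d red_walk.
    by split=> //; rewrite drevK.
  have d' := dart_rev (Sq_dart3 S).
  exists r, (drev x b :: p), (drev a.2 b' :: r); split.
    split=> //; rewrite (Sq_end S); split=> //=; rewrite drevK => -[t rt].
    apply: nB; exists (a' :: t); apply: (lev_trans X_npc pr).
    have /andP[_ wt] := lev_walkr rt.
    apply: lev_trans (lev_Sq S _) => //; last by rewrite (Sq_end S).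
    by apply: lev_cons => //; apply: Sq_dart S.
  split=> //; first by left.
    by right; apply: lev_refl; rewrite /= d' red_walk.
  left; apply: (@lev_trans _ X_npc _ _ (drev x b :: a :: r)).
    by apply: lev_cons => //; apply: dart_rev (Sq_dart2 S).
  have := Sq_rot (Sq_sym S) => Q; apply: (lev_Sq Q); exact: red_walk.
case: nA => nA nB.
have pushed k : dart x k -> (~ exists r, lev x p (k :: r)) ->
    red k.2 (drev x k :: p) /\ mv x k p (drev x k :: p).
  move=> xk nk; split; last first.
    by right; apply: lev_refl; rewrite /= (dart_rev xk) red_walk.
  by split=> //; rewrite ?drevK //; apply: dart_rev.
have [ra ma] := pushed a (Sq_dart S) nA; have [rb mb] := pushed b (Sq_dart2 S) nB.
have d' := dart_rev (Sq_dart3 S).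
exists (drev x a :: p), (drev x b :: p), (drev a.2 b' :: drev x a :: p).
split; split=> //.
- rewrite (Sq_end S); split=> //; rewrite drevK => -[t] /lev_inv[[e _]|].
    by have := Sq_neq (Sq_rot S); rewrite e.
  case=> [c [d [w [Q L _]]]]; have [_ e] := Sq_uniq X_npc (Sq_rot S) Q.
  by apply: nB; exists w; rewrite e.
- by right; apply: lev_refl; rewrite /= d' (dart_rev (Sq_dart S)) red_walk.
- by right; rewrite (Sq_end S); apply: (lev_Sq (Sq_rot (Sq_sym (Sq_rot S)))); exact: red_walk.
Qed.

End ReducedClasses.

(** * Distance to a base vertex *)

Section Depth.
Variable X : cubeComplex.
Hypothesis X_npc : nonpos_curved X.
Hypothesis X_conn : one_connected X.
Implicit Types (x y u v c e : cell X) (a b k : cell X * cell X).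
Implicit Types (p q r : seq (cell X * cell X)).

(** The default value is the same for all walks, so that equivalent walks have
   equal representatives. *)
Definition canon x p := xget [::] [set q | lev x p q].

Lemma canonP x p : walk x p -> lev x p (canon x p).
Proof.
move=> /lev_refl L; rewrite /canon.
by case: xgetP => [q _ //|no]; case: (no p).
Qed.

Lemma canon_eq x p q : lev x p q -> canon x p = canon x q.
Proof.
move=> L; congr xget; apply/seteqP; split=> r /= L'.
  exact: lev_trans (lev_sym L) L'.
exact: lev_trans L L'.
Qed.

Lemma canon_walk x p : walk x p -> canon x (canon x p) = canon x p.
Proof. by move=> /canonP/canon_eq. Qed.

(** The states of the monodromy action used to compare reduced walks: a vertex
   and a chosen representative of a class of reduced walks from it to [y]. *)
Definition good_class y (s : cell X * seq (cell X * cell X)) :=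
  [/\ red s.1 s.2, canon s.1 s.2 = s.2 & wend s.1 s.2 = y].

Definition class_act y (s : cell X * seq (cell X * cell X)) a :=
  xget s [set s' | [/\ good_class y s', s'.1 = a.2 & mv s.1 a s.2 s'.2]].

Lemma good_canon y x p : red x p -> wend x p = y -> good_class y (x, canon x p).
Proof.
move=> rp ep; have L := canonP (red_walk rp); split=> //=.
- exact: red_lev L rp.
- by rewrite canon_walk // red_walk.
- by rewrite -(lev_wend L).
Qed.

Lemma class_actP y s a : good_class y s -> dart s.1 a ->
  [/\ good_class y (class_act y s a), (class_act y s a).1 = a.2 &
      mv s.1 a s.2 (class_act y s a).2].
Proof.
case: s => x p [/= rp cp ep] xa.
rewrite /class_act; case: xgetP => [s' _ //|/= no].
have [p' rp' m] := mv_ex X_npc xa rp; case: (no (a.2, canon a.2 p')); split=> //=.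
  by apply: good_canon; rewrite // (mv_wend m).
exact: mv_levr (canonP (red_walk rp')) m.
Qed.

Lemma good_class_uniq y x s1 s2 : good_class y s1 -> good_class y s2 ->
  s1.1 = x -> s2.1 = x -> lev x s1.2 s2.2 -> s1 = s2.
Proof.
case: s1 s2 => x1 p1 [x2 p2] [/= _ c1 _] [/= _ c2 _] e1 e2 L.
by rewrite -c1 -c2 e1 e2; congr (_, _); apply: canon_eq.
Qed.

Lemma class_act_eq y s a s' : good_class y s -> dart s.1 a -> good_class y s' ->
  s'.1 = a.2 -> mv s.1 a s.2 s'.2 -> class_act y s a = s'.
Proof.
move=> gs sa gs' e m; have [g1 o1 m1] := class_actP gs sa.
apply: (good_class_uniq g1 gs' o1 e).
have [rs _ _] := gs; have [r1 _ _] := g1; have [r2 _ _] := gs'.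
apply: (mv_uniq X_npc (lev_refl (red_walk rs)) _ _ m1 m); rewrite -?e -?o1 //.
by rewrite e -o1.
Qed.

Lemma class_act_dart y s a : good_class y s -> dart s.1 a ->
  [/\ good_class y (class_act y s a), (class_act y s a).1 = a.2 &
      class_act y (class_act y s a) (drev s.1 a) = s].
Proof.
move=> gs sa; have [g1 o1 m1] := class_actP gs sa; split=> //.
by apply: class_act_eq; rewrite // o1; [apply: dart_rev | apply: mv_rev].
Qed.

Lemma class_act_Sq y s a b a' b' : good_class y s -> Sq s.1 a b a' b' ->
  class_act y (class_act y s a) b' = class_act y (class_act y s b) a'.
Proof.
move=> gs S; have [rs _ es] := gs.
have [pa [pb [pw [[ra rb rw] [ma mb ma' mb']]]]] := mv_Sq X_npc rs S.
have ea := mv_wend ma; have eb := mv_wend mb; have ew := mv_wend mb'.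
have step z p k p' : red z p -> wend z p = y -> dart z k -> red k.2 p' ->
    mv z k p p' -> class_act y (z, canon z p) k = (k.2, canon k.2 p').
  move=> rp ep zk rp' m; apply: class_act_eq => //=; first exact: good_canon.
    by apply: good_canon; rewrite // (mv_wend m).
  apply: (mv_levr X_npc (canonP (red_walk rp'))).
  exact: mv_levl (canonP (red_walk rp)) m.
have es' : s = (s.1, canon s.1 s.2) by have [_ -> _] := gs; case: (s).
rewrite es' (step _ _ a pa) ?(step _ _ b pb) ?(Sq_dart S) ?(Sq_dart2 S) //=.
rewrite (step _ _ b' pw) ?(step _ _ a' pw) ?(Sq_dart3 S) ?(Sq_dart4 S) //.
- by rewrite (Sq_end S).
- by rewrite eb.
- by rewrite ea.
- by rewrite -(Sq_end S).
Qed.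

Lemma class_act_wrev y x p : red x p -> wend x p = y ->
  foldl (class_act y) (y, [::]) (wrev x p) = (x, canon x p).
Proof.
elim: p x => [|a p IH] x /=.
  move=> vx <-; congr (_, _); symmetry; apply: (@lev_nilr _ x).
  by apply: lev_sym; apply: canonP.
case=> xa rp no ep; rewrite foldl_rcons (IH _ rp ep).
apply: class_act_eq.
- exact: good_canon.
- exact: dart_rev.
- by apply: good_canon.
- by [].
have rap : red x (a :: p) by [].
rewrite /=; right; rewrite drevK.
apply: (lev_trans X_npc (lev_sym (canonP (red_walk rap)))).
by apply: lev_cons => //; apply: canonP; apply: red_walk.
Qed.

(** Going backwards along a reduced walk, starting from the class of the trivial
   walk, builds the class of that walk. So the closed walk that follows [p]
   backwards and then [q] first builds the class of [p]; it must bring it back to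
   the trivial class, which going along [q] does to the class of [q] only. *)
Lemma red_uniq x p q : red x p -> red x q -> wend x p = wend x q -> lev x p q.
Proof.
have [_ _ X_sc] := X_conn; move=> rp rq epq; set y := wend x q.
have vy : vertex y by apply: wend_vertex; apply: red_walk.
have gy : good_class y (y, [::]).
  by split=> //=; apply: (@lev_nilr _ y); apply: lev_sym; apply: canonP.
have fix_y p' : red x p' -> wend x p' = y ->
    foldl (class_act y) (x, canon x p') q = (y, [::]).
  move=> rp' ep'; rewrite -(class_act_wrev rp' ep') -foldl_cat.
  have [w e] := wrev_walk (red_walk rp'); rewrite ep' in w e.
  apply: (monodromy (@class_act_dart y) (@class_act_Sq y)) => //=.
    by rewrite walk_cat w e red_walk.
  by rewrite wend_cat e.
have gx p' : red x p' -> wend x p' = y -> good_class y (x, canon x p').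
  exact: good_canon.
have := act_wrev (@class_act_dart y) (gx _ rp epq) (red_walk rq).
rewrite (fix_y _ rp epq) -(fix_y _ rq erefl).
rewrite (act_wrev (@class_act_dart y) (gx _ rq erefl) (red_walk rq)) => -[e].
by apply: (lev_trans X_npc (canonP (red_walk rp))); rewrite -e; apply/lev_sym/canonP/red_walk.
Qed.

(** Moving the origin of the trivial walk along any walk gives a reduced one. *)
Lemma red_ex x y : vertex x -> vertex y -> exists2 p, red x p & wend x p = y.
Proof.
have [_ X_pc _] := X_conn; move=> vx vy; have [p] := X_pc y x vy vx.
rewrite edge_path_walk path_end_wend => w e.
have gy : good_class y (y, [::]).
  by split=> //=; apply: (@lev_nilr _ y); apply: lev_sym; apply: canonP.
have [[]] := act_walk (@class_act_dart y) gy w.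
by rewrite e; set s := foldl _ _ _ => r _ eW ex; exists s.2; rewrite -ex.
Qed.

Definition depth y x := size (xget [::] [set p | red x p /\ wend x p = y]).

Lemma depth_red x p : red x p -> depth (wend x p) x = size p.
Proof.
rewrite /depth => rp; case: xgetP => [q _ [rq e]|/(_ p) []//].
exact: lev_size (red_uniq rq rp e).
Qed.

Lemma depthxx x : vertex x -> depth x x = 0%N.
Proof. by move=> vx; rewrite -[LHS]/(depth (wend x [::]) x) depth_red. Qed.

Definition desc y x a := dart x a && (depth y a.2 < depth y x)%N.

Lemma desc_dart y x a : desc y x a -> dart x a.
Proof. by case/andP. Qed.

Lemma dart_depth y x a : vertex y -> dart x a ->
  (exists p, [/\ red x (a :: p), wend x (a :: p) = y & depth y x = (depth y a.2).+1]) \/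
  depth y a.2 = (depth y x).+1.
Proof.
move=> vy xa; have [p rp ep] := red_ex (dart_vertex xa) vy.
have [p' rp' [m|m]] := mv_ex X_npc xa rp; [left|right]; have e := lev_wend m.
  exists p'; have r := red_lev X_npc m rp; rewrite -ep e; split=> //.
  by rewrite (depth_red r); congr _.+1; apply: esym (depth_red rp').
have r := red_lev X_npc m rp'.
by rewrite -ep (depth_red rp); apply: (depth_red r).
Qed.

Lemma depth_desc y x a : vertex y -> desc y x a -> depth y x = (depth y a.2).+1.
Proof.
move=> vy /andP[xa lt]; have [[p [_ _ ->]]//|e] := dart_depth vy xa.
by rewrite e ltnNge leqnSn in lt.
Qed.

Lemma depth_asc y x a : vertex y -> dart x a -> ~~ desc y x a ->
  depth y a.2 = (depth y x).+1.
Proof.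
move=> vy xa; rewrite /desc xa /=; have [[p [_ _ ->]]|//] := dart_depth vy xa.
by rewrite ltnSn.
Qed.

Lemma desc_red y x a : vertex y -> desc y x a ->
  exists p, red x (a :: p) /\ wend x (a :: p) = y.
Proof.
move=> vy /andP[xa lt]; have [[p [? ? _]]|e] := dart_depth vy xa; first by exists p.
by rewrite e ltnNge leqnSn in lt.
Qed.

Lemma red_desc x a p : red x (a :: p) -> desc (wend x (a :: p)) x a.
Proof.
move=> r; have [xa rp _] := r; rewrite /desc xa (depth_red r) /=.
by rewrite (depth_red rp : depth (wend a.2 p) _ = _).
Qed.

Lemma desc_cons y x a p : desc y x a -> red a.2 p -> wend a.2 p = y -> red x (a :: p).
Proof.
move=> /andP[xa lt] rp ep; split=> // -[r L]; have r' := red_lev X_npc L rp.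
have rr : red x r by have [] := r'.
move: lt; rewrite -{1}ep (depth_red rp) (lev_size L) -ep (lev_wend L) /=.
by rewrite (depth_red rr) ltnNge leqnSn.
Qed.

Lemma desc_rev y x a : dart x a -> ~~ desc y x a -> vertex y -> desc y a.2 (drev x a).
Proof. by move=> xa na vy; rewrite /desc (dart_rev xa) /= (depth_asc vy xa na). Qed.

Lemma depth0 y x : vertex x -> vertex y -> depth y x = 0%N -> x = y.
Proof.
move=> vx vy; have [p rp <-] := red_ex vx vy.
by rewrite (depth_red rp); case: p {rp}.
Qed.

Lemma desc_ex y x : vertex x -> vertex y -> x <> y -> exists a, desc y x a.
Proof.
move=> vx vy; have [[|a p] rp <-] := red_ex vx vy => // _.
by exists a; apply: red_desc.
Qed.

(** Inversion of the equivalence between the two reduced walks to [y] that start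
   with [a] and with [b]. *)
Lemma desc_Sq y x a b : vertex y -> desc y x a -> desc y x b -> a <> b ->
  exists a' b', [/\ Sq x a b a' b', desc y a.2 b' & desc y b.2 a'].
Proof.
move=> vy /(desc_red vy)[p [rp ep]] /(desc_red vy)[q [rq eq]] ab.
have L := red_uniq rp rq (etrans ep (esym eq)).
case: (lev_inv L) => [[]//|[a' [b' [r [S pr rq']]]]].
have r1 := red_lev X_npc pr (red_cons rp); have r2 := red_lev X_npc (lev_sym rq') (red_cons rq).
exists a', b'; split=> //.
  by rewrite -ep -[wend x _]/(wend a.2 p) (lev_wend pr); apply: red_desc.
by rewrite -eq -[wend x _]/(wend b.2 q) -(lev_wend rq'); apply: red_desc.
Qed.

End Depth.

(** * Hyperplanes *)

Section Hyperplanes.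
Variable X : cubeComplex.
Hypothesis X_npc : nonpos_curved X.
Hypothesis X_conn : one_connected X.
Implicit Types (x y z u v w c e : cell X) (a b k m : cell X * cell X).
Implicit Types (p q r : seq (cell X * cell X)) (h : set (cell X)).

Lemma parallel_sym e e' : parallel e e' -> parallel e' e.
Proof. exact: rst_sym. Qed.

Lemma parallel_trans e e1 e' : parallel e e1 -> parallel e1 e' -> parallel e e'.
Proof. exact: rst_trans. Qed.

(** A ladder is a strip of squares: the darts [k] and [k0] are joined by a
   sequence of parallel darts, each spanning a square with the next dart of the
   walk [p]. *)
Fixpoint ladder x p k k0 : Prop := if p is a :: p' then
  exists a' k', Sq x a k a' k' /\ ladder a.2 p' k' k0 else dart x k /\ k = k0.

Lemma ladder_dart x p k k0 : ladder x p k k0 -> dart x k.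
Proof. by case: p => [[]//|a p [a' [k' [/Sq_dart2]]]]. Qed.

Lemma ladder_end x p k k0 : ladder x p k k0 -> dart (wend x p) k0.
Proof.
elim: p x k => [|a p IH] x k /=; first by case=> ? <-.
by case=> [a' [k' [_ /IH]]].
Qed.

Lemma ladder_parallel x p k k0 : ladder x p k k0 -> parallel k.1 k0.1.
Proof.
elim: p x k => [|a p IH] x k /=; first by case=> _ <-; apply: rst_refl.
by case=> [a' [k' [S /IH]]]; apply: parallel_trans; apply: Sq_parallel S.
Qed.

Lemma ladder_cat x p q k k0 : ladder x (p ++ q) k k0 <->
  exists2 k1, ladder x p k k1 & ladder (wend x p) q k1 k0.
Proof.
elim: p x k => [|a p IH] x k /=.
  by split=> [L|[k1 [_ <-]]//]; exists k => //; split=> //; apply: ladder_dart L.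
split=> [[a' [k' [S /IH[k1 L1 L2]]]]|[k1 [a' [k' [S L1]]] L2]].
  by exists k1 => //; exists a', k'.
by exists a', k'; split=> //; apply/IH; exists k1.
Qed.

(** Moving a ladder across a square of its walk: the two sides of the square and
   the rung between them span a cube. *)
Lemma ladder_lev x p q k k0 : lev x p q -> ladder x p k k0 -> ladder x q k k0.
Proof.
move=> L; elim: L k => {x p q} [//|x a p q xa _ IH|x a b a' b' p q r S _ IH1 _ IH2] k /=.
  by case=> a' [k' [S /IH L]]; exists a', k'.
case=> [a1 [k1 [S1 /IH1 /= [c2 [k2 [S2 L]]]]]].
have [A [B [K [/= Q1 Q2 _]]]] := Sq_cube X_npc (Sq_rot S) (Sq_rot S1) S2.
exists B, K; split=> //; apply: IH2.
exists (drev k2.2 A), k2; rewrite (Sq_end S); split=> //.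
by have := Sq_rot Q2; rewrite /= -(Sq_end S) drevK.
Qed.

Lemma ladder_back x a p k k' k0 a' : Sq x a k a' k' ->
  ladder a.2 (drev x a :: p) k' k0 -> ladder x p k k0.
Proof. by move=> S /= [c [k'' [Q]]]; have [_ <-] := Sq_uniq X_npc (Sq_rot S) Q. Qed.

(** A backtrack of the walk can be removed from the ladder, because a square is
   determined by two of its sides ([ladder_back]). *)
Lemma ladder_red x p k k0 : ladder x p k k0 ->
  exists q, [/\ red x q, wend x q = wend x p & ladder x q k k0].
Proof.
elim: p x k => [|a p IH] x k /=.
  by case=> xk e; exists [::]; split=> //; apply: dart_vertex xk.
case=> [a' [k' [S /IH[q [rq eq L]]]]].
have [[r qr]|no] := pselect (exists r, lev a.2 q (drev x a :: r)).
  exists r; split; first by case: (red_lev X_npc qr rq).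
    by rewrite -eq (lev_wend qr).
  by apply: (ladder_back S); apply: ladder_lev L.
exists (a :: q); split=> //; first by split=> //; apply: Sq_dart S.
by exists a', k'.
Qed.

Lemma ladder_flip x p k k0 : ladder x p k k0 -> exists p',
  ladder k.2 p' (drev x k) (drev (wend x p) k0) /\ wend k.2 p' = k0.2.
Proof.
elim: p x k => [|a p IH] x k /=.
  by case=> xk <-; exists [::]; split=> //; split=> //; apply: dart_rev.
case=> [a' [k' [S /IH[p' [L e]]]]]; exists (a' :: p') => /=.
rewrite (Sq_end S); split=> //; exists a, (drev a.2 k'); split=> //.
exact: Sq_sym (Sq_rot (Sq_sym S)).
Qed.

Lemma parallel_ladder e e' x k : parallel e e' -> dart x k -> k.1 = e ->
  exists p k', ladder x p k k' /\ k'.1 = e'.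
Proof.
move=> P; have {}P := clos_rst_rst1n _ _ _ _ P.
elim: P x k => {e e'} [e|e e1 e' op _ IH] x k xk ke.
  by exists [::], k.
have {}op : opposite e e1 by case: op => // /opposite_sym.
have [a [k' [a' [S ke1]]]] := opposite_Sq op xk ke.
have [p [k0 [L ke0]]] := IH _ _ (Sq_dart3 S) ke1.
by exists (a :: p), k0; split=> //; exists a', k'.
Qed.

Lemma same_edge z y k k0 : dart z k -> dart y k0 -> k.1 = k0.1 ->
  z = y /\ k = k0 \/ z = k0.2 /\ k = drev y k0.
Proof.
move=> zk yk0 e.
have [ez|ez] : z = y \/ z = k0.2.
  by apply: (dart_end yk0 (dart_vertex zk)); rewrite -e; apply: dart_le.
  by left; split=> //; rewrite ez in zk; apply: (dart_uniq zk yk0).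
by right; split=> //; rewrite ez in zk; apply: (dart_uniq zk (dart_rev yk0)).
Qed.

(** The two cases are the two sides of the hyperplane: a ladder from [x] ends at one
   of the two ends of [k0], and flipping it changes the end. *)
Lemma hyp_dart_cases y k0 x k : dart y k0 -> dart x k -> parallel k.1 k0.1 ->
  (exists p, ladder x p k k0 /\ wend x p = y) \/
  (exists p, ladder k.2 p (drev x k) k0 /\ wend k.2 p = y).
Proof.
move=> yk0 xk /parallel_ladder/(_ xk erefl)[p [k' [L e]]].
case: (same_edge (ladder_end L) yk0 e) => -[ez ek]; rewrite ek in L.
  by left; exists p.
have [p' [L' e']] := ladder_flip L; right; exists p'.
by rewrite e' ez drevK in L' *.
Qed.

(** By uniqueness of reduced walks, the ladder can be moved to a reduced walk
   starting with [a]. *)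
Lemma ladder_desc y x p k k0 a : ladder x p k k0 -> wend x p = y -> desc y x a ->
  exists a' k' q, [/\ Sq x a k a' k', ladder a.2 q k' k0 & wend a.2 q = y].
Proof.
move=> /ladder_red[q [rq <- L]] ep ya; have vy : vertex y.
  by rewrite -ep; apply: wend_vertex; apply: red_walk.
have [r [rr er]] := desc_red X_npc X_conn vy ya.
have /ladder_lev/(_ L) /= := red_uniq X_npc X_conn rq rr (etrans ep (esym er)).
by case=> a' [k' [S Lr]]; exists a', k', r.
Qed.

(** Otherwise [k] would span a square with itself. *)
Lemma ladder_asc y x p k k0 : ladder x p k k0 -> wend x p = y -> ~~ desc y x k.
Proof.
move=> L e; apply/negP => /(ladder_desc L e)[a' [k' [q [S _ _]]]].
by have := Sq_neq S.
Qed.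

(** If the ladder joining [k] to [k0] starts on the side of [x], its first square
   can be chosen to contain [a]; if not, [k] is itself descending. *)
Lemma hyp_desc_Sq y k0 x k a : dart y k0 -> dart x k -> parallel k.1 k0.1 ->
  desc y x a -> a <> k -> exists a' k', Sq x a k a' k'.
Proof.
move=> yk0 xk kk0 ya ak; have vy := dart_vertex yk0.
have [[p [L e]]|[p [L e]]] := hyp_dart_cases yk0 xk kk0.
  by have [a' [k' [q [S _ _]]]] := ladder_desc L e ya; exists a', k'.
have yk : desc y x k.
  have := desc_rev X_npc X_conn (dart_rev xk) (ladder_asc L e) vy.
  by rewrite drevK.
by have [a' [k' [S _ _]]] := desc_Sq X_npc X_conn vy ya yk ak; exists a', k'.
Qed.

(** Once reduced, a ladder from [k2] to [k1] or its reverse has length 0 or 1; in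
   length 1, it would be a square with two equal sides. *)
Lemma hyp_uniq x k1 k2 : dart x k1 -> dart x k2 -> parallel k1.1 k2.1 -> k1 = k2.
Proof.
move=> xk1 xk2 /parallel_sym/parallel_ladder/(_ xk2 erefl)[p [k' [L e]]].
have := same_edge (ladder_end L) xk1 e.
have [q [rq <- {}L]] := ladder_red L; case=> -[eq ek].
  have := depth_red X_npc X_conn rq; rewrite eq (depthxx X_npc X_conn (dart_vertex xk1)).
  by case: q rq L eq => //= _ [_ ->].
have rk1 : red x [:: k1].
  split=> //=; first by case/dartP: xk1 => -[].
  by case=> r /lev_size.
have /ladder_lev/(_ L) /= := red_uniq X_npc X_conn rq rk1 eq.
case=> a' [k'' [S [_ ek']]]; rewrite ek' ek in S.
by have := Sq_neq (Sq_rot S).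
Qed.

(** The crossing propagates from [y] to [x], by induction on the distance to [y].
   If [k] or [m] is descending, [hyp_desc_Sq] applies. If not, a descending dart
   at [x] spans squares with both, and at its end the two hyperplanes still have
   dual edges, which span a square by induction. The three squares complete to a
   cube. *)
Lemma hyp_cross y k0 m0 k0' m0' x k m : Sq y k0 m0 k0' m0' ->
  dart x k -> dart x m -> parallel k.1 k0.1 -> parallel m.1 m0.1 ->
  exists k' m', Sq x k m k' m'.
Proof.
move=> S0; have yk0 := Sq_dart S0; have ym0 := Sq_dart2 S0.
have vy := dart_vertex yk0.
have [n] := ubnP (depth y x); elim: n x k m => // n IH x k m xn xk xm pk pm.
have km : k <> m.
  move=> e; case: (Sq_neq S0); apply: (hyp_uniq yk0 ym0).
  by apply: parallel_trans (parallel_sym pk) _; rewrite e.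
have [yk|nyk] := boolP (desc y x k); first exact: hyp_desc_Sq ym0 xm pm yk km.
have [ym|nym] := boolP (desc y x m).
  have [|m' [k' S]] := hyp_desc_Sq yk0 xk pk ym; first exact/nesym.
  by exists k', m'; apply: Sq_sym.
have [exy|nxy] := pselect (x = y).
  rewrite exy in xk xm *; rewrite (hyp_uniq xk yk0 pk) (hyp_uniq xm ym0 pm).
  by exists k0', m0'.
have [a ya] := desc_ex X_npc X_conn (dart_vertex xk) vy nxy.
have [|a1 [k' S1]] := hyp_desc_Sq yk0 xk pk ya; first by move=> e; rewrite -e ya in nyk.
have [|a2 [m' S2]] := hyp_desc_Sq ym0 xm pm ya; first by move=> e; rewrite -e ya in nym.
have [|||||k'' [m'' S3]] := IH a.2 k' m'.
- by move: xn; rewrite (depth_desc X_npc X_conn vy ya).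
- exact: Sq_dart3 S1.
- exact: Sq_dart3 S2.
- by apply: parallel_trans pk; apply: parallel_sym; apply: Sq_parallel S1.
- by apply: parallel_trans pm; apply: parallel_sym; apply: Sq_parallel S2.
have [A [B [K [/= Q _ _]]]] := Sq_cube X_npc (Sq_rot S1) (Sq_rot S2) S3.
by exists B, K.
Qed.

Lemma hyp_parallel h e e' : hyperplane h -> h e -> h e' -> parallel e e'.
Proof.
case=> e0 _ -> /= p p'; exact: parallel_trans (parallel_sym p) p'.
Qed.

Lemma hyp_closed h e e' : hyperplane h -> h e -> parallel e e' -> h e'.
Proof. case=> e0 _ -> /= p p'; exact: parallel_trans p p'. Qed.

Lemma parallel_edge e e' : parallel e e' -> edge e = edge e'.
Proof.
by elim=> {e e'} [e e' [-> -> _]|//|e e' _ ->|e e1 e' _ -> _ ->].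
Qed.

Lemma hyp_edge h e : hyperplane h -> h e -> edge e.
Proof. by case=> e0 ee -> /= /parallel_edge <-. Qed.

Lemma hyp_eq h h' e : hyperplane h -> hyperplane h' -> h e -> h' e -> h = h'.
Proof.
move=> hh hh' he h'e; apply/seteqP; split=> e1 he1.
  exact: hyp_closed hh' h'e (hyp_parallel hh he he1).
exact: hyp_closed hh he (hyp_parallel hh' h'e he1).
Qed.

Lemma transverse_Sq h h' : hyperplane h -> hyperplane h' -> transverse h h' ->
  exists y k m k' m', [/\ Sq y k m k' m', h k.1 & h' m.1].
Proof.
move=> hh hh' [ne [c [e he ec] [e' he' ec']]].
have [y vy yc] := vertex_below c.
have [k [yk kc ek]] := parallel_in_cube (hyp_edge hh he) ec vy yc.
have [m [ym mc em]] := parallel_in_cube (hyp_edge hh' he') ec' vy yc.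
have hk := hyp_closed hh he ek; have hm := hyp_closed hh' he' em.
have [|k' [m' [S _ _]]] := Sq_ex yk ym _ kc mc.
  by move=> ekm; apply: ne; apply: (hyp_eq hh hh' hk); rewrite ekm.
by exists y, k, m, k', m'.
Qed.

Lemma transverse_cross h h' x k m : hyperplane h -> hyperplane h' ->
  transverse h h' -> dart x k -> dart x m -> h k.1 -> h' m.1 ->
  exists k' m', Sq x k m k' m'.
Proof.
move=> hh hh' T xk xm hk hm.
have [y [k0 [m0 [k0' [m0' [S hk0 hm0]]]]]] := transverse_Sq hh hh' T.
exact: (hyp_cross S xk xm (hyp_parallel hh hk hk0) (hyp_parallel hh' hm hm0)).
Qed.

End Hyperplanes.

(** * The Helly property *)

Section Helly.
Variable X : cubeComplex.
Hypothesis X_npc : nonpos_curved X.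
Hypothesis X_conn : one_connected X.
Implicit Types (a x y z u v w c e : cell X) (b k m : cell X * cell X).
Implicit Types (p q r : seq (cell X * cell X)) (h : set (cell X)).

(** The carrier of the hyperplane of [ka] is gated: if [a] is its vertex nearest
   to [x], ladders along it that lead to [a] also lead towards [x]. At the
   first step that would not, two descending darts span a square whose last vertex
   still belongs to the carrier but is too close to [x]. *)
Lemma gate x a ka z kz p : vertex x ->
    (forall u k, dart u k -> parallel k.1 ka.1 -> (depth x a <= depth x u)%N) ->
    red z p -> wend z p = a -> ladder z p kz ka ->
  depth x z = (depth x a + size p)%N.
Proof.
move=> vx min; have [n] := ubnP (size p); elim: n z kz p => // n IH z kz [|b p] /=.
  by rewrite addn0 => _ _ ->.
rewrite ltnS => pn rbp ep [b1 [kz' [S L]]]; have [zb rp nbp] := rbp.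
have IHp := IH _ _ _ pn rp ep L.
have [d|nd] := boolP (desc x b.2 (drev z b)); last first.
  have zb' : desc x z b.
    by have := desc_rev X_npc X_conn (dart_rev zb) nd vx; rewrite drevK.
  by rewrite (depth_desc X_npc X_conn vx zb') IHp addnS.
have dz : depth x b.2 = (depth x z).+1 := depth_desc X_npc X_conn vx d.
case: p L rp rbp ep pn nbp IHp => [|c p] L rp rbp ep pn nbp IHp.
  have pz : parallel kz.1 ka.1.
    by apply: parallel_trans (ladder_parallel L); apply: Sq_parallel S.
  by have := min z kz (Sq_dart2 S) pz; rewrite -ep /= dz ltnn.
have [c1 [kz'' [S1 L1]]] := L.
have [bc rp' _] := rp.
have IHp' := IH _ _ _ (ltnW pn) rp' ep L1.
have dc : desc x b.2 c by rewrite /desc bc IHp' IHp /= addnS.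
have ne : drev z b <> c.
  by move=> e; apply: nbp; exists p; rewrite e; apply: lev_refl; apply: red_walk.
have [r' [c' [Q dc' dr']]] := desc_Sq X_npc X_conn vx d dc ne.
have := Sq_rot Q; rewrite /= drevK => Q'.
have LL : lev z [:: b, c & p] (c' :: drev c.2 r' :: p).
  by apply: lev_Sq => //; apply: red_walk.
have Lz : ladder z [:: b, c & p] kz ka by exists b1, kz'.
have [c2 [kw [S2 Lw]]] := ladder_lev X_npc LL Lz.
have [_ rw _] := red_lev X_npc LL rbp.
have ew : wend c'.2 (drev c.2 r' :: p) = a by rewrite -ep; apply: esym (lev_wend LL).
have := IH c'.2 kw (drev c.2 r' :: p) pn rw ew Lw; rewrite -[RHS]IHp dz.
by rewrite (depth_desc X_npc X_conn vx dc') => /eqP; rewrite -addn2 -[X in X == _]addn0 eqn_add2l.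
Qed.

(** So a geodesic to [a] in the carrier, followed by one from [a] to [x], is a
   geodesic. *)
Lemma gate_red x a ka z kz p r : vertex x ->
    (forall u k, dart u k -> parallel k.1 ka.1 -> (depth x a <= depth x u)%N) ->
    red z p -> wend z p = a -> ladder z p kz ka -> red a r -> wend a r = x ->
  red z (p ++ r).
Proof.
move=> vx min rp ep L ra er; elim: p z kz rp ep L => [|b p IH] z kz /=.
  by move=> _ ->.
move=> rbp ep Lb; have [b1 [kz' [S L]]] := Lb; have [zb rp _] := rbp.
apply: (@desc_cons X X_npc X_conn x).
- rewrite /desc zb (gate vx min rp ep L).
  by rewrite (gate (p := b :: p) vx min rbp ep Lb) /= addnS.
- exact: IH L.
- by rewrite wend_cat ep.
Qed.

(** Let [x] be adjacent to all of [s], let [h] be a further hyperplane and let [a],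
   adjacent to [h], be nearest to [x]. For [h'] in [s] there is a vertex [z]
   adjacent to [h] and [h'], which cross. By [gate_red] some reduced walk from [z]
   to [x] passes through [a]; it carries a ladder along [h'], since both its ends
   are adjacent to [h'], and therefore [a] is adjacent to [h']. *)
Lemma helly (s : seq (set (cell X))) :
    (forall h, h \in s -> hyperplane h) ->
    (forall h h', h \in s -> h' \in s -> h <> h' -> transverse h h') ->
  exists2 x, vertex x & forall h, h \in s -> exists2 k, dart x k & h k.1.
Proof.
elim: s => [|h s IH] hs T; first by have [[x vx] _ _] := X_conn; exists x.
have [|h1 h2 h1s h2s|x vx xs] := IH; first by move=> h' h's; apply: hs; rewrite inE h's orbT.
  by apply: T; rewrite inE ?h1s ?h2s orbT.
have hh : hyperplane h by apply: hs; rewrite inE eqxx.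
have [hs'|hs'] := boolP (h \in s).
  by exists x => // h'; rewrite inE => /orP[/eqP->|]; apply: xs.
have [a [ka [aka hka min]]] : exists a ka, [/\ dart a ka, h ka.1 &
    forall u k, dart u k -> parallel k.1 ka.1 -> (depth x a <= depth x u)%N].
  pose P n := `[< exists u k, [/\ dart u k, h k.1 & depth x u = n] >].
  have exP : exists n, P n.
    have [e ee eh] := hh; have [v vv ve] := vertex_below e.
    have [w vw] := dart_ex vv ee ve.
    exists (depth x v); apply/asboolP; exists v, (e, w); split=> //.
    by rewrite eh; apply: rst_refl.
  case: (ex_minnP exP) => n /asboolP[a [ka [aka hka <-]]] min; exists a, ka.
  split=> // u k uk pk; apply: min; apply/asboolP; exists u, k; split=> //.
  exact: hyp_closed hh hka (parallel_sym pk).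
exists a; first exact: dart_vertex aka.
move=> h'; rewrite inE => /orP[/eqP->|h's]; first by exists ka.
have hh' : hyperplane h' by apply: hs; rewrite inE h's orbT.
have [ki xki hki] := xs _ h's.
have ne : h <> h' by move=> e; rewrite e h's in hs'.
have [z [k [m [k' [m' [S hk hm]]]]]] : exists z k m k' m', [/\ Sq z k m k' m', h k.1 & h' m.1].
  by apply: transverse_Sq => //; apply: T => //; rewrite inE ?eqxx ?h's ?orbT.
have pk := hyp_parallel hh hk hka; have pm := hyp_parallel hh' hm hki.
(* The vertex [z] may be chosen on the same side of [h] as [a] ... *)
have {z k m k' m' S hk hm pk pm} [z [k [m [k' [m' [p [S Lk ek pm]]]]]]] :
    exists z k m k' m' p, [/\ Sq z k m k' m', ladder z p k ka, wend z p = a & parallel m.1 ki.1].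
  have [[p [L e]]|[p [L e]]] := hyp_dart_cases aka (Sq_dart S) pk.
    by exists z, k, m, k', m', p.
  exists k.2, (drev z k), m', (drev m.2 k'), m, p; split=> //; first exact: Sq_rot.
  by apply: parallel_trans pm; apply/parallel_sym/(Sq_parallel S).
(* ... and on the same side of [h'] as [x]. *)
have [z' [k1 [m1 [q [p' [{}Lk {}ek Lm em]]]]]] : exists z k m q p,
    [/\ ladder z p k ka, wend z p = a, ladder z q m ki & wend z q = x].
  have [[q [L e]]|[q [L e]]] := hyp_dart_cases xki (Sq_dart2 S) pm.
    by exists z, k, m, q, p.
  exists m.2, k', (drev z m), q, (drev z m :: p); split=> //.
  by exists (drev k.2 m'), k; split=> //; apply: Sq_rot (Sq_sym S).
have [p2 [rp2 ep2 Lp2]] := ladder_red X_npc Lk; rewrite ek in ep2.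
have [r ra er] := red_ex X_npc X_conn (dart_vertex aka) vx.
have rpr := gate_red vx min rp2 ep2 Lp2 ra er.
have [q2 [rq2 eq2 Lq2]] := ladder_red X_npc Lm.
have LL : lev z' q2 (p2 ++ r).
  by apply: (red_uniq X_npc X_conn rq2 rpr); rewrite eq2 em wend_cat ep2.
have /ladder_cat[k2 _] := ladder_lev X_npc LL Lq2; rewrite ep2 => Lr.
exists k2; first exact: ladder_dart Lr.
exact: (hyp_closed hh' hki (parallel_sym (ladder_parallel Lr))).
Qed.

End Helly.

(** * Germs of automorphisms *)

Section Dimension.
Variable X : cubeComplex.
Implicit Types (a c : cell X).

(** [mono_dim] for the map and for its inverse. *)
Lemma iso_dim a (F : cell X -> cell X) :
    (forall c c', a <= c -> a <= c' -> (F c <= F c') = (c <= c')) ->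
    (forall c', F a <= c' -> exists2 c, a <= c & F c = c') ->
  forall c, a <= c -> (dim (F c) + dim a)%N = (dim c + dim (F a))%N.
Proof.
move=> mF oF c ac; have Fac : F a <= F c by rewrite mF.
pose G c' := xget a [set c | a <= c /\ F c = c'].
have GP c' : F a <= c' -> a <= G c' /\ F (G c') = c'.
  by move=> /oF[c1 ac1 e]; rewrite /G; case: xgetP => [//|/(_ c1)[]].
have eqF c1 c2 : a <= c1 -> a <= c2 -> F c1 = F c2 -> c1 = c2.
  move=> ac1 ac2 e; have l12 : c1 <= c2 by rewrite -mF // e.
  have l21 : c2 <= c1 by rewrite -mF // e.
  by apply/le_anti; rewrite l12 l21.
have GF c1 : a <= c1 -> G (F c1) = c1.
  by move=> ac1; have [|? ?] := GP (F c1); [rewrite mF | apply: eqF].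
apply/eqP; rewrite eqn_leq; apply/andP; split.
  have := @mono_dim X X (F a) G _ (F c) Fac; rewrite !GF // addnC [X in (_ <= X)%N]addnC.
  rewrite [X in (_ <= X)%N]addnC; apply=> c1 c2 ac1 lt12.
  have [aG1 e1] := GP _ ac1; have [aG2 e2] := GP _ (le_trans ac1 (ltW lt12)).
  by rewrite lt_neqAle -mF // e1 e2 (ltW lt12) andbT; apply/eqP => E;
    move: lt12; rewrite -e1 -e2 E ltxx.
rewrite addnC; apply: (@mono_dim X X a F) => // c1 c2 ac1 lt12.
have ac2 := le_trans ac1 (ltW lt12); rewrite lt_neqAle mF // (ltW lt12) andbT.
by apply/eqP => /(eqF _ _ ac1 ac2) E; rewrite E ltxx in lt12.
Qed.

Lemma square_edges (s y : cell X) (a b k : cell X * cell X) : vertex y -> dim s = 2%N ->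
  dart y a -> dart y b -> a <> b -> a.1 <= s -> b.1 <= s ->
  dart y k -> k.1 <= s -> k = a \/ k = b.
Proof.
move=> vy ds ya yb ab as_ bs yk ks.
have ne : a.1 <> b.1 by move/(dart_uniq ya yb).
have /dartP[[_ ea _] la _ _] := ya; have /dartP[[_ eb _] lb _ _] := yb.
have /dartP[[_ ek _] lk _ _] := yk.
have [psi [cpsi p0 pa pb pN]] := square_chart vy ne ea eb la lb as_ bs.
have [m d w] := cpsi.
have es : psi None None = s by apply: (dim_le_eq pN); rewrite d ds.
have := chart2_edges cpsi ek; rewrite p0 es => /(_ lk ks)[] E; [left|right].
  by apply: (dart_uniq yk ya); rewrite E.
by apply: (dart_uniq yk yb); rewrite E.
Qed.

End Dimension.

(** Only the values of [phi] at the cells that contain [x] matter. *)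
Definition germ (X : cubeComplex) (x : cell X) (phi : cell X -> cell X) :=
  [/\ vertex (phi x),
      forall c c', x <= c -> x <= c' -> (phi c <= phi c') = (c <= c') &
      forall c', phi x <= c' -> exists2 c, x <= c & phi c = c'].

Section Framings.
Variables (L : scomplex) (X : cubeComplex).
Hypothesis L_finite : finite_scomplex L.
Hypothesis X_npc : nonpos_curved X.
Hypothesis X_L : L_cube_complex L X.
Implicit Types (x y c e s : cell X) (t : {fset svert L}) (v : svert L).

(** An isomorphism from [L] to the link of [x], seen as a labelling of the edges at
   [x]. The last clause treats [x] itself as the cell of the empty simplex. *)
Definition framing x (E : svert L -> cell X) :=
  [/\ forall v, edge (E v) && (x <= E v), injective E,
      forall e, edge e -> x <= e -> exists v, E v = e &
      forall t, t = fset0 \/ simplex t <->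
        exists2 c, x <= c & forall v, (v \in t) = (E v <= c)].

Lemma edge_vertexF x e : vertex x -> edge e -> e <= x = false.
Proof.
by move=> /eqP dx /eqP de; apply/negP => /dim_le; rewrite dx de.
Qed.

Lemma framing_ex x : vertex x -> exists E, framing x E.
Proof.
move=> vx; have [f [[g fK gK] fS]] := X_L vx.
exists (fun v => val (g v)); split.
- by move=> v; apply: (valP (g v)).
- by move=> u v /val_inj/(can_inj gK).
- by move=> e ee xe; exists (f (exist _ e (introT andP (conj ee xe)))); rewrite fK.
move=> t; pose s := [fset g v | v in t]%fset.
have st v : (g v \in s) = (v \in t).
  apply/imfsetP/idP => /= [[u ut /(can_inj gK)->]//|vt]; by exists v.
have fs : [fset f v | v in s]%fset = t.
  apply/fsetP=> v; apply/imfsetP/idP => /= [[u us ->]|vt].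
    by rewrite -st fK.
  by exists (g v); rewrite ?st ?gK.
have := fS s; rewrite fs => tS; split=> [[->|/tS[_ [c xc cP]]]|[c xc cP]].
- exists x => // v; rewrite inE; symmetry; apply: edge_vertexF => //.
  by have /andP[] := valP (g v).
- by exists c => // v; rewrite -cP st.
have [->|t0] := eqVneq t fset0; first by left.
right; apply/tS; split.
  have /fset0Pn[v vt] := t0; apply/fset0Pn; exists (g v); by rewrite st.
by exists c => // u; rewrite -(fK u) st cP.
Qed.

Lemma all_svert : exists U : {fset svert L}, forall v, v \in U.
Proof.
have /finite_fsetP[U eU] := L_finite; exists U => v.
by have : [set: svert L] v by []; rewrite eU.
Qed.

Definition code (E : svert L -> cell X) c : {fset svert L} :=
  xget fset0 [set t | forall v, (v \in t) = (E v <= c)].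

Lemma in_code E c v : (v \in code E c) = (E v <= c).
Proof.
rewrite /code; case: xgetP => [t _ /(_ v)//|no].
have [U allU] := all_svert; case: (no [fset v in U | E v <= c]%fset) => u.
by rewrite !inE allU.
Qed.

Section Framed.
Variables (x : cell X) (E : svert L -> cell X).
Hypothesis vx : vertex x.
Hypothesis EP : framing x E.

Lemma code_le c c' : x <= c -> x <= c' -> (code E c `<=` code E c')%fset = (c <= c').
Proof.
have [E1 E2 E3 E4] := EP; move=> xc xc'; apply/fsubsetP/idP => [sub|cc' v].
  apply: (cell_le_edges X_npc vx) => // e ee xe ec.
  by have [v Ev] := E3 e ee xe; rewrite -Ev -in_code sub // in_code Ev.
by rewrite !in_code => Evc; apply: le_trans cc'.
Qed.

Lemma code_inj c c' : x <= c -> x <= c' -> code E c = code E c' -> c = c'.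
Proof.
move=> xc xc' e; apply/le_anti.
by rewrite -(code_le xc xc') -(code_le xc' xc) e fsubset_refl.
Qed.

Lemma code_real c : x <= c -> code E c = fset0 \/ simplex (code E c).
Proof.
by have [_ _ _ E4] := EP; move=> xc; apply/E4; exists c => // v; rewrite in_code.
Qed.

Definition decode t := xget x [set c | x <= c /\ code E c = t].

Lemma decodeP t : t = fset0 \/ simplex t -> x <= decode t /\ code E (decode t) = t.
Proof.
have [_ _ _ E4] := EP; move=> /E4[c xc cP]; rewrite /decode.
case: xgetP => [//|/(_ c)[]]; split=> //.
by apply/fsetP => v; rewrite in_code cP.
Qed.

Lemma codeK c : x <= c -> decode (code E c) = c.
Proof.
by move=> xc; have [? ?] := decodeP (code_real xc); apply: code_inj.
Qed.

Lemma code_vertex : code E x = fset0.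
Proof.
have [E1 _ _ _] := EP; apply/fsetP=> v; rewrite in_code inE.
by apply: edge_vertexF => //; have /andP[] := E1 v.
Qed.

(** The directions of a chart at [x] are the edges of the cell at [x]. *)
Lemma code_card c : x <= c -> #|` code E c| = dim c.
Proof.
have [E1 E2 E3 E4] := EP; move=> xc; have [phi [m d w phi0]] := chart_at vx xc.
have /choice[f fP] : forall i, exists v, E v = phi (dirface i).
  by move=> i; apply: E3; rewrite -?phi0 ?m ?face0_dir // /edge d dirface_dim.
have f_inj : injective f.
  move=> i j fij; have : phi (dirface i) <= phi (dirface j) by rewrite -!fP fij.
  rewrite m dirface_le ?face0_dir // ffunE.
  by case: (i =P j).
have -> : code E c = [fset f i | i in 'I_(dim c)]%fset.
  apply/fsetP=> v; rewrite in_code; apply/idP/imfsetP => /= [vc|[i _ ->]].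
    have /andP[/eqP ev xv] := E1 v; have /w[F eF] := vc.
    have xF : cface_le (face0 _) F by rewrite -m phi0 eF.
    have [|i eFi] := cface_dim1P xF; first by rewrite -d eF.
    by exists i => //; apply: E2; rewrite fP -eF eFi.
  by rewrite fP; apply/w; exists (dirface i).
by rewrite card_imfset //= size_enum_ord.
Qed.

End Framed.
End Framings.

(** * Extending germs by superstar-transitivity *)

Section Extension.
Variables (L : scomplex) (X : cubeComplex).
Hypothesis L_finite : finite_scomplex L.
Hypothesis L_flag : flag L.
Hypothesis L_superstar : superstar_transitive L.
Hypothesis X_npc : nonpos_curved X.
Hypothesis X_L : L_cube_complex L X.
Implicit Types (c e s : cell X) (t : {fset svert L}) (v : svert L).

(** [A] is a set of pairwise adjacent edges at [x], and [F] is given on the cells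
   containing one of them. *)
Section Star.
Variables (x y : cell X) (A : set (cell X)) (F : cell X -> cell X).
Hypotheses (vx : vertex x) (vy : vertex y).
Hypothesis A_edge : forall e, A e -> edge e /\ x <= e.
Hypothesis A_pair : forall e e', A e -> A e' -> exists2 c, e <= c & e' <= c.
Hypothesis F_edge : forall e, A e -> edge (F e) /\ y <= F e.
Hypothesis F_mono : forall e c c', A e -> e <= c -> e <= c' -> (F c <= F c') = (c <= c').
Hypothesis F_onto : forall e c', A e -> F e <= c' -> exists2 c, e <= c & F c = c'.
Hypothesis F_inj : forall e e', A e -> A e' -> F e = F e' -> e = e'.

Lemma F_dim e c : A e -> e <= c -> dim (F c) = dim c.
Proof.
move=> Ae ec; have [/eqP de _] := A_edge Ae; have [/eqP dFe _] := F_edge Ae.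
have := iso_dim (fun c c' => @F_mono e c c' Ae) (fun c' => @F_onto e c' Ae) ec.
by rewrite de dFe => /eqP; rewrite eqn_add2r => /eqP.
Qed.

Lemma F_above e c : A e -> e <= c -> y <= F c.
Proof.
by move=> Ae ec; have [_] := F_edge Ae; move/le_trans; apply; rewrite (F_mono Ae).
Qed.

(** The square of [Sq_ex], in terms of cells. *)
Lemma span_square z e e' c : vertex z -> edge e -> edge e' -> z <= e -> z <= e' ->
  e <> e' -> e <= c -> e' <= c -> exists s, [/\ dim s = 2%N, e <= s, e' <= s, s <= c &
    forall c', z <= c' -> e <= c' -> e' <= c' -> s <= c'].
Proof.
move=> vz ee ee' ze ze' ne ec ec'.
have [a za] := dart_ex vz ee ze; have [b zb] := dart_ex vz ee' ze'.
have [|a' [b' [S _ _]]] := Sq_ex za zb _ ec ec'; first by case.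
have [s [ds [s1 s2 _ _] min _]] := Sq_cell X_npc S.
by exists s; split=> //; apply: min => //; apply: le_trans ec.
Qed.

(** The edges [e] and [e'] span a square [s], on which [F] is an isomorphism; so
   [F s] is the square spanned by [F e] and [F e'], and it is contained in [F c].
   As [F] reflects the order on the cells containing [e'], [s] is in [c]. *)
Lemma F_reflect_edge e e' c : A e -> A e' -> e' <= c -> F e <= F c -> e <= c.
Proof.
move=> Ae Ae' e'c Fec; have [<-//|ne] := pselect (e' = e).
have [ee xe] := A_edge Ae; have [ee' xe'] := A_edge Ae'.
have [c0 ec0 ec0'] := A_pair Ae Ae'.
have [s [ds es e's _ min]] := span_square vx ee ee' xe xe' (nesym ne) ec0 ec0'.
have [fe ye] := F_edge Ae; have [fe' ye'] := F_edge Ae'.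
have Fs : F e <= F s by rewrite (F_mono Ae).
have Fs' : F e' <= F s by rewrite (F_mono Ae').
have [|s1 [ds1 _ _ s1s min1]] := span_square vy fe fe' ye ye' _ Fs Fs'.
  by move=> E; apply: ne; rewrite (F_inj Ae Ae' E).
have es1 : s1 = F s by apply: (dim_le_eq s1s); rewrite (F_dim Ae es) ds ds1.
apply: le_trans es _; rewrite -(F_mono Ae') // -es1; apply: min1 => //.
  exact: F_above e'c.
by rewrite (F_mono Ae').
Qed.

Definition star c := exists2 e, A e & e <= c.

Lemma F_star_mono c c' : star c -> star c' -> (F c <= F c') = (c <= c').
Proof.
move=> [e Ae ec] [e' Ae' e'c']; apply/idP/idP => [FF|cc']; last first.
  by rewrite (F_mono Ae) // (le_trans ec).
have ec' : e <= c'.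
  apply: (F_reflect_edge Ae Ae' e'c'); apply: le_trans FF.
  by rewrite (F_mono Ae).
by rewrite -(F_mono Ae).
Qed.

Lemma F_star_inj c c' : star c -> star c' -> F c = F c' -> c = c'.
Proof.
move=> sc sc' e; apply/le_anti.
by rewrite -(F_star_mono sc sc') -(F_star_mono sc' sc) e lexx.
Qed.

(** With [F e], the edge [e'] spans a square in [F c0]. It is the image of a square
   containing [e], whose other edge at [x] must be sent to [e']. *)
Lemma F_span_edge c0 e' : (forall e, edge e -> x <= e -> e <= c0 -> A e) -> star c0 ->
  edge e' -> y <= e' -> e' <= F c0 -> exists2 e, A e & F e = e'.
Proof.
move=> c0A [e Ae ec0] ee' ye' e'c0; have [fe ye] := F_edge Ae.
have [<-|ne] := pselect (F e = e'); first by exists e.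
have Fec0 : F e <= F c0 by rewrite (F_mono Ae).
have [s' [ds' es' e's' sc0 _]] := span_square vy fe ee' ye ye' ne Fec0 e'c0.
have [s es Fs] := F_onto Ae es'; have ds : dim s = 2%N by rewrite -(F_dim Ae es) Fs.
have sc : s <= c0 by rewrite -(F_mono Ae) // Fs.
have [edge_e xe] := A_edge Ae; have [a xa] := dart_ex vx edge_e xe.
have xs := le_trans xe es.
have [a2 [xa2 a2s nea]] : exists b, [/\ dart x b, b.1 <= s & b.1 <> e].
  have [psi [cpsi p0 pN]] := cell2_chart vx xs ds; have [m d w] := cpsi.
  have S := chart2_Sq cpsi; rewrite p0 in S.
  have [E|E] := pselect (psi None (Some false) = e).
    exists (psi (Some false) None, psi (Some false) (Some true)).
    split; [exact: Sq_dart2 S | by rewrite -pN m | rewrite -E].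
    exact/nesym/(Sq_neq1 S).
  exists (psi None (Some false), psi (Some true) (Some false)).
  by split=> //; [exact: Sq_dart S | rewrite -pN m].
have /dartP[[_ ea2 _] xa2' _ _] := xa2.
have Aa2 : A a2.1 by apply: c0A => //; apply: le_trans sc.
exists a2.1 => //; have [fa2 ya2] := F_edge Aa2.
have [b1 yb1] := dart_ex vy fe ye; have [b2 yb2] := dart_ex vy fa2 ya2.
have [b3 yb3] := dart_ex vy ee' ye'.
have Fs2 : F a2.1 <= s' by rewrite -Fs (F_mono Aa2).
have [|[E _]|[E _]] := square_edges vy ds' yb1 yb2 _ es' Fs2 yb3 e's'.
- by case=> /(F_inj Ae Aa2) /esym.
- by case: ne.
- by [].
Qed.

(** [F] is an isomorphism from the star of [A] to that of its image; through the
   labels of the edges at [x] and at [y] by the vertices of [L], it becomes an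
   isomorphism between open stars of simplices of [L], and superstar-transitivity
   applies. *)
Lemma germ_extension : A !=set0 ->
  exists phi, [/\ germ x phi, phi x = y & forall e c, A e -> e <= c -> phi c = F c].
Proof.
move=> [e0 Ae0].
have [E EP] := framing_ex X_L vx; have [E' EP'] := framing_ex X_L vy.
have [E1 E2 E3 E4] := EP; have [E1' E2' E3' E4'] := EP'.
have inE_ := in_code L_finite.
pose cx := code E; pose cy := code E'; pose dx := decode x E; pose dy := decode y E'.
have [U allU] := all_svert L_finite.
(* The labels of the edges in [A]: they form a simplex because [L] is flag. *)
pose sg : {fset svert L} := [fset v in U | `[< A (E v) >]]%fset.
have in_sg v : v \in sg = `[< A (E v) >] by rewrite !inE allU.
have Av e : A e -> exists2 v, A (E v) & E v = e.
  by move=> Ae; have [ee xe] := A_edge Ae; have [v Ev] := E3 e ee xe; exists v; rewrite // Ev.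
have sg_simp : simplex sg.
  apply: (L_flag (s := sg)).
    by have [v Ev _] := Av _ Ae0; apply/fset0Pn; exists v; rewrite in_sg; apply/asboolP.
  move=> u v; rewrite !in_sg => /asboolP Au /asboolP Aw _.
  have [c uc vc] := A_pair Au Aw; have [_ xu] := A_edge Au.
  have [z|] := code_real L_finite EP (le_trans xu uc).
    by have := inE_ _ E c u; rewrite z inE uc.
  move/simplexS; apply; last by apply/fset0Pn; exists u; rewrite !inE eqxx.
  by apply/fsubsetP => w; rewrite !inE => /orP[] /eqP->; rewrite inE_.
(* The cell spanned by [A]. *)
pose c0 := dx sg.
have [xc0 cxc0] : x <= c0 /\ cx c0 = sg by apply: (decodeP L_finite EP); right.
have c0A e : edge e -> x <= e -> e <= c0 -> A e.
  move=> ee xe ec0; have [v Ev] := E3 e ee xe; rewrite -Ev; apply/asboolP.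
  by rewrite -in_sg -cxc0 inE_ Ev.
have Ac0 e : A e -> e <= c0.
  by move=> Ae; have [v _ Ev] := Av e Ae; rewrite -Ev -inE_ -/cx cxc0 in_sg Ev; apply/asboolP.
have sc0 : star c0 by exists e0 => //; apply: Ac0.
(* [F] read on simplices of [L]. *)
pose phi t := cy (F (dx t)).
have star_x c : star c -> x <= c.
  by case=> e /A_edge[_ xe]; apply: le_trans.
have star_y c : star c -> y <= F c by case=> e Ae; apply: F_above.
have openP t : open_star sg t <-> exists2 c, star c & cx c = t.
  split=> [[st /fset0Pn[v]]|[c sc <-]].
    rewrite inE in_sg => /andP[vt /asboolP AEv].
    have [xd cd] : x <= dx t /\ cx (dx t) = t by apply: (decodeP L_finite EP); right.
    by exists (dx t) => //; exists (E v) => //; rewrite -inE_ -/cx cd.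
  have [e Ae ec] := sc; have [v AEv Ev] := Av e Ae.
  have vc : v \in cx c by rewrite inE_ Ev.
  split; last by apply/fset0Pn; exists v; rewrite inE vc in_sg; apply/asboolP.
  by have [z|//] := code_real L_finite EP (star_x _ sc); rewrite /cx z in vc.
have dxK c : star c -> dx (cx c) = c.
  by move=> /star_x xc; apply: (codeK L_finite X_npc vx EP).
have phiE c : star c -> phi (cx c) = cy (F c) by move=> sc; rewrite /phi dxK.
have cy_inj c c' : y <= c -> y <= c' -> cy c = cy c' -> c = c'.
  exact: (code_inj L_finite X_npc vy EP').
have simp_y c : y <= c -> c <> y -> simplex (cy c).
  move=> yc ne; have [z|//] := code_real L_finite EP' yc; case: ne.
  by apply: cy_inj => //; rewrite /cy z (code_vertex L_finite vy EP').
have open_y c : star c -> open_star (phi sg) (cy (F c)).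
  move=> sc; have [e Ae ec] := sc; have [fe ye] := F_edge Ae.
  have [v Ev] := E3' _ fe ye; have vc : v \in cy (F c) by rewrite inE_ Ev (F_mono Ae).
  split.
    by have [z|//] := code_real L_finite EP' (star_y _ sc); rewrite /cy z in vc.
  by apply/fset0Pn; exists v; rewrite inE vc -cxc0 phiE // inE_ Ev (F_mono Ae) ?Ac0.
have phi_iso : star_iso sg (phi sg) phi.
  split.
  - split.
    + by move=> t /= /openP[c sc <-]; rewrite phiE //; apply: open_y.
    + move=> t u; rewrite !inE => /openP[c sc <-] /openP[d sd <-].
      by rewrite !phiE // => /(cy_inj _ _ (star_y _ sc) (star_y _ sd))/(F_star_inj sc sd)->.
    + move=> t' /= [st' /fset0Pn[v]]; rewrite inE -{1}cxc0 phiE // inE_ => /andP[vt' vc0].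
      have /andP[ev yv] := E1' v.
      have [e Ae Fe] := F_span_edge c0A sc0 ev yv vc0.
      have [yd cd] : y <= dy t' /\ cy (dy t') = t' by apply: (decodeP L_finite EP'); right.
      have [|c ec Fc] := F_onto (c' := dy t') Ae.
        by rewrite Fe -inE_ -/cy cd.
      have sc : star c by exists e.
      by exists (cx c); rewrite ?phiE ?Fc //; apply/openP; exists c.
  - move=> t /openP[c sc <-]; rewrite phiE // /cx /cy.
    rewrite (code_card L_finite vx EP (star_x _ sc)) (code_card L_finite vy EP' (star_y _ sc)).
    by case: sc => e Ae ec; apply: F_dim ec.
  - move=> t u /openP[c sc <-] /openP[d sd <-]; rewrite !phiE //.
    rewrite (code_le L_finite X_npc vy EP' (star_y _ sc) (star_y _ sd)).
    by rewrite (code_le L_finite X_npc vx EP (star_x _ sc) (star_x _ sd)) F_star_mono.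
have simp_phi : simplex (phi sg).
  by rewrite -cxc0 phiE //; have [] := open_y _ sc0.
have [Phi [[Psi PhiK PsiK] PhiS] PhiP] := L_superstar sg_simp simp_phi phi_iso erefl.
pose img t := [fset Phi v | v in t]%fset.
have in_img v t : (Phi v \in img t) = (v \in t).
  by apply/imfsetP/idP => /= [[u ut /(can_inj PhiK)->]//|vt]; exists v.
have in_img' v t : (v \in img t) = (Psi v \in t) by rewrite -{1}(PsiK v) in_img.
have img_le t u : (img t `<=` img u)%fset = (t `<=` u)%fset.
  apply/fsubsetP/fsubsetP => H v; last by rewrite !in_img' => /H.
  by have := H (Phi v); rewrite !in_img.
have real_img t : t = fset0 \/ simplex t <-> img t = fset0 \/ simplex (img t).
  have z : t = fset0 <-> img t = fset0.
    split=> [->|e]; apply/fsetP => v; first by rewrite in_img' !inE.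
    by rewrite -in_img e !inE.
  by split=> -[?|?]; [left; apply/z | right; apply/PhiS | left; apply/z | right; apply/PhiS].
exists (fun c => dy (img (cx c))).
have D c : x <= c -> y <= dy (img (cx c)) /\ cy (dy (img (cx c))) = img (cx c).
  by move=> xc; apply: (decodeP L_finite EP'); apply: (real_img _).1; apply: (code_real L_finite EP).
have Dx : dy (img (cx x)) = y.
  have [yd cd] := D x (lexx x); apply: cy_inj => //; rewrite cd /cx /cy.
  rewrite (code_vertex L_finite vx EP) (code_vertex L_finite vy EP').
  by apply/fsetP => v; rewrite in_img' !inE.
split=> //; [split; rewrite ?Dx // | ].
- move=> c c' xc xc'; have [yd cd] := D c xc; have [yd' cd'] := D c' xc'.
  rewrite -(code_le L_finite X_npc vy EP' yd yd') -/cy cd cd' img_le.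
  exact: (code_le L_finite X_npc vx EP).
- move=> c' yc'; pose t := [fset Psi v | v in cy c']%fset.
  have imt : img t = cy c'.
    apply/fsetP => v; rewrite in_img'; apply/imfsetP/idP => /= [[u uc /(can_inj PsiK)->]//|vc].
    by exists v.
  have rt : t = fset0 \/ simplex t by apply: (real_img _).2; rewrite imt; apply: (code_real L_finite EP').
  have [xd cd] := decodeP L_finite EP rt; exists (dx t) => //.
  by rewrite /cx cd imt; apply: (codeK L_finite X_npc vy EP').
- move=> e c Ae ec; have sc : star c by exists e.
  have -> : img (cx c) = cy (F c) by rewrite -phiE // -PhiP //; apply/openP; exists c.
  by apply: (codeK L_finite X_npc vy EP'); apply: star_y.
Qed.

End Star.
End Extension.

(** * Automorphisms of the union of hyperplanes *)

Section UnionAutomorphism.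
Variables (X : cubeComplex) (H : set (set (cell X))) (g : ucell X -> ucell X).
Hypothesis H_hyp : forall h, H h -> hyperplane h.
Hypothesis gP : union_aut H g.
Implicit Types (c d e : cell X) (h k : set (cell X)) (T : set (set (cell X))).
Implicit Types (m n : ucell X).

Definition touches c := exists2 h, H h & crosses h c.

Lemma crosses_le h c c' : crosses h c -> c <= c' -> crosses h c'.
Proof. by case=> e he ec cc'; exists e => //; apply: le_trans cc'. Qed.

Lemma touches_le c c' : touches c -> c <= c' -> touches c'.
Proof. by case=> h Hh hc cc'; exists h => //; apply: crosses_le cc'. Qed.

Lemma mid_cell h c : H h -> crosses h c -> union_cells H (c, [set h]).
Proof. by move=> Hh hc; split=> [k -> //| |k -> //]; exists h. Qed.

Lemma uaut_cell m : union_cells H m -> union_cells H (g m).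
Proof. by have [[gH _ _] _ _] := gP; apply: gH. Qed.

Lemma uaut_inj m n : union_cells H m -> union_cells H n -> g m = g n -> m = n.
Proof. by have [[_ gI _] _ _] := gP; move=> Hm Hn; apply: gI; rewrite inE. Qed.

Lemma uaut_onto m : union_cells H m -> exists2 n, union_cells H n & g n = m.
Proof. by have [[_ _ gS] _ _] := gP; case/gS => n ? <-; exists n. Qed.

Lemma uaut_le m n : union_cells H m -> union_cells H n ->
  ucell_le (g m) (g n) <-> ucell_le m n.
Proof. by have [_ gL _] := gP; apply: gL. Qed.

Lemma uaut_mid m : union_cells H m -> is_midcube (g m) <-> is_midcube m.
Proof. by have [_ _ gM] := gP; apply: gM. Qed.

(** The cube under the image of the midcubes of [c]; it is the same for all the
   members of [H] that cross [c] by [uaut_cubeE]. *)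
Definition uaut_cube c : cell X :=
  (g (c, [set xget set0 [set h | H h /\ crosses h c]])).1.

(** The hyperplane containing the image of [h]; well defined by [parallel_mid]. *)
Definition uaut_hyp h : set (cell X) :=
  xget set0 [set h' | exists2 e, h e & (g (e, [set h])).2 = [set h']].

Lemma mid_image h c : H h -> crosses h c -> exists c' h', g (c, [set h]) = (c', [set h']).
Proof.
move=> Hh hc; have M := mid_cell Hh hc.
have /(uaut_mid M) [h' e] : is_midcube (c, [set h]) by exists h.
by exists (g (c, [set h])).1, h'; rewrite -e -surjective_pairing.
Qed.

Lemma mid_le_hyp h c c' : H h -> crosses h c -> c <= c' ->
  (g (c', [set h])).2 = (g (c, [set h])).2.
Proof.
move=> Hh hc cc'; have hc' := crosses_le hc cc'.
have /(uaut_le (mid_cell Hh hc) (mid_cell Hh hc')) : ucell_le (c, [set h]) (c', [set h]) by split.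
have [d [k ->]] := mid_image Hh hc; have [d' [k' ->]] := mid_image Hh hc'.
by case=> /= _ /(_ k' erefl) ->.
Qed.

(** Comparable midcubes are dual to the same hyperplane, and so are their images;
   two opposite edges of a square give midcubes below the one of the square. *)
Lemma parallel_mid h e e' : H h -> h e -> parallel e e' ->
  (g (e, [set h])).2 = (g (e', [set h])).2.
Proof.
move=> Hh + P; elim: P => {e e'} [e e' op he|//|e e' P IH he|e e1 e' P1 IH1 P2 IH2 he].
- have he' : h e' by apply: (hyp_closed (H_hyp Hh) he); apply: rst_step.
  have [_ _ [s [_ es e's]] _] := op.
  rewrite -(@mid_le_hyp h e s) //; last by exists e.
  by rewrite (@mid_le_hyp h e' s) //; exists e'.
- by rewrite IH //; apply: (hyp_closed (H_hyp Hh) he); apply: parallel_sym.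
- by rewrite IH1 // IH2 //; apply: (hyp_closed (H_hyp Hh) he).
Qed.

Lemma hyp_self h : hyperplane h -> exists2 e, edge e & h e.
Proof. by case=> e ee ->; exists e => //; apply: rst_refl. Qed.

Lemma uaut_hypP h c : H h -> crosses h c -> (g (c, [set h])).2 = [set uaut_hyp h].
Proof.
move=> Hh [e he ec]; have hc : crosses h e by exists e.
rewrite (mid_le_hyp Hh hc ec) /uaut_hyp; case: xgetP => [h' _ [e' he' <-]|/= no].
  by apply: parallel_mid => //; apply: hyp_parallel he he'; apply: H_hyp.
have [d [k E]] := mid_image Hh hc; case: (no k).
by exists e => //; rewrite E.
Qed.

Lemma image_hyp m h : union_cells H m -> (g m).2 h -> H h /\ crosses h (g m).1.
Proof. by case/uaut_cell => gH _ gC gh; split; [apply: gH | apply: gC]. Qed.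

(** The midcubes of [c] dual to the members of [T] are the minimal midcubes above
   [(c, T)], and [g] preserves this relation. *)
Lemma uaut_midcubes c T h : union_cells H (c, T) -> T h ->
  g (c, [set h]) = ((g (c, T)).1, [set uaut_hyp h]).
Proof.
move=> M Th; have [TH _ TC] := M; have Hh := TH _ Th; have hc : crosses h c := TC _ Th.
have Mh := mid_cell Hh hc; have eh := uaut_hypP Hh hc.
have /(uaut_le M Mh)[/= l1 l2] : ucell_le (c, T) (c, [set h]).
  by split=> // k ->.
have gTh : (g (c, T)).2 (uaut_hyp h) by apply: l2; rewrite eh.
have [Hk kc] := image_hyp M gTh; have Mk := mid_cell Hk kc.
have [[d U] Mn en] := uaut_onto Mk.
have /(uaut_mid Mn)[k /= eU] : is_midcube (g (d, U)) by rewrite en; exists (uaut_hyp h).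
rewrite eU in en Mn.
have /(uaut_le M Mn)[/= cd Tk] : ucell_le (g (c, T)) (g (d, [set k])).
  by rewrite en; split=> // z ->.
have /(uaut_le Mn Mh)[/= dc hk] : ucell_le (g (d, [set k])) (g (c, [set h])).
  by rewrite en; split=> //=; rewrite eh.
have ed : d = c by apply/le_anti; rewrite dc cd.
have ek : h = k := hk h erefl.
by rewrite -en ed ek.
Qed.

(** The value for [T] is compared with that for the hyperplane chosen in
   [uaut_cube] through the cell of [c] that lies on both. *)
Lemma uaut_cubeE c T : union_cells H (c, T) -> (g (c, T)).1 = uaut_cube c.
Proof.
move=> M; have [TH [h Th] TC] := M.
rewrite /uaut_cube; case: xgetP => [k _ [Hk kc]|/(_ h)/= []]; last first.
  by split; [apply: TH | apply: TC].
have M2 : union_cells H (c, T `|` [set k]).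
  split=> [z [/TH//|->//]||z [/TC//|->//]].
  by exists h; left.
rewrite (uaut_midcubes M2 (h := k)); last by right.
have := uaut_midcubes M2 (h := h) (or_introl Th); rewrite (uaut_midcubes M Th) => -[-> ].
by [].
Qed.

Lemma uautE c T : union_cells H (c, T) -> g (c, T) = (uaut_cube c, [set uaut_hyp h | h in T]).
Proof.
move=> M; have [TH _ TC] := M; rewrite [LHS]surjective_pairing (uaut_cubeE M).
congr (_, _); apply/seteqP; split=> k; last first.
  case=> h Th <-; have hc : crosses h c := TC _ Th.
  have /(uaut_le M (mid_cell (TH _ Th) hc))[_] : ucell_le (c, T) (c, [set h]).
    by split=> // z ->.
  by apply; rewrite (uaut_hypP (TH _ Th) hc).
move=> gk; have [Hk kc] := image_hyp M gk; have Mk := mid_cell Hk kc.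
have [[d U] Mn en] := uaut_onto Mk.
have /(uaut_mid Mn)[h /= eU] : is_midcube (g (d, U)) by rewrite en; exists k.
rewrite eU in en Mn.
have /(uaut_le M Mn)[/= cd Th] : ucell_le (g (c, T)) (g (d, [set h])).
  by rewrite en; split=> // z ->.
have {}Th : T h by apply: Th.
exists h => //; have [HH _ HC] := Mn.
have dh : crosses h d by apply: HC.
have := uaut_hypP (TH _ Th) dh; rewrite en /= => E.
by have : [set k] k by []; rewrite E.
Qed.

Lemma uaut_midE h c : H h -> crosses h c ->
  g (c, [set h]) = (uaut_cube c, [set uaut_hyp h]).
Proof. by move=> Hh hc; rewrite (uautE (mid_cell Hh hc)) image_set1. Qed.

Lemma uaut_cross h c : H h -> crosses h c ->
  H (uaut_hyp h) /\ crosses (uaut_hyp h) (uaut_cube c).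
Proof.
move=> Hh hc; have := @image_hyp _ (uaut_hyp h) (mid_cell Hh hc).
by rewrite uaut_midE //; apply.
Qed.

(** The cube [c] may be crossed by one hyperplane of [H] and [c'] by another;
   the cell of their common image lying on the images of both comes from a cell
   of a cube [d], which must be equal to [c] and to [c']. *)
Lemma uaut_cube_inj c c' : touches c -> touches c' -> uaut_cube c = uaut_cube c' -> c = c'.
Proof.
move=> [h Hh hc] [h' Hh' hc'] e.
have [Hk kc] := uaut_cross Hh hc; have [Hk' kc'] := uaut_cross Hh' hc'.
pose T := [set uaut_hyp h; uaut_hyp h'].
have M : union_cells H (uaut_cube c, T).
  by split=> [z [->|->]//||z [->|->]//]; [exists (uaut_hyp h); left | rewrite e].
have [[d U] Mn en] := uaut_onto M; have E := uautE Mn; rewrite en in E.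
case: E => ed eU.
have [UH _ UC] := Mn.
have key k b : H k -> crosses k b -> T (uaut_hyp k) -> uaut_cube b = uaut_cube c -> b = d.
  move=> Hk1 kb Tk eb; have : [set uaut_hyp h | h in U] (uaut_hyp k) by rewrite -eU.
  case=> k' Uk' ek; have k'd : crosses k' d by apply: UC.
  have := uaut_midE (UH _ Uk') k'd; rewrite ek -ed -eb -(uaut_midE Hk1 kb).
  by move/(uaut_inj (mid_cell (UH _ Uk') k'd) (mid_cell Hk1 kb)) => -[->].
have -> : c = d by apply: (key h) => //; left.
by symmetry; apply: (key h') => //; right.
Qed.

Lemma uaut_cube_le c c' : touches c -> touches c' ->
  (uaut_cube c <= uaut_cube c') = (c <= c').
Proof.
move=> Kc Kc'; have [h Hh hc] := Kc; apply/idP/idP => [le|cc']; last first.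
  have hc' := crosses_le hc cc'.
  have /(uaut_le (mid_cell Hh hc) (mid_cell Hh hc'))[] : ucell_le (c, [set h]) (c', [set h]) by split.
  by rewrite !uaut_midE.
have [Hk kc] := uaut_cross Hh hc; have M := mid_cell Hk (crosses_le kc le).
have [[d U] Mn en] := uaut_onto M; have E := uautE Mn; rewrite en in E.
case: E => ed eU; have [UH [k Uk] UC] := Mn.
have -> : c' = d by apply: uaut_cube_inj => //; exists k; [apply: UH | apply: UC].
have /(uaut_le (mid_cell Hh hc) Mn)[] // : ucell_le (g (c, [set h])) (g (d, U)).
by rewrite en uaut_midE //; split.
Qed.

Lemma uaut_cube_onto c' : touches c' -> exists2 c, touches c & uaut_cube c = c'.
Proof.
case=> h' Hh' hc'; have [[d U] Mn en] := uaut_onto (mid_cell Hh' hc').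
have := uautE Mn; rewrite en => -[ed _]; have [UH [k Uk] UC] := Mn.
by exists d => //; exists k; [apply: UH | apply: UC].
Qed.

(** Edges are the minimal cubes meeting the union. *)
Lemma uaut_edge h e : H h -> h e -> H (uaut_hyp h) /\ uaut_hyp h (uaut_cube e).
Proof.
move=> Hh he; have hc : crosses h e by exists e.
have [Hk [e' ke' e'e]] := uaut_cross Hh hc; split=> //.
have Ke : touches e by exists h.
have Ke' : touches e' by exists (uaut_hyp h) => //; exists e'.
have [d Kd ed] := uaut_cube_onto Ke'; rewrite -ed uaut_cube_le // in e'e.
suff -> : e = d by rewrite ed.
have [k Hk' [e1 ke1 e1d]] := Kd.
have edge_e1 := hyp_edge (H_hyp Hk') ke1; have edge_e := hyp_edge (H_hyp Hh) he.
have e1e := edge_le_eq edge_e edge_e1 (le_trans e1d e'e).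
by apply/le_anti; rewrite e'e -{1}e1e e1d.
Qed.

Lemma uaut_hyp_inj h h' c : H h -> H h' -> crosses h c -> crosses h' c ->
  uaut_hyp h = uaut_hyp h' -> h = h'.
Proof.
move=> Hh Hh' hc hc' e; have := uaut_midE Hh hc; rewrite e -(uaut_midE Hh' hc').
move/(uaut_inj (mid_cell Hh hc) (mid_cell Hh' hc')) => -[E].
by have : [set h] h by []; rewrite E.
Qed.

End UnionAutomorphism.

(** * Extending a germ system by one vertex *)

Section Germs.
Variable X : cubeComplex.
Implicit Types (x c e : cell X) (a : cell X * cell X) (phi : cell X -> cell X).

Lemma germ_dim x phi c : vertex x -> germ x phi -> x <= c -> dim (phi c) = dim c.
Proof.
move=> /eqP dx [/eqP dpx mono onto] xc.
by have := iso_dim mono onto xc; rewrite dx dpx !addn0.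
Qed.

Lemma germ_inj x phi c c' : germ x phi -> x <= c -> x <= c' -> phi c = phi c' -> c = c'.
Proof.
case=> _ mono _ xc xc' e; apply/le_anti.
by rewrite -(mono c c') // -(mono c' c) // e lexx.
Qed.

Lemma germ_dart x phi a z : germ x phi -> dart x a -> vertex z -> z <= phi a.1 ->
  phi x != z -> dart (phi x) (phi a.1, z).
Proof.
move=> G xa vz za ne; have vx := dart_vertex xa; have [vp mono _] := G.
have /dartP[[_ ea _] xa1 _ _] := xa; apply/dartP; split=> //=.
  by split=> //; rewrite /edge (germ_dim vx G).
by rewrite mono.
Qed.

End Germs.

Section Step.
Variables (L : scomplex) (X : cubeComplex).
Hypothesis L_finite : finite_scomplex L.
Hypothesis L_flag : flag L.
Hypothesis L_superstar : superstar_transitive L.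
Hypothesis X_npc : nonpos_curved X.
Hypothesis X_conn : one_connected X.
Hypothesis X_L : L_cube_complex L X.
Implicit Types (x y z c e s : cell X) (a b k : cell X * cell X) (h : set (cell X)).

(** [G] and [pi] have the properties of the maps that an automorphism of the union
   of the hyperplanes induces on cubes and on hyperplanes. *)
Variables (H : set (set (cell X))) (G : cell X -> cell X) (pi : set (cell X) -> set (cell X)).
Hypothesis H_hyp : forall h, H h -> hyperplane h.
Hypothesis H_trans : forall h h', H h -> H h' -> h <> h' -> transverse h h'.
Hypothesis G_edge : forall h e, H h -> h e -> H (pi h) /\ pi h (G e).
Hypothesis G_le : forall c c', touches H c -> touches H c' -> (G c <= G c') = (c <= c').
Hypothesis G_onto : forall c', touches H c' -> exists2 c, touches H c & G c = c'.
Hypothesis pi_inj : forall h h' c, H h -> H h' -> crosses h c -> crosses h' c ->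
  pi h = pi h' -> h = h'.

Variable x0 : cell X.
Hypothesis vx0 : vertex x0.
Hypothesis x0_H : forall h, H h -> exists2 k, dart x0 k & h k.1.

Lemma touches_edge e : edge e -> touches H e -> exists2 h, H h & h e.
Proof.
move=> ee [h Hh [e' he' le]]; exists h => //.
by rewrite -(edge_le_eq ee (hyp_edge (H_hyp Hh) he') le).
Qed.

Lemma edge_touches h e : H h -> h e -> touches H e.
Proof. by move=> Hh he; exists h => //; exists e. Qed.

Lemma G_inj c c' : touches H c -> touches H c' -> G c = G c' -> c = c'.
Proof.
by move=> Kc Kc' e; apply/le_anti; rewrite -(G_le Kc Kc') -(G_le Kc' Kc) e lexx.
Qed.

Lemma G_edge_edge e : edge e -> touches H e -> edge (G e).
Proof.
move=> ee /(touches_edge ee)[h Hh he]; have [Hk ke] := G_edge Hh he.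
exact: hyp_edge (H_hyp Hk) ke.
Qed.

Lemma G_touches c : touches H c -> touches H (G c).
Proof.
move=> Kc; have [h Hh [e he ec]] := Kc; have [Hk ke] := G_edge Hh he.
by exists (pi h) => //; exists (G e); rewrite ?G_le //; apply: edge_touches he.
Qed.

Lemma G_onto_above e c' : touches H e -> G e <= c' -> exists2 c, e <= c & touches H c /\ G c = c'.
Proof.
move=> Ke ec'; have [c Kc ec] := G_onto (touches_le (G_touches Ke) ec').
by exists c => //; rewrite -G_le // ec.
Qed.

(** [G] preserves edges, and dimension is determined by the order above an edge. *)
Lemma G_dim c : touches H c -> dim (G c) = dim c.
Proof.
move=> Kc; have [h Hh [e he ec]] := Kc; have Ke := edge_touches Hh he.
have ee := hyp_edge (H_hyp Hh) he; have := G_edge_edge ee Ke.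
have up d : e <= d -> touches H d := touches_le Ke.
have mono d d' : e <= d -> e <= d' -> (G d <= G d') = (d <= d').
  by move=> ed ed'; apply: G_le; apply: up.
have onto c' : G e <= c' -> exists2 d, e <= d & G d = c'.
  by case/(G_onto_above Ke) => d ed [_ <-]; exists d.
by move=> /eqP dGe; have := iso_dim mono onto ec; rewrite dGe (eqP ee) => /eqP;
  rewrite eqn_add2r => /eqP.
Qed.

Lemma edge_parallel_eq z e e' : vertex z -> edge e -> edge e' -> z <= e -> z <= e' ->
  parallel e e' -> e = e'.
Proof.
move=> vz ee ee' ze ze' p; have [v zv] := dart_ex vz ee ze.
by have [v' zv'] := dart_ex vz ee' ze'; case: (hyp_uniq X_npc X_conn zv zv' p).
Qed.

(** By definition, edges of a square without common vertex are opposite. *)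
Lemma square_meet s e e' : dim s = 2%N -> edge e -> edge e' -> e <= s -> e' <= s ->
  ~ parallel e e' -> exists z, [/\ vertex z, z <= e & z <= e'].
Proof.
move=> ds ee ee' es e's np; apply: contrapT => no; apply: np; apply: rst_step.
split=> //; first by exists s.
case=> v [ve ve']; have [z vz zv] := vertex_below v.
by apply: no; exists z; split=> //; apply: le_trans zv _.
Qed.

Lemma desc_touching_Sq x k a : dart x k -> touches H k.1 -> desc x0 x a -> a <> k ->
  exists a' k', Sq x a k a' k'.
Proof.
move=> xk Kk xa ne; have /dartP[[_ ek _] _ _ _] := xk.
have [h Hh hk] := touches_edge ek Kk; have [k0 xk0 hk0] := x0_H Hh.
exact: (hyp_desc_Sq X_npc X_conn xk0 xk (hyp_parallel (H_hyp Hh) hk hk0) xa ne).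
Qed.

Lemma touching_Sq x k m : dart x k -> touches H k.1 -> dart x m -> touches H m.1 -> m <> k ->
  exists m' k', Sq x m k m' k'.
Proof.
move=> xk Kk xm Km ne; have /dartP[[_ ek _] _ _ _] := xk.
have [h Hh hk] := touches_edge ek Kk; have /dartP[[_ em _] _ _ _] := xm.
have [h' Hh' hm] := touches_edge em Km.
apply: (transverse_cross X_npc X_conn (H_hyp Hh') (H_hyp Hh) _ xm xk hm hk).
apply: H_trans => // e; apply: ne; apply: (hyp_uniq X_npc X_conn xm xk).
by rewrite e in hm; apply: (hyp_parallel (H_hyp Hh)).
Qed.

Variable F : cell X -> cell X -> cell X.

(** [F a.2] stands for the germs chosen at the lower neighbours of [x]. That [x] is
   not sent to the image of a neighbour makes the glued map injective on edges. *)
Definition coherent x phi :=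
  [/\ germ x phi, forall c, x <= c -> touches H c -> phi c = G c &
      forall a, desc x0 x a ->
        phi x != F a.2 a.2 /\ forall c, a.1 <= c -> phi c = F a.2 c].

Section AtVertex.
Variable x : cell X.
Hypothesis vx : vertex x.
Hypothesis F_coh : forall z, vertex z -> (depth x0 z < depth x0 x)%N -> coherent z (F z).

Lemma coh_desc a : desc x0 x a -> coherent a.2 (F a.2).
Proof.
by case/andP=> /dartP[[_ _ va] _ _ _] lt; apply: F_coh.
Qed.

(** Both germs agree on these cells with the one at the fourth vertex of the square
   spanned by [a] and [b]. *)
Lemma desc_agree a b c : desc x0 x a -> desc x0 x b -> a.1 <= c -> b.1 <= c ->
  F a.2 c = F b.2 c.
Proof.
move=> xa xb ac bc; have [->//|ne] := pselect (a = b).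
have [a' [b' [S xa' xb']]] := desc_Sq X_npc X_conn vx0 xa xb ne.
have [s [_ [_ _ a's b's] min _]] := Sq_cell X_npc S.
have sc : s <= c by apply: min => //; apply: le_trans ac; have /dartP[] := Sq_dart S.
have [_ _ ca] := coh_desc xa; have [_ _ cb] := coh_desc xb.
have [_ ->] := ca _ xa'; last exact: le_trans sc.
have [_ ->] := cb _ xb'; last exact: le_trans sc.
by rewrite (Sq_end S).
Qed.

(** Let [w] be the fourth vertex of the square [s] spanned by [a] and [b]. The germs
   at [w] and at the ends of [a] and [b] agree on [s], and send the sides of [s]
   issued from [w] to two sides of its image. The images of [a] and [b] are the
   other two sides, so they are distinct and meet at the fourth vertex. *)
Lemma desc_image a b y : desc x0 x a -> desc x0 x b -> a <> b ->
  dart (F a.2 a.2) (F a.2 a.1, y) ->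
  dart (F b.2 b.2) (F b.2 b.1, y) /\ F a.2 a.1 <> F b.2 b.1.
Proof.
move=> xa xb ne zy.
have [a' [b' [S xb' xa']]] := desc_Sq X_npc X_conn vx0 xa xb ne.
set w := b'.2; have ew : a'.2 = w := Sq_end S.
have [s [ds [as_ bs a's b's] _ _]] := Sq_cell X_npc S.
have [Ga _ ca] := coh_desc xa; have [Gb _ cb] := coh_desc xb.
have da := desc_dart xa; have db := desc_dart xb.
have db' := Sq_dart3 S; have da' := Sq_dart4 S.
have [nw1 c1] := ca _ xb'; have [nw2 c2] := cb _ xa'; rewrite ew in nw2 c2.
have vw : vertex w by have /dartP[[]] := db'.
have Gw : germ w (F w).
  have lt1 : (depth x0 w < depth x0 x)%N.
    case/andP: xb' => _ lt; case/andP: xa => _; exact: ltn_trans.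
  by have [] := F_coh vw lt1.
have wb' : w <= b'.1 by have /dartP[] := db'.
have wa' : w <= a'.1 by have /dartP[_ _ ? _] := da'; rewrite -ew.
have [va' monoa _] := Ga; have [vb' monob _] := Gb; have [vFw monow _] := Gw.
have ws : w <= s by apply: le_trans b's.
have dS : dim (F w s) = 2%N by rewrite (germ_dim vw Gw).
have Sa : F a.2 s = F w s by apply: c1.
have Sb : F b.2 s = F w s by apply: c2.
have q1 : dart (F w w) (F w b'.1, F a.2 a.2).
  have := germ_dart Gw (dart_rev db') va'; apply=> /=; last by rewrite eq_sym.
  by rewrite -c1 // monoa //; have /dartP[] := db'.
have q2 : dart (F w w) (F w a'.1, F b.2 b.2).
  have wda' : dart w (drev b.2 a') by rewrite -ew; apply: dart_rev.
  have := germ_dart Gw wda' vb'; apply=> /=; last by rewrite eq_sym.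
  by rewrite -c2 // monob //; have /dartP[] := da'.
have nq : (F w b'.1, F a.2 a.2) <> (F w a'.1, F b.2 b.2).
  case=> /(germ_inj Gw wb' wa') e _.
  have := Sq_neq1 (Sq_rot (Sq_sym (Sq_rot S))); exact.
have l1 : F w b'.1 <= F w s by rewrite monow.
have l2 : F w a'.1 <= F w s by rewrite monow.
have [q1' [q2' [Q _ _]]] := Sq_ex q1 q2 nq l1 l2.
have la : a.2 <= a.1 by have /dartP[] := da.
have lb : b.2 <= b.1 by have /dartP[] := db.
have la2 : a.2 <= b'.1 by have /dartP[] := db'.
have lb2 : b.2 <= a'.1 by have /dartP[] := da'.
have ls : a.2 <= s by apply: le_trans as_.
have ls2 : b.2 <= s by apply: le_trans bs.
have ey : (F a.2 a.1, y) = q2'.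
  apply: (Sq_side X_npc Q dS l1 l2 zy); first by rewrite -Sa /= monoa.
  case=> e _; rewrite -c1 // in e; have := germ_inj Ga la la2 e.
  exact: Sq_neq1 (Sq_rot S).
have eb : edge (F b.2 b.1).
  have /dartP[[_ /eqP eb vb2] _ _ _] := db; rewrite /edge (germ_dim vb2 Gb) ?eb //.
have lFb : F b.2 b.2 <= F b.2 b.1 by rewrite monob.
have [y2 zy2] := dart_ex vb' eb lFb.
have ey2 : (F b.2 b.1, y2) = q1'.
  apply: (Sq_side X_npc (Sq_sym Q) dS l2 l1 zy2); first by rewrite -Sb /= monob.
  case=> e _; rewrite -c2 // in e; have := germ_inj Gb lb lb2 e.
  exact: Sq_neq1 (Sq_rot (Sq_sym S)).
have e2 : y2 = y by rewrite -[y2]/((F b.2 b.1, y2).2) ey2 (Sq_end Q) -ey.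
split; first by rewrite -e2.
move=> e; have := Sq_neq1 (Sq_rot (Sq_sym (Sq_rot Q))); rewrite /= -ey -ey2 /=; exact.
Qed.

(** In the square [s] spanned by [a] and [k], let [k'] be the side opposite to [k].
   In the square [G s], the edges [G k.1] and [G k'.1] are dual to the same
   hyperplane, hence disjoint, and the image of [a] joins them. *)
Lemma hyp_image a k y : desc x0 x a -> dart x k -> touches H k.1 -> a <> k ->
  dart (F a.2 a.2) (F a.2 a.1, y) -> y <= G k.1 /\ ~ (F a.2 a.2 <= G k.1).
Proof.
move=> xa xk Kk ne zy; have [Ga Ka _] := coh_desc xa.
have [a' [k' S]] := desc_touching_Sq xk Kk xa ne.
have [s [ds [as_ ks a's k's] _ _]] := Sq_cell X_npc S.
have /dartP[[_ ek _] xk1 _ _] := xk; have /dartP[[_ ek' _] ak' _ _] := Sq_dart3 S.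
have /dartP[[_ ea va] xa1 aa _] := desc_dart xa.
have [h Hh hk] := touches_edge ek Kk; have [Hp pk] := G_edge Hh hk.
have hk' : h k'.1 by apply: (hyp_closed (H_hyp Hh) hk); apply: Sq_parallel S.
have Kk' := edge_touches Hh hk'; have Ks := touches_le Kk ks.
have [_ pk'] := G_edge Hh hk'; have [vz mono _] := Ga.
have Fk' : F a.2 k'.1 = G k'.1 by apply: Ka.
have Fs : F a.2 s = G s by apply: Ka => //; apply: le_trans k's.
have zk' : F a.2 a.2 <= G k'.1 by rewrite -Fk' mono.
have eGk := G_edge_edge ek Kk; have eGk' := G_edge_edge ek' Kk'.
have nz : ~ (F a.2 a.2 <= G k.1).
  move=> zk; have := edge_parallel_eq vz eGk eGk' zk zk' (hyp_parallel (H_hyp Hp) pk pk').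
  move/(G_inj Kk Kk') => e; have [_ _ _] := Sq_opp S; apply.
  by exists x; rewrite -e.
split=> //.
have /dartP[[_ eb vy] zb yb _] := zy; rewrite /= in eb zb yb.
have [||||||u [vu ub uk]] := @square_meet (G s) (F a.2 a.1) (G k.1) => //.
- by rewrite G_dim.
- by rewrite -Fs mono // (le_trans aa).
- by rewrite G_le.
- move=> pab; have := edge_parallel_eq vz eb eGk' zb zk'.
  move/(_ (parallel_trans pab (hyp_parallel (H_hyp Hp) pk pk'))).
  rewrite -Fk' => /(germ_inj Ga aa ak'); exact: Sq_neq1 (Sq_rot S).
by case: (dart_end zy vu ub) => e; rewrite e in uk; [case: nz|].
Qed.

(** [y] is the image of [x]. The constraints on the germ at [x] define the map [Fp] on
   the cells containing a descending edge or an edge dual to a member of [H]. *)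
Lemma coherent_step y : vertex y ->
    (forall a, desc x0 x a -> dart (F a.2 a.2) (F a.2 a.1, y)) ->
    (forall k, dart x k -> touches H k.1 -> y <= G k.1) ->
    (exists a, dart x a /\ (desc x0 x a \/ touches H a.1)) ->
  exists phi, coherent x phi.
Proof.
move=> vy yD yK [a0 [xa0 Aa0]].
pose A e := [/\ edge e, x <= e & touches H e \/ exists2 a, desc x0 x a & a.1 = e].
pose low c := xget a0 [set a | desc x0 x a /\ a.1 <= c].
pose Fp c := if `[< touches H c >] then G c else F (low c).2 c.
have FpK c : touches H c -> Fp c = G c by move=> Kc; rewrite /Fp asboolT.
have FpD a c : desc x0 x a -> a.1 <= c -> Fp c = F a.2 c.
  move=> xa ac; rewrite /Fp; case: asboolP => [Kc|_].
    have [_ Ka _] := coh_desc xa; rewrite Ka // (le_trans _ ac) //.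
    by have /dartP[] := desc_dart xa.
  rewrite /low; case: xgetP => [b _ [xb bc]|/(_ a)[]//].
  exact: desc_agree.
have Adart e : A e -> exists a, [/\ dart x a, a.1 = e & desc x0 x a \/ touches H a.1].
  case=> ee xe [Ke|[a xa <-]]; last by exists a; split=> //; [apply: desc_dart xa | left].
  by have [v xv] := dart_ex vx ee xe; exists (e, v); split=> //; right.
have A_edge e : A e -> edge e /\ x <= e by case.
have pair_Sq a b : dart x a -> dart x b -> desc x0 x a \/ touches H a.1 ->
    desc x0 x b \/ touches H b.1 -> a <> b -> exists a' b', Sq x a b a' b'.
  move=> xa xb [Da|Ka] [Db|Kb] ne.
  - by have [a' [b' [S _ _]]] := desc_Sq X_npc X_conn vx0 Da Db ne; exists a', b'.
  - exact: desc_touching_Sq xb Kb Da ne.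
  - have [b' [a' S]] := desc_touching_Sq xa Ka Db (nesym ne).
    by exists a', b'; apply: Sq_sym.
  - exact: touching_Sq xb Kb xa Ka ne.
have A_pair e e' : A e -> A e' -> exists2 c, e <= c & e' <= c.
  move=> /Adart[a [xa <- Aa]] /Adart[b [xb <- Ab]].
  have [->|ne] := pselect (a = b); first by exists b.1.
  have [a' [b' S]] := pair_Sq _ _ xa xb Aa Ab ne.
  by have [s [_ [? ? _ _] _ _]] := Sq_cell X_npc S; exists s.
have F_edge e : A e -> edge (Fp e) /\ y <= Fp e.
  move=> Ae; have [a [xa ea [Da|Ka]]] := Adart e Ae; rewrite -ea.
    rewrite (FpD a) //; have /dartP[[_ ? _] _ ? _] := yD a Da; by split.
  rewrite FpK //; split; last exact: yK.
  by have /dartP[[_ ? _] _ _ _] := xa; apply: G_edge_edge.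
have F_mono e c c' : A e -> e <= c -> e <= c' -> (Fp c <= Fp c') = (c <= c').
  move=> Ae; have [a [xa <- [Da|Ka]]] := Adart e Ae => ac ac'.
    rewrite !(FpD a) //; have [[_ mono _] _ _] := coh_desc Da.
    have /dartP[_ _ la _] := xa; by rewrite mono ?(le_trans la).
  have Kc := touches_le Ka ac; have Kc' := touches_le Ka ac'.
  by rewrite !FpK // G_le.
have F_onto e c' : A e -> Fp e <= c' -> exists2 c, e <= c & Fp c = c'.
  move=> Ae; have [a [xa <- [Da|Ka]]] := Adart e Ae.
    rewrite (FpD a) // => ac'; have [[_ mono onto] _ _] := coh_desc Da.
    have /dartP[_ _ la _] := xa; have [|c zc ec] := onto c'.
      by apply: le_trans ac'; rewrite mono.
    have ac : a.1 <= c by rewrite -mono // ec.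
    by exists c; rewrite ?(FpD a).
  by rewrite FpK // => /(G_onto_above Ka)[c ac [Kc <-]]; exists c; rewrite ?FpK.
have F_inj e e' : A e -> A e' -> Fp e = Fp e' -> e = e'.
  move=> /Adart[a [xa <- Aa]] /Adart[b [xb <- Ab]] eF.
  have [->//|ne] := pselect (a = b); exfalso.
  case: Aa Ab => [Da|Ka] [Db|Kb].
  - rewrite (FpD a a.1) // (FpD b b.1) // in eF.
    by have [_ []] := desc_image Da Db ne (yD a Da).
  - rewrite (FpD a a.1) // FpK // in eF; have [_] := hyp_image Da xb Kb ne (yD a Da).
    by rewrite -eF; have /dartP[_ ? _ _] := yD a Da.
  - rewrite (FpD b b.1) // FpK // in eF; have [_] := hyp_image Db xa Ka (nesym ne) (yD b Db).
    by rewrite eF; have /dartP[_ ? _ _] := yD b Db.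
  - rewrite !FpK // in eF; apply: ne; apply: (dart_uniq xa xb).
    exact: G_inj eF.
have A0 : A !=set0.
  exists a0.1; have /dartP[[_ ? _] ? _ _] := xa0; split=> //.
  by case: Aa0 => [D|?]; [right; exists a0 | left].
have [phi [Gphi phix phiF]] := germ_extension L_finite L_flag L_superstar X_npc X_L
  vx vy A_edge A_pair F_edge F_mono F_onto F_inj A0.
exists phi; split=> //.
  move=> c xc Kc; have [h Hh [e he ec]] := Kc.
  have [k [xk kc ek]] := parallel_in_cube (hyp_edge (H_hyp Hh) he) ec vx xc.
  have hk := hyp_closed (H_hyp Hh) he ek.
  rewrite (phiF k.1) // ?FpK //; have /dartP[[_ ? _] ? _ _] := xk; split=> //.
  by left; apply: edge_touches hk.
move=> a Da; split.
  by rewrite phix; have /dartP[_ _ _] := yD a Da; rewrite eq_sym.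
move=> c ac; rewrite (phiF a.1) // ?(FpD a) //.
have /dartP[[_ ? _] ? _ _] := desc_dart Da; split=> //.
by right; exists a.
Qed.

(** [y] is the other end of the image of any descending edge. *)
Lemma coherent_above : x <> x0 -> exists phi, coherent x phi.
Proof.
move=> ne; have [a xa] := desc_ex X_npc X_conn vx vx0 ne.
have [Ga _ _] := coh_desc xa; have [vz mono _] := Ga.
have /dartP[[_ /eqP ea va] _ aa _] := desc_dart xa.
have ez : edge (F a.2 a.1) by rewrite /edge (germ_dim va Ga) ?ea.
have lz : F a.2 a.2 <= F a.2 a.1 by rewrite mono.
have [y zy] := dart_ex vz ez lz.
have yD b : desc x0 x b -> dart (F b.2 b.2) (F b.2 b.1, y).
  move=> xb; have [<-//|ne'] := pselect (a = b).
  by have [] := desc_image xa xb ne' zy.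
apply: (@coherent_step y _ yD).
- by have /dartP[[]] := zy.
- move=> k xk Kk; have [ak|ak] := pselect (a = k); last first.
    by have [] := hyp_image xa xk Kk ak zy.
  have [_ Ka _] := coh_desc xa; rewrite -ak in Kk *.
  by rewrite -Ka //; have /dartP[] := zy.
- by exists a; split; [apply: desc_dart xa | left].
Qed.

End AtVertex.

Lemma depth_edge1 y a : dart y a -> depth y a.2 = 1%N.
Proof.
move=> ya; have vy := dart_vertex ya; rewrite (depth_asc X_npc X_conn vy ya).
  by rewrite (depthxx X_npc X_conn vy).
by rewrite /desc ya (depthxx X_npc X_conn vy).
Qed.

(** Seen from [y], the two edges descend from [v], so they would span a square with
   a vertex at distance less than 0. *)
Lemma no_bigon y v e e' : dart y (e, v) -> dart y (e', v) -> e = e'.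
Proof.
move=> d d'; have vy := dart_vertex d; apply: contrapT => ne.
have D e1 : dart y (e1, v) -> desc y v (e1, y).
  move=> d1; rewrite /desc (dart_rev d1) /= (depthxx X_npc X_conn vy).
  by rewrite -[v]/((e1, v).2) (depth_edge1 d1).
have [|a' [b' [_]]] := desc_Sq X_npc X_conn vy (D _ d) (D _ d'); first by case.
by rewrite /desc /= (depthxx X_npc X_conn vy) andbF.
Qed.

(** Two vertices at distance 1 are not adjacent, as adjacent vertices are at
   distances that differ by 1. *)
Lemma no_triangle y a b e : dart y a -> dart y b -> a.2 <> b.2 -> edge e ->
  a.2 <= e -> b.2 <= e -> False.
Proof.
move=> ya yb ne ee ae be; have /dartP[[vy _ va] _ _ _] := ya.
have /dartP[[_ _ vb] _ _ _] := yb; have [v av] := dart_ex va ee ae.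
have [e'|e'] := dart_end av vb be; first by apply: ne.
rewrite /= in e'; rewrite -e' in av.
have := dart_depth X_npc X_conn vy av; rewrite /= (depth_edge1 ya) (depth_edge1 yb).
by case=> [[p [_ _]]|].
Qed.

(** The images meet pairwise, because two dual edges at [x0] span a square whose
   image contains two edges dual to different hyperplanes. If an image avoided the
   common vertex of two others, the three would form a triangle. *)
Lemma base_vertex : H !=set0 ->
  exists2 y, vertex y & forall k, dart x0 k -> touches H k.1 -> y <= G k.1.
Proof.
case=> h1 Hh1; have [k1 xk1 hk1] := x0_H Hh1.
have eG k : dart x0 k -> touches H k.1 -> edge (G k.1).
  by move=> /dartP[[_ ek _] _ _ _]; apply: G_edge_edge.
have meet2 k m : dart x0 k -> touches H k.1 -> dart x0 m -> touches H m.1 ->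
    exists z, [/\ vertex z, z <= G k.1 & z <= G m.1].
  move=> xk Kk xm Km; have [->|ne] := pselect (m = k).
    by have [z vz zk] := vertex_below (G k.1); exists z.
  have [m' [k' S]] := touching_Sq xk Kk xm Km ne.
  have [s [ds [ms ks _ _] _ _]] := Sq_cell X_npc S.
  have Ks := touches_le Kk ks.
  apply: (@square_meet (G s)); rewrite ?G_dim ?G_le ?eG //.
  have /dartP[[_ ek _] _ _ _] := xk; have /dartP[[_ em _] _ _ _] := xm.
  have [h Hh hk] := touches_edge ek Kk; have [h' Hh' hm] := touches_edge em Km.
  have [Hp pk] := G_edge Hh hk; have [Hp' pm] := G_edge Hh' hm => par.
  have epi : pi h = pi h'.
    by apply: (hyp_eq (H_hyp Hp) (H_hyp Hp') (hyp_closed (H_hyp Hp) pk par)).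
  have eh : h = h'.
    by apply: (pi_inj (c := s)) epi => //; [exists k.1 | exists m.1].
  apply: ne; apply: (hyp_uniq X_npc X_conn xm xk).
  by rewrite -eh in hm; apply: (hyp_parallel (H_hyp Hh)).
have K1 := edge_touches Hh1 hk1.
have [[k2 [xk2 K2 ne12]]|single] := pselect
    (exists k, [/\ dart x0 k, touches H k.1 & k <> k1]); last first.
  have [y vy yk1] := vertex_below (G k1.1); exists y => // k xk Kk.
  by have [->//|ne] := pselect (k = k1); case: single; exists k.
have [y [vy y1 y2]] := meet2 _ _ xk1 K1 xk2 K2; exists y => // k xk Kk.
apply: contrapT => nyk.
have [u [vu u1 uk]] := meet2 _ _ xk1 K1 xk Kk.
have [w [vw w2 wk]] := meet2 _ _ xk2 K2 xk Kk.
have far z e : z <= G k.1 -> vertex z -> edge e -> y <= e -> z <= e -> dart y (e, z).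
  move=> zk vz ee ye ze; apply/dartP; split=> //=; apply/eqP => e0.
  by apply: nyk; rewrite e0.
have d1 := far u _ uk vu (eG _ xk1 K1) y1 u1.
have d2 := far w _ wk vw (eG _ xk2 K2) y2 w2.
have uw : u <> w.
  move=> e; rewrite -e in d2; have := G_inj K1 K2 (no_bigon d1 d2).
  by move/(dart_uniq xk1 xk2) => e12; apply: ne12.
exact: no_triangle d1 d2 uw (eG _ xk Kk) uk wk.
Qed.

Lemma coherent_base : H !=set0 -> exists phi, coherent x0 phi.
Proof.
move=> H0; have [y vy yK] := base_vertex H0.
have nodesc a : ~ desc x0 x0 a.
  by rewrite /desc (depthxx X_npc X_conn vx0) andbF.
apply: (coherent_step vx0 _ vy _ yK).
- by move=> z _; rewrite (depthxx X_npc X_conn vx0).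
- by move=> a /nodesc.
- have [h Hh] := H0; have [k xk hk] := x0_H Hh; exists k; split=> //.
  by right; apply: edge_touches hk.
Qed.

End Step.

(** * Gluing the germs *)

Section Family.
Variables (L : scomplex) (X : cubeComplex).
Hypothesis L_finite : finite_scomplex L.
Hypothesis L_flag : flag L.
Hypothesis L_superstar : superstar_transitive L.
Hypothesis X_npc : nonpos_curved X.
Hypothesis X_conn : one_connected X.
Hypothesis X_L : L_cube_complex L X.
Implicit Types (x y z c e s : cell X) (a b k : cell X * cell X) (h : set (cell X)).

Variables (H : set (set (cell X))) (G : cell X -> cell X) (pi : set (cell X) -> set (cell X)).
Hypothesis H_hyp : forall h, H h -> hyperplane h.
Hypothesis H_trans : forall h h', H h -> H h' -> h <> h' -> transverse h h'.
Hypothesis G_edge : forall h e, H h -> h e -> H (pi h) /\ pi h (G e).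
Hypothesis G_le : forall c c', touches H c -> touches H c' -> (G c <= G c') = (c <= c').
Hypothesis G_onto : forall c', touches H c' -> exists2 c, touches H c & G c = c'.
Hypothesis pi_inj : forall h h' c, H h -> H h' -> crosses h c -> crosses h' c ->
  pi h = pi h' -> h = h'.

Variable x0 : cell X.
Hypothesis vx0 : vertex x0.
Hypothesis x0_H : forall h, H h -> exists2 k, dart x0 k & h k.1.
Hypothesis H0 : H !=set0.

Local Notation coh := (coherent H G x0).

Lemma coherent_ext F F' x phi : (forall a, desc x0 x a -> F a.2 = F' a.2) ->
  coh F x phi -> coh F' x phi.
Proof.
move=> e [Gphi Kphi D]; split=> // a xa; have [ne De] := D a xa.
by rewrite -e.
Qed.

(** The germs are chosen by recursion on the distance to [x0]: [fam n] provides
   those at distance at most [n]. *)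
Lemma coherent_family : exists F, forall x, vertex x -> coh F x (F x).
Proof.
have [phi0 P0] := coherent_base L_finite L_flag L_superstar X_npc X_conn X_L
  H_hyp H_trans G_edge G_le G_onto pi_inj vx0 x0_H (fun=> id) H0.
have /choice[nxt nxtP] (Fx : (cell X -> cell X -> cell X) * cell X) :
    exists phi, (exists psi, coh Fx.1 Fx.2 psi) -> coh Fx.1 Fx.2 phi.
  by have [[psi P]|no] := pselect (exists psi, coh Fx.1 Fx.2 psi); [exists psi | exists id].
pose fam := fix fam n : cell X -> cell X -> cell X := if n is m.+1 then
  (fun x => if (depth x0 x <= m)%N then fam m x else nxt (fam m, x)) else (fun=> phi0).
have famS n x : (depth x0 x <= n)%N -> fam n.+1 x = fam n x by move=> /= ->.
have stable n m x : (depth x0 x <= n)%N -> (n <= m)%N -> fam m x = fam n x.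
  move=> xn /subnK <-; elim: (m - n)%N => // i IH.
  by rewrite addSn famS // (leq_trans xn) // leq_addl.
have good n x : vertex x -> (depth x0 x <= n)%N -> coh (fam n) x (fam n x).
  elim: n x => [|n IH] x vx.
    rewrite leqn0 => /eqP/(depth0 X_npc X_conn vx vx0) ->.
    apply: coherent_ext P0 => a; by rewrite /desc (depthxx X_npc X_conn vx0) andbF.
  rewrite leq_eqVlt => /orP[/eqP xn|xn].
    apply: (@coherent_ext (fam n)) => [a /andP[_]|].
      by rewrite xn ltnS => an; rewrite famS.
    rewrite /= xn ltnn; apply: (nxtP (fam n, x)).
    have F_coh z : vertex z -> (depth x0 z < depth x0 x)%N -> coh (fam n) z (fam n z).
      by rewrite xn ltnS; apply: IH.
    have xx0 : x <> x0.
      by move=> e; rewrite e (depthxx X_npc X_conn vx0) in xn.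
    exact: (coherent_above L_finite L_flag L_superstar X_npc X_conn X_L
      H_hyp H_trans G_edge G_le G_onto vx0 x0_H vx F_coh xx0).
  rewrite famS //; apply: (@coherent_ext (fam n)) (IH _ vx xn) => a /andP[_ lt].
  by rewrite famS // ltnW // (leq_trans lt).
exists (fun x => fam (depth x0 x) x) => x vx.
apply: (@coherent_ext (fam (depth x0 x))) (good _ _ vx (leqnn _)) => a /andP[_ lt].
exact: stable (leqnn _) (ltnW lt).
Qed.

(** Germs agree along edges, and any two vertices of a cell are joined by edges of
   that cell. *)
Lemma germ_system : exists f, [/\ forall x, vertex x -> germ x f,
  forall x a, dart x a -> f x != f a.2 & forall c, touches H c -> f c = G c].
Proof.
have [F FP] := coherent_family.
have agree u a : dart u a -> F u u != F a.2 a.2 /\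
    forall c, a.1 <= c -> F u c = F a.2 c.
  move=> ua; have [d|d] := boolP (desc x0 u a).
    by have [_ _ D] := FP u (dart_vertex ua); apply: D.
  have d' := desc_rev X_npc X_conn ua d vx0; have /dartP[[_ _ va] _ _ _] := ua.
  have [_ _ D] := FP _ va; have [ne e] := D _ d'.
  by split=> [|c ac]; [rewrite eq_sym | rewrite e].
have /choice[vtx vtxP] (c : cell X) : exists x, vertex x /\ x <= c.
  by have [x ? ?] := vertex_below c; exists x.
exists (fun c => F (vtx c) c).
have fE x c : vertex x -> x <= c -> F (vtx c) c = F x c.
  move=> vx xc; have [vv vc] := vtxP c; symmetry.
  apply: (@cube_connected X c (fun u => F u c = F (vtx c) c) _ (vtx c)) => //.
  by move=> u a ua ac <-; have [_ ->] := agree u a ua.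
split=> [x vx|x a xa|c Kc].
- have [[vF mono onto] _ _] := FP x vx; split; rewrite ?(fE x) //.
    by move=> c c' xc xc'; rewrite !(fE x) // mono.
  by move=> c' /onto[c xc ec]; exists c; rewrite ?(fE x).
- have /dartP[[vx _ va] _ _ _] := xa; rewrite (fE x x) // (fE a.2 a.2) //.
  by have [] := agree x a xa.
- by have [vv vc] := vtxP c; have [_ FK _] := FP _ vv; apply: FK.
Qed.

End Family.

Section Glue.
Variable X : cubeComplex.
Hypothesis X_npc : nonpos_curved X.
Hypothesis X_conn : one_connected X.
Implicit Types (x y z u v w c e s : cell X) (a b k : cell X * cell X).
Implicit Types (p q : seq (cell X * cell X)).

(** Such a map [f] is a covering, because darts and squares lift uniquely to a given
   vertex; it is an automorphism because [X] is simply connected. *)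
Variable f : cell X -> cell X.
Hypothesis f_germ : forall x, vertex x -> germ x f.
Hypothesis f_dart_neq : forall x a, dart x a -> f x != f a.2.

Definition fdart a := (f a.1, f a.2).

Lemma f_vertex x : vertex x -> vertex (f x).
Proof. by case/f_germ. Qed.

Lemma f_le x c c' : vertex x -> x <= c -> x <= c' -> (f c <= f c') = (c <= c').
Proof. by case/f_germ => _ mono _; apply: mono. Qed.

Lemma f_mono c c' : c <= c' -> f c <= f c'.
Proof.
move=> cc'; have [x vx xc] := vertex_below c.
by rewrite (f_le vx) // (le_trans xc).
Qed.

Lemma f_dim c : dim (f c) = dim c.
Proof.
have [x vx xc] := vertex_below c.
exact: germ_dim vx (f_germ vx) xc.
Qed.

Lemma f_dart x a : dart x a -> dart (f x) (fdart a).
Proof.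
move=> xa; have /dartP[[vx ea va] la aa _] := xa.
apply/dartP; split=> /=; rewrite ?f_mono ?f_dart_neq //.
by rewrite /vertex /edge !f_dim; split.
Qed.

Lemma f_dart_inj x a a' : dart x a -> dart x a' -> f a.1 = f a'.1 -> a = a'.
Proof.
move=> xa xa' e; apply: (dart_uniq xa xa').
by apply: (germ_inj (f_germ (dart_vertex xa)) _ _ e); apply: dart_le.
Qed.

Lemma f_lift x b : vertex x -> dart (f x) b -> exists2 a, dart x a & fdart a = b.
Proof.
move=> vx xb; have /dartP[[_ eb _] lb _ _] := xb.
have [_ _ onto] := f_germ vx; have [e xe fe] := onto _ lb.
have ee : edge e by rewrite /edge -f_dim fe.
have [v xv] := dart_ex vx ee xe; exists (e, v) => //.
exact: dart_uniq (f_dart xv) xb fe.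
Qed.

Lemma f_Sq x a b a' b' : Sq x a b a' b' ->
  Sq (f x) (fdart a) (fdart b) (fdart a') (fdart b').
Proof.
move=> S; have [s [ds [as_ bs a's b's] _ _]] := Sq_cell X_npc S.
have da := Sq_dart S; have db := Sq_dart2 S.
have db' := Sq_dart3 S; have da' := Sq_dart4 S.
have ne : fdart a <> fdart b.
  by case=> /(f_dart_inj da db) /(Sq_neq S).
have [a1 [b1 [Q _ _]]] := Sq_ex (f_dart da) (f_dart db) ne (f_mono as_) (f_mono bs).
have dS : dim (f s) = 2%N by rewrite f_dim.
have eb' : fdart b' = b1.
  apply: (Sq_side X_npc Q dS (f_mono as_) (f_mono bs) (f_dart db') (f_mono b's)).
  case=> /(f_dart_inj db' (dart_rev da)) e _.
  by have := Sq_neq (Sq_rot S); rewrite e.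
have ea' : fdart a' = a1.
  apply: (Sq_side X_npc (Sq_sym Q) dS (f_mono bs) (f_mono as_) (f_dart da') (f_mono a's)).
  case=> /(f_dart_inj da' (dart_rev db)) e _.
  by have := Sq_neq (Sq_rot (Sq_sym S)); rewrite e.
by rewrite ea' eb'.
Qed.

(** The end of the lift at [x] of the dart [b], for the monodromy principle. *)
Definition lift_act x b := xget x [set z | exists2 a, dart x a & fdart a = b /\ a.2 = z].

Lemma lift_actE x a : dart x a -> lift_act x (fdart a) = a.2.
Proof.
move=> xa; rewrite /lift_act; case: xgetP => [z _ [a1 xa1 [[e _] <-]]|/(_ a.2)[]].
  by rewrite (f_dart_inj xa1 xa e).
by exists a.
Qed.

Lemma lift_act_dart x b : vertex x -> dart (f x) b ->
  [/\ vertex (lift_act x b), f (lift_act x b) = b.2 &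
      lift_act (lift_act x b) (drev (f x) b) = x].
Proof.
move=> vx /(f_lift vx)[a xa <-]; rewrite (lift_actE xa); split=> //.
  by have /dartP[[]] := xa.
by rewrite -[drev _ _]/(fdart (drev x a)) lift_actE //; apply: dart_rev.
Qed.

Lemma lift_act_Sq x a b a' b' : vertex x -> Sq (f x) a b a' b' ->
  lift_act (lift_act x a) b' = lift_act (lift_act x b) a'.
Proof.
move=> vx S; have [s [_ [as_ bs _ _] _ _]] := Sq_cell X_npc S.
have [a1 xa1 ea] := f_lift vx (Sq_dart S); have [b1 xb1 eb] := f_lift vx (Sq_dart2 S).
have xs : f x <= s by apply: le_trans as_; apply: dart_le (Sq_dart S).
have [_ mono onto] := f_germ vx; have [c xc ec] := onto _ xs.
have ac : a1.1 <= c.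
  by rewrite -(f_le vx) ?(dart_le xa1) // ec -[f a1.1]/((fdart a1).1) ea.
have bc : b1.1 <= c.
  by rewrite -(f_le vx) ?(dart_le xb1) // ec -[f b1.1]/((fdart b1).1) eb.
have [|a2 [b2 [Q _ _]]] := Sq_ex xa1 xb1 _ ac bc.
  by move=> e; case: (Sq_neq S); rewrite -ea -eb e.
have Q' := f_Sq Q; rewrite ea eb in Q'; have [-> ->] := Sq_uniq X_npc S Q'.
rewrite -ea -eb (lift_actE xa1) (lift_actE xb1).
by rewrite (lift_actE (Sq_dart3 Q)) (lift_actE (Sq_dart4 Q)) (Sq_end Q).
Qed.

(** A walk from [u] to [v] has a closed image, whose lift at [u] is closed. *)
Lemma f_vertex_inj u v : vertex u -> vertex v -> f u = f v -> u = v.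
Proof.
move=> vu vv e; have [p rp ep] := red_ex X_npc X_conn vu vv.
have wp := red_walk rp.
have lift q z : walk z q -> foldl lift_act z (map fdart q) = wend z q /\
    (walk (f z) (map fdart q) /\ wend (f z) (map fdart q) = f (wend z q)).
  elim: q z => [|a q IH] z /=; first by move=> vz; split=> //; split=> //; apply: f_vertex.
  case/andP=> za /IH[e1 [e2 e3]]; rewrite lift_actE // e1 f_dart //.
have [e1 [w1 e2]] := lift p u wp; have [_ _ X_sc] := X_conn.
have := @monodromy X (cell X) (@vertex X) f lift_act lift_act_dart lift_act_Sq
  u (map fdart p) X_sc vu w1.
by rewrite e1 e2 ep => ->.
Qed.

(** Lift a walk that ends at [y]. *)
Lemma f_vertex_onto y : vertex y -> exists2 x, vertex x & f x = y.
Proof.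
move=> vy; have [[x vx] _ _] := X_conn.
have [p rp ep] := red_ex X_npc X_conn (f_vertex vx) vy.
have [vz ez] := @act_walk X (cell X) (@vertex X) f lift_act lift_act_dart _ _ vx (red_walk rp).
by exists (foldl lift_act x p) => //; rewrite ez.
Qed.

(** The vertices of [f c'] are joined by edges of [f c'], which lift to edges of
   [c']; so the vertices of [f c'] are images of vertices of [c']. *)
Lemma f_reflect c c' : (f c <= f c') = (c <= c').
Proof.
apply/idP/idP => [le|]; last exact: f_mono.
have [x vx xc] := vertex_below c; have [x' vx' xc'] := vertex_below c'.
have fxc' : f x <= f c' by apply: le_trans le; apply: f_mono.
have [u [vu uc' eu]] : exists u, [/\ vertex u, u <= c' & f u = f x].
  apply: (@cube_connected X (f c') (fun w => exists u, [/\ vertex u, u <= c' & f u = w])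
    _ (f x') (f x) _ (f_mono xc') _ fxc'); rewrite ?f_vertex //; last by exists x'.
  move=> w b wb bc' [u [vu uc' eu]]; rewrite -eu in wb.
  have [a ua ea] := f_lift vu wb; have /dartP[[_ _ va] lu la _] := ua.
  have ac' : a.1 <= c' by rewrite -(f_le vu) // -[f a.1]/((fdart a).1) ea.
  by exists a.2; split=> //; [apply: le_trans ac' | rewrite -ea].
have ux : u = x by apply: f_vertex_inj.
by rewrite -(f_le vx) // -ux.
Qed.

Lemma f_onto c' : exists c, f c = c'.
Proof.
have [y vy yc'] := vertex_below c'; have [x vx ex] := f_vertex_onto vy.
have [_ _ onto] := f_germ vx; have [|c _ <-] := onto c'; first by rewrite ex.
by exists c.
Qed.

Lemma f_inj : injective f.
Proof.
by move=> c c' e; apply/le_anti; rewrite -(f_reflect c c') -(f_reflect c' c) e lexx.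
Qed.

Lemma f_automorphism : automorphism f.
Proof.
split; last exact: f_reflect.
have /choice[r rP] := f_onto; exists r => // c; exact: f_inj.
Qed.

Lemma f_opposite e e' : opposite (f e) (f e') <-> opposite e e'.
Proof.
rewrite /opposite /edge !f_dim; split=> -[ee ee' [s [ds es e's]] no]; split=> //.
- have [d ed] := f_onto s; exists d; rewrite -ed f_dim !f_reflect in ds es e's.
  by split.
- by case=> v [ve ve']; apply: no; exists (f v); rewrite !f_reflect.
- by exists (f s); rewrite f_dim !f_reflect.
- case=> v; have [w <-] := f_onto v; rewrite !f_reflect => we.
  by apply: no; exists w.
Qed.

Lemma f_parallel e e' : parallel e e' -> parallel (f e) (f e').
Proof.
elim=> {e e'} [e e' op|e|e e' _|e e1 e' _ P1 _ P2].
- by apply: rst_step; apply/f_opposite.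
- exact: rst_refl.
- exact: parallel_sym.
- exact: parallel_trans P1 P2.
Qed.

Lemma f_parallel_lift e e2 : parallel (f e) e2 -> exists2 e', parallel e e' & f e' = e2.
Proof.
suff key e1 : clos_refl_sym_trans_1n _ (@opposite X) e1 e2 ->
    forall e, f e = e1 -> exists2 e', parallel e e' & f e' = e2.
  by move=> P; apply: key (clos_rst_rst1n _ _ _ _ P) _ _.
elim=> {e1 e2} [e1|e1 e2 e3 op _ IH] {}e ee; first by exists e => //; apply: rst_refl.
have [e2' e2E] := f_onto e2; have [e' P' <-] := IH e2' e2E.
exists e' => //; apply: parallel_trans P'; rewrite -ee -e2E in op.
by case: op => /f_opposite op; [|apply: parallel_sym]; apply: rst_step.
Qed.

Lemma f_hyperplane h h' e : hyperplane h -> hyperplane h' -> h e -> h' (f e) ->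
  f @` h = h'.
Proof.
move=> hh hh' he h'e; apply/seteqP; split=> [z [d hd <-]|z hz].
  by apply: (hyp_closed hh' h'e); apply: f_parallel; apply: hyp_parallel he hd.
have [d P <-] := f_parallel_lift (hyp_parallel hh' h'e hz).
by exists d => //; apply: hyp_closed he P.
Qed.

End Glue.

(** * Extension of automorphisms *)

Theorem proposition4p2 (L : scomplex) (X : cubeComplex)
    (L_finite : finite_scomplex L) (L_flag : flag L)
    (L_superstar : superstar_transitive L)
    (X_cat0 : cat0 X) (X_L : L_cube_complex L X)
    (H : set (set (cell X))) (H_finite : finite_set H)
    (H_hyperplanes : forall h, H h -> hyperplane h)
    (H_transverse : forall h h', H h -> H h' -> h <> h' -> transverse h h') :
  HAEP H.
Proof.
move=> g gP; have [X_conn X_npc] := X_cat0.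
have [H0|H0] := pselect (H !=set0); last first.
  have no m : ~ union_cells H m by case=> mH [h mh] _; apply: H0; exists h; apply: mH.
  exists id; split; first by split=> //; exists id.
    by apply/seteqP; split=> m; [case=> m' /no | move/no].
  by move=> m /no.
have [s eH] := (finite_seqP _).1 H_finite.
have inH h : (h \in s) <-> H h by rewrite eH.
have [x0 vx0 x0_H] := helly X_npc X_conn
  (fun h hs => H_hyperplanes h ((inH h).1 hs))
  (fun h h' hs hs' => H_transverse h h' ((inH h).1 hs) ((inH h').1 hs')).
pose G := uaut_cube H g; pose pi := uaut_hyp g.
have G_edge := uaut_edge H_hyperplanes gP.
have [f [f_germ f_neq fG]] := germ_system L_finite L_flag L_superstar X_npc X_conn
  X_L H_hyperplanes H_transverse G_edge (uaut_cube_le H_hyperplanes gP)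
  (uaut_cube_onto H_hyperplanes gP) (uaut_hyp_inj H_hyperplanes gP) vx0
  (fun h Hh => x0_H h ((inH h).2 Hh)) H0.
have f_hyp h : H h -> f @` h = uaut_hyp g h.
  move=> Hh; have [e ee he] := hyp_self (H_hyperplanes h Hh).
  have [Hp pe] := G_edge h e Hh he.
  apply: (f_hyperplane X_npc X_conn f_germ f_neq (H_hyperplanes h Hh)
    (H_hyperplanes _ Hp) he).
  by rewrite fG //; exists h => //; exists e.
have act m : union_cells H m -> ucell_act f m = g m.
  case: m => c T M; rewrite (uautE H_hyperplanes gP M) /ucell_act /=.
  have [TH [h Th] TC] := M; congr (_, _).
    by apply: fG; exists h; [apply: TH | apply: TC].
  by apply: eq_imagel => k Tk; apply: f_hyp; apply: TH.
exists f; split=> //; first exact: (f_automorphism X_npc X_conn f_germ f_neq).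
apply/seteqP; split=> m.
  by case=> n Hn <-; rewrite act //; apply: (uaut_cell gP).
by case/(uaut_onto gP) => n Hn en; exists n; rewrite ?act.
Qed.
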